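(* Let $0<p,q\le\infty$ and let $\mu\in C^1(\mathbb{R}^n)$ be real-valued such that, for some $s>0$ and $\epsilon>0$, $\langle\xi\rangle^{-s}\partial_j\mu(\xi)\in W^{\infty,\infty}_{n/(\dot p\wedge\dot q)+\epsilon}$ for $j=1,\dots,n$. Then for every $\delta>sn/(\dot p\wedge\dot q)$ the operator $e^{i\mu(D)}$ is bounded from $W^{p,q}_\delta$ to $W^{p,q}$, i.e. $\|e^{i\mu(D)}f\|_{W^{p,q}}\le C\|f\|_{W^{p,q}_\delta}$ for all $f\in\mathcal S(\mathbb{R}^n)$.
   Context: Fourier transform: $\hat f(\xi)=\int f(x)e^{-2\pi i x\cdot\xi}dx$. $\langle x\rangle=(1+|x|^2)^{1/2}$. For a fixed nonzero Schwartz window $\phi$, $V_\phi f(x,\xi)=\int f(y)\overline{\phi(y-x)}e^{-2\pi i y\cdot\xi}dy$. For $0<p,q\le\infty$, $s\in\mathbb{R}$, the Wiener amalgam space $W^{p,q}_s$ consists of $f\in\mathcal S'$ with $\|f\|_{W^{p,q}_s}=\big\|\,\|V_\phi f(x,\xi)\langle\xi\rangle^s\|_{L^q_\xi}\big\|_{L^p_x}<\infty$ (independent of $\phi$ up to equivalence); $W^{p,q}=W^{p,q}_0$. $\dot p=\min\{1,p\}$, $\dot q=\min\{1,q\}$, $\dot p\wedge\dot q=\min\{\dot p,\dot q\}$. $e^{i\mu(D)}f=\mathcal F^{-1}(e^{i\mu}\hat f)$. *)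

(* Defs.v *)
From HB Require Import structures.
From mathcomp Require Import all_boot all_order all_algebra.
From mathcomp Require Import all_classical all_reals all_analysis.
From mathcomp Require Import complex.
Set Implicit Arguments. Unset Strict Implicit. Unset Printing Implicit Defensive.
Import Order.TTheory GRing.Theory Num.Theory.
Import numFieldNormedType.Exports.
Local Open Scope classical_set_scope.
Local Open Scope ring_scope.

Section Amalgam.
Variable R : realType.

Definition dotp (n : nat) (x xi : 'rV[R]_n) : R := \sum_(i < n) x 0 i * xi 0 i.

Definition jbr (n : nat) (x : 'rV[R]_n) : R := Num.sqrt (1 + dotp x x).

Definition ebasis (n : nat) (j : 'I_n) : 'rV[R]_n := delta_mx 0 j.

(* Integral over R^n of a [0,+oo]-valued function, as the iterated Lebesgue
   integral over R (by Tonelli this is the integral against Lebesgue measure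
   on R^n for measurable nonnegative functions). *)
Fixpoint iint (n : nat) : ('rV[R]_n -> \bar R) -> \bar R :=
  match n return ('rV[R]_n -> \bar R) -> \bar R with
  | 0 => fun f => f 0
  | n'.+1 => fun f =>
      (\int[@lebesgue_measure R]_t
          iint (fun y : 'rV[R]_n' => f (row_mx (const_mx t : 'rV[R]_1) y)))%E
  end.

Definition integrable_n (n : nat) (f : 'rV[R]_n -> R) : Prop :=
  (iint (fun x => (`|f x|)%:E) < +oo)%E.

(* Lebesgue integral on R^n of a real function (meaningful for integrable f):
   integral of the positive part minus integral of the negative part *)
Definition rint (n : nat) (f : 'rV[R]_n -> R) : R :=
  fine (iint (fun x => (Num.max (f x) 0)%:E))
  - fine (iint (fun x => (Num.max (- f x) 0)%:E)).

Definition cint (n : nat) (f : 'rV[R]_n -> R[i]) : R[i] :=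
  (rint (fun x => complex.Re (f x)) +i* rint (fun x => complex.Im (f x)))%C.

(* Lebesgue-null subsets of R^n (for measurable sets) *)
Definition nulln (n : nat) (A : set 'rV[R]_n) : Prop :=
  iint (fun x => (\1_A x : R)%:E) = 0%E.

Definition esssupn (n : nat) (g : 'rV[R]_n -> \bar R) : \bar R :=
  ereal_inf [set t : \bar R | nulln [set x | (t < g x)%E]].

Definition Lpn (n : nat) (p : \bar R) (g : 'rV[R]_n -> \bar R) : \bar R :=
  if p == +oo%E then esssupn g
  else (iint (fun x => g x `^ fine p) `^ (fine p)^-1)%E.

Definition cexpi (t : R) : R[i] := (cos t +i* sin t)%C.

Definition RtoC (t : R) : R[i] := (t +i* 0)%C.

Definition fourier (n : nat) (f : 'rV[R]_n -> R[i]) (xi : 'rV[R]_n) : R[i] :=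
  cint (fun x => f x * cexpi (- (2 * pi * dotp x xi))).

Definition eimuD (n : nat) (mu : 'rV[R]_n -> R) (f : 'rV[R]_n -> R[i])
    (x : 'rV[R]_n) : R[i] :=
  cint (fun xi => cexpi (mu xi) * fourier f xi * cexpi (2 * pi * dotp x xi)).

(* fixed nonzero Schwartz window: the Gaussian phi(y) = exp(-pi |y|^2) *)
Definition gwin (n : nat) (y : 'rV[R]_n) : R := expR (- (pi * dotp y y)).

Definition stft (n : nat) (f : 'rV[R]_n -> R[i]) (x xi : 'rV[R]_n) : R[i] :=
  cint (fun y => f y * RtoC (gwin (y - x)) * cexpi (- (2 * pi * dotp y xi))).

Definition Wnorm (n : nat) (p q : \bar R) (s : R) (f : 'rV[R]_n -> R[i])
    : \bar R :=
  Lpn p (fun x => Lpn q (fun xi => (Normc.normc (stft f x xi) * jbr xi `^ s)%:E)).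

(* f (a locally integrable function, so that its STFT is given by absolutely
   convergent integrals) belongs to W^{p,q}_s *)
Definition inW (n : nat) (p q : \bar R) (s : R) (f : 'rV[R]_n -> R[i]) : Prop :=
  (forall x : 'rV[R]_n, integrable_n (fun y => Normc.normc (f y) * gwin (y - x)))
  /\ (Wnorm p q s f < +oo)%E.

Definition dotexp (p : \bar R) : R := fine (Order.min 1%E p).

Definition pderiv (n : nat) (js : seq 'I_n) (g : 'rV[R]_n -> R)
    : 'rV[R]_n -> R :=
  foldr (fun j h => 'D_(ebasis j) h) g js.

Definition C1 (n : nat) (g : 'rV[R]_n -> R) : Prop :=
  (forall x, differentiable g x) /\
  (forall j : 'I_n, continuous ('D_(ebasis j) g)).

Definition schwartzR (n : nat) (g : 'rV[R]_n -> R) : Prop :=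
  (forall (js : seq 'I_n) x, differentiable (pderiv js g) x) /\
  (forall (js : seq 'I_n) (k : nat), exists M : R,
      forall x, jbr x ^+ k * `|pderiv js g x| <= M).

Definition schwartz (n : nat) (f : 'rV[R]_n -> R[i]) : Prop :=
  schwartzR (fun x => complex.Re (f x)) /\ schwartzR (fun x => complex.Im (f x)).

End Amalgam.

(* Main.v *)
(** Put r = min(1,p,q), so that n/r < a <= N := n/r + eps and s a <= delta for some a.
    The heart of the matter is the bound
      |F(gauss_c(. - xi) e^{i mu})(x)| <= C <xi>^{s a} <x>^{-a}.
    Differentiating <.>^sg gauss_c(. - xi) e^{i mu} produces the factor
    D_j mu = <.>^s (<.>^{-s} D_j mu), and splitting off a Gaussian from the window turns
    <.>^{-s} D_j mu into a function whose Fourier transform is O(<.>^{-N}) by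
    hypothesis; convolution with <.>^{-N} preserves O(<.>^{-k}) for k <= N, so each
    integration by parts gains one power of <x>^{-1} and costs <xi>^s, and
    non-integer a is reached by interpolation between integers.
    Writing V for the short-time Fourier transform, it follows that
    T = |V(e^{i mu(D)} f)| and H = |V f| <xi>^delta are both <= K (H * j), where
    j(x,xi) = <x>^{-a} <xi>^{-a}.  As H is bounded, M(z) = sup_w j(z - w) H(w) is
    finite, H * j <= M^{1-r} (H^r * j^r), and the estimate for H itself bounds M^r by
    H^r * j^r; hence T^r <= C (H^r * j^r), where now j^r is integrable because a r > n,
    and Young's inequality applies in the exponents p/r, q/r >= 1. *)
Require Import Defs.
From HB Require Import structures.
From mathcomp Require Import all_boot all_order all_algebra.
From mathcomp Require Import all_classical all_reals all_analysis.
From mathcomp Require Import complex.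
From mathcomp Require Import measurable_realfun ring lra.
Set Implicit Arguments. Unset Strict Implicit. Unset Printing Implicit Defensive.
Import Order.TTheory GRing.Theory Num.Theory.
Import numFieldNormedType.Exports.
Local Open Scope classical_set_scope.
Local Open Scope ring_scope.
Local Notation normc := Normc.normc.
Local Notation Re := complex.Re.
Local Notation Im := complex.Im.

Definition rV_display : measure_display.
Proof. exact: (default_measure_display). Qed.

(** * Coordinate sigma-algebra on row vectors *)

Section measurable_rV.
Variables (R : realType) (n : nat).

Let coord : 'I_n -> 'rV[R]_n -> measurableTypeR R := fun i x => x 0 i.

Let rV_set0 : g_sigma_preimage coord set0.
Proof. exact: sigma_algebra0. Qed.

Let rV_setC A : g_sigma_preimage coord A -> g_sigma_preimage coord (~` A).
Proof. exact: sigma_algebraC. Qed.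

Let rV_bigcup (F : _^nat) : (forall i, g_sigma_preimage coord (F i)) ->
  g_sigma_preimage coord (\bigcup_i (F i)).
Proof. exact: sigma_algebra_bigcup. Qed.

HB.instance Definition _ := @isMeasurable.Build rV_display
  'rV[R]_n (g_sigma_preimage coord) rV_set0 rV_setC rV_bigcup.

Lemma measurable_coord (i : 'I_n) :
  measurable_fun setT (fun x : 'rV[R]_n => x 0 i : measurableTypeR R).
Proof.
move=> _ A mA; rewrite setTI; apply: sub_sigma_algebra.
by rewrite (bigD1 i)//=; left; exists A => //; rewrite setTI.
Qed.

End measurable_rV.

(** It suffices to test the generators of the sigma-algebra, which are preimages under single
    coordinates. *)
Lemma measurable_rVP (R : realType) n d (T : measurableType d) (f : T -> 'rV[R]_n) :
  (forall i, measurable_fun setT (fun t => f t 0 i : measurableTypeR R)) ->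
  measurable_fun setT f.
Proof.
move=> mf; apply: (@measurability _ _ _ _ setT f
  (\big[setU/set0]_(i < n) preimage_set_system setT
     ((fun i (x : 'rV[R]_n) => x 0 i : measurableTypeR R) i) measurable)) => //.
(* In dimension 0 the generating family is empty; reindexing through [inord] needs a successor. *)
case: n f mf => [|m] f mf A; first by rewrite big_ord0 => -[].
rewrite -bigcup_mkord_ord => -[_ [i _ [B mB <-]] <-].
rewrite (setTI (_ @^-1` B)) -comp_preimage; exact: (mf (inord i)).
Qed.

(** * Lebesgue measure on row vectors *)
Section leb.
Variable R : realType.

(** The same [row_mx] splitting as in the recursion of [iint], so that the two unfold in step. *)
Definition consrV n (ty : measurableTypeR R * 'rV[R]_n) : 'rV[R]_n.+1 :=
  row_mx (const_mx ty.1 : 'rV[R]_1) ty.2.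

Definition unconsrV n (x : 'rV[R]_n.+1) : measurableTypeR R * 'rV[R]_n :=
  (x 0 0, rsubmx (x : 'rV[R]_(1 + n))).

Lemma unconsrVK n : cancel (@unconsrV n) (@consrV n).
Proof.
move=> x; rewrite /consrV /unconsrV /=.
have -> : (const_mx (x 0 0) : 'rV[R]_1) = @lsubmx _ 1 1 n x.
  by apply/rowP => i; rewrite !mxE (ord1 i); congr (x _ _); apply: val_inj.
exact: (@hsubmxK _ 1 1 n x).
Qed.

Lemma consrVK n : cancel (@consrV n) (@unconsrV n).
Proof.
case=> t y; rewrite /consrV /unconsrV /= row_mxKr; congr pair.
have -> : 0 = lshift n (0 : 'I_1) by apply: val_inj.
by rewrite (@row_mxEl _ 1 1 n) mxE.
Qed.

Lemma measurable_consrV n : measurable_fun setT (@consrV n).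
Proof.
apply: measurable_rVP => i; rewrite /consrV.
case: (@splitP 1 n i) => j ij.
  have -> : (fun t : measurableTypeR R * 'rV[R]_n =>
      row_mx (const_mx t.1 : 'rV[R]_1) t.2 0 i) = fst.
    apply/funext => t; have -> : i = lshift n j by apply: val_inj.
    by rewrite (@row_mxEl _ 1 1 n) mxE.
  exact: measurable_fst.
have -> : (fun t : measurableTypeR R * 'rV[R]_n =>
    row_mx (const_mx t.1 : 'rV[R]_1) t.2 0 i) =
      (fun y : 'rV[R]_n => y 0 j : measurableTypeR R) \o snd.
  apply/funext => t; have -> : i = rshift 1 j by apply: val_inj.
  by rewrite (@row_mxEr _ 1 1 n).
exact: measurableT_comp (measurable_coord _) measurable_snd.
Qed.

Lemma measurable_unconsrV n : measurable_fun setT (@unconsrV n).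
Proof.
apply/measurable_fun_pairP; split; first exact: measurable_coord.
apply: measurable_rVP => i /=.
rewrite (_ : (fun _ => _) = (fun x : 'rV[R]_n.+1 => x 0 (rshift 1 i))).
  exact: measurable_coord.
by apply/funext => x; rewrite /unconsrV /= mxE.
Qed.

Section lebS.
Variables (n : nat) (m : {sigma_finite_measure set 'rV[R]_n -> \bar R}).

(** Transporting the product measure along [consrV] makes integration against [leb] follow the
    recursion of [iint]. *)
Definition lebS : set 'rV[R]_n.+1 -> \bar R :=
  pushforward (@lebesgue_measure R \x m)%E (@consrV n).

Let preimage_consrV A : measurable A -> measurable (@consrV n @^-1` A).
Proof. by move=> mA; rewrite -[X in measurable X]setTI; exact: measurable_consrV. Qed.

Let lebS0 : lebS set0 = 0%E.
Proof. by rewrite /lebS /pushforward preimage_set0 measure0. Qed.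

Let lebS_ge0 A : (0 <= lebS A)%E.
Proof. by rewrite /lebS /pushforward; exact: measure_ge0. Qed.

Let lebS_sigma_additive : semi_sigma_additive lebS.
Proof.
move=> F mF tF mUF; rewrite /lebS /pushforward preimage_bigcup.
apply: measure_semi_sigma_additive.
- by move=> i; exact: preimage_consrV.
- apply/trivIsetP => /= i j _ _ ij; rewrite -preimage_setI.
  by move/trivIsetP : tF => /(_ _ _ _ _ ij) ->//; rewrite preimage_set0.
- by rewrite -preimage_bigcup; exact: preimage_consrV.
Qed.

HB.instance Definition _ := isMeasure.Build _ _ _ lebS
  lebS0 lebS_ge0 lebS_sigma_additive.

Let lebS_sigma_finite : sigma_finite setT lebS.
Proof.
have /sigma_finiteP [F [F_T F_nd F_oo]] := sigma_finiteT (@lebesgue_measure R).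
have /sigma_finiteP [G [G_T G_nd G_oo]] := sigma_finiteT m.
exists (fun k => @unconsrV n @^-1` (F k `*` G k)).
  rewrite predeqE => x; split => // _.
  have [k _ Fk] : (\bigcup_k F k) (unconsrV x).1 by rewrite -F_T.
  have [l _ Gl] : (\bigcup_k G k) (unconsrV x).2 by rewrite -G_T.
  exists (maxn k l) => //; split.
    by move: (Fk); apply/subsetPset/F_nd/leq_maxl.
  by move: (Gl); apply/subsetPset/G_nd/leq_maxr.
move=> k; have [mF Foo] := F_oo k; have [mG Goo] := G_oo k.
have mFG := measurableX mF mG; split.
  by rewrite -[X in measurable X]setTI; exact: measurable_unconsrV.
rewrite /lebS /pushforward -comp_preimage.
rewrite (_ : _ \o _ = id); last by apply/funext => z /=; rewrite consrVK.
by rewrite preimage_id product_measure1E// lte_mul_pinfty// ge0_fin_numE.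
Qed.

HB.instance Definition _ := Measure_isSigmaFinite.Build _ _ _ lebS lebS_sigma_finite.
End lebS.

Definition leb0 : set 'rV[R]_0 -> \bar R := dirac (0 : 'rV[R]_0).
HB.instance Definition _ := Measure.on leb0.
Let leb0_sigma_finite : sigma_finite setT leb0.
Proof.
exists (fun=> setT) => [|_]; first by rewrite bigcup_const.
by split => //; rewrite /leb0 diracT ltry.
Qed.
HB.instance Definition _ := Measure_isSigmaFinite.Build _ _ _ leb0 leb0_sigma_finite.

Fixpoint leb n : {sigma_finite_measure set 'rV[R]_n -> \bar R} :=
  match n return {sigma_finite_measure set 'rV[R]_n -> \bar R} with
  | 0 => leb0
  | n'.+1 => lebS (leb n')
  end.

Local Open Scope ereal_scope.

Lemma integral_lebS n (f : 'rV[R]_n.+1 -> \bar R) :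
  measurable_fun setT f -> (forall x, 0 <= f x) ->
  \int[leb n.+1]_x f x = \int[@lebesgue_measure R]_t \int[leb n]_y f (consrV (t, y)).
Proof.
move=> mf f0; rewrite /= ge0_integral_pushforward//=; last exact: measurable_consrV.
rewrite (fubini_tonelli1 (f \o @consrV n))//.
  exact: measurableT_comp mf (@measurable_consrV n).
by move=> x; exact: f0.
Qed.

Lemma measurable_consrVl n (f : 'rV[R]_n.+1 -> \bar R) t :
  measurable_fun setT f -> measurable_fun setT (fun y => f (consrV (t, y))).
Proof.
move=> mf; apply: (measurableT_comp mf).
exact: (measurableT_comp (@measurable_consrV n)).
Qed.

(** The bridge from the iterated integrals of the statement to measure theory: each successor step
    is Tonelli's theorem in the form [integral_lebS]. *)
Lemma iintE n (f : 'rV[R]_n -> \bar R) :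
  measurable_fun setT f -> (forall x, 0 <= f x) -> iint f = \int[leb n]_x f x.
Proof.
elim: n f => [|n IH] f mf f0.
  by rewrite /= integral_dirac// diracT mul1e.
rewrite integral_lebS//=; apply: eq_integral => t _.
by rewrite IH//; exact: (measurable_consrVl t mf).
Qed.

Lemma measurable_integral_cons n (f : 'rV[R]_n.+1 -> \bar R) :
  measurable_fun setT f -> (forall x, 0 <= f x) ->
  measurable_fun setT (fun t : measurableTypeR R => \int[leb n]_y f (consrV (t, y))).
Proof.
move=> mf f0.
apply: (measurable_fun_fubini_tonelli_F (f \o @consrV n)) => [|z]; last exact: f0.
exact: measurableT_comp mf (@measurable_consrV n).
Qed.

End leb.
Global Opaque leb.

(** * Invariance under translation and reflection; monotonicity of integrals *)

Section shift.
Variable R : realType.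
Notation mu := (@lebesgue_measure R).
Local Open Scope ereal_scope.
(** Uniqueness of Lebesgue measure: the two measures agree on half-open intervals. *)
Lemma lebesgue_measure_shift (a : R) (A : set R) : measurable A ->
  pushforward mu ((fun t => t + a)%R : measurableTypeR R -> measurableTypeR R) A = mu A.
Proof.
have ms : measurable_fun setT ((fun t => t + a)%R : measurableTypeR R -> measurableTypeR R).
  exact: measurable_funD.
move=> mA; apply/esym/lebesgue_measure_unique => //= _ [[b c]] _ <-.
have -> : pushforward mu ((fun t => t + a)%R : measurableTypeR R -> measurableTypeR R)
    `]b, c] = mu `](b - a)%R, (c - a)%R].
  rewrite /pushforward; congr (mu _); apply/seteqP; split => t /=;
    rewrite !in_itv/= => /andP[? ?]; apply/andP; split; lra.
by rewrite !lebesgue_measure_itv/= !lte_fin ltrD2r -!EFinB opprB addrA subrK.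
Qed.

Lemma integral_shift1 (a : R) (f : R -> \bar R) :
  measurable_fun setT f -> (forall t, 0 <= f t) ->
  \int[mu]_t f (t + a)%R = \int[mu]_t f t.
Proof.
move=> mf f0.
have ms : measurable_fun setT ((fun t => t + a)%R : measurableTypeR R -> measurableTypeR R).
  exact: measurable_funD.
rewrite -[LHS](@ge0_integral_pushforward _ _ _ _ _ _ ms mu setT f)//.
by apply: eq_measure_integral => /= A mA _; exact: lebesgue_measure_shift.
Qed.

Lemma integral_opp1 (f : R -> \bar R) :
  measurable_fun setT f -> (forall t, 0 <= f t) ->
  \int[mu]_t f (- t)%R = \int[mu]_t f t.
Proof.
move=> mf f0.
have ms : measurable_fun setT (-%R : measurableTypeR R -> measurableTypeR R).
  exact: oppr_measurable.
rewrite -[LHS](@ge0_integral_pushforward _ _ _ _ _ _ ms mu setT f)//.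
by apply: eq_measure_integral => /= A mA _; exact: lebesgue_measureN.
Qed.

Lemma measurable_rVD n (a : 'rV[R]_n) : measurable_fun setT (fun x : 'rV[R]_n => x + a)%R.
Proof.
apply: measurable_rVP => i.
rewrite (_ : (fun _ => _) = (fun x : 'rV[R]_n => x 0 i + a 0 i)%R).
  by apply: measurable_funD => //; exact: measurable_coord.
by apply/funext => x; rewrite mxE.
Qed.

Lemma measurable_rVN n : measurable_fun setT (fun x : 'rV[R]_n => - x)%R.
Proof.
apply: measurable_rVP => i.
rewrite (_ : (fun _ => _) = (fun x : 'rV[R]_n => - x 0 i)%R).
  by apply: measurable_funN; exact: measurable_coord.
by apply/funext => x; rewrite mxE.
Qed.

Lemma consrVD n (t t' : R) (y y' : 'rV[R]_n) :
  (consrV (t, y) + consrV (t', y') = consrV (t + t', y + y'))%R.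
Proof.
rewrite /consrV /= (@add_row_mx _ 1 1 n).
by rewrite (_ : const_mx t + const_mx t' = const_mx (t + t'))%R//; apply/rowP => i; rewrite !mxE.
Qed.

Lemma consrVN n (t : R) (y : 'rV[R]_n) : (- consrV (t, y) = consrV (- t, - y))%R.
Proof.
rewrite /consrV /= (@opp_row_mx _ 1 1 n).
by rewrite (_ : - const_mx t = const_mx (- t))%R//; apply/rowP => i; rewrite !mxE.
Qed.

(** Induction on the dimension: [consrV] is additive, so the leading coordinate is shifted by
    one-dimensional invariance and the others by the induction hypothesis. *)
Lemma integral_rVD n (a : 'rV[R]_n) (f : 'rV[R]_n -> \bar R) :
  measurable_fun setT f -> (forall x, 0 <= f x) ->
  \int[leb R n]_x f (x + a)%R = \int[leb R n]_x f x.
Proof.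
elim: n a f => [|n IH] a f mf f0.
  by apply: eq_integral => x _; congr f; apply/rowP => -[].
have mfa := measurableT_comp mf (measurable_rVD a).
rewrite (integral_lebS mfa (fun=> f0 _)) (integral_lebS mf f0).
rewrite -(@integral_shift1 (unconsrV a).1 (fun t => \int[leb R n]_y f (consrV (t, y)))).
- apply: eq_integral => t _.
  rewrite -(IH (unconsrV a).2 _ (measurable_consrVl (t + (unconsrV a).1)%R mf) (fun=> f0 _)).
  apply: eq_integral => y _.
  by rewrite -{1}(unconsrVK a) -consrVD; case: (unconsrV a).
- exact: measurable_integral_cons.
- by move=> t; apply: integral_ge0.
Qed.

Lemma integral_rVN n (f : 'rV[R]_n -> \bar R) :
  measurable_fun setT f -> (forall x, 0 <= f x) ->
  \int[leb R n]_x f (- x)%R = \int[leb R n]_x f x.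
Proof.
elim: n f => [|n IH] f mf f0.
  by apply: eq_integral => x _; congr f; apply/rowP => -[].
have mfa := measurableT_comp mf (@measurable_rVN n.+1).
rewrite (integral_lebS mfa (fun=> f0 _)) (integral_lebS mf f0).
rewrite -(@integral_opp1 (fun t => \int[leb R n]_y f (consrV (t, y)))).
- apply: eq_integral => t _.
  rewrite -(IH _ (measurable_consrVl (- t)%R mf) (fun=> f0 _)).
  by apply: eq_integral => y _; rewrite /= consrVN.
- exact: measurable_integral_cons.
- by move=> t; apply: integral_ge0.
Qed.

Lemma integral_rVB n (a : 'rV[R]_n) (f : 'rV[R]_n -> \bar R) :
  measurable_fun setT f -> (forall x, 0 <= f x) ->
  \int[leb R n]_x f (a - x)%R = \int[leb R n]_x f x.
Proof.
move=> mf f0; rewrite -(integral_rVD a mf f0).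
rewrite -(@integral_rVN _ (fun x => f (x + a)%R))//; last exact: measurableT_comp mf (measurable_rVD a).
by apply: eq_integral => x _; rewrite addrC.
Qed.

(* No measurability: [nnintegral] is a supremum over simple functions below. *)
Lemma ge0_le_integral_nm d (T : measurableType d) (m : {measure set T -> \bar R})
    (f g : T -> \bar R) : (forall x, 0 <= f x) -> (forall x, f x <= g x) ->
  \int[m]_x f x <= \int[m]_x g x.
Proof.
move=> f0 fg.
have g0 x : 0 <= g x by exact: le_trans (fg x).
rewrite !ge0_integralTE//; apply: le_ereal_sup => _ [h hf <-].
by exists h => // x; exact: le_trans (hf x) (fg x).
Qed.

Lemma iint_ge0 n (f : 'rV[R]_n -> \bar R) : (forall x, 0 <= f x) -> 0 <= iint f.
Proof.
by elim: n f => [|n IH] f f0 //=; apply: integral_ge0 => t _; exact: IH.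
Qed.

Lemma le_iint n (f g : 'rV[R]_n -> \bar R) : (forall x, 0 <= f x) ->
  (forall x, f x <= g x) -> iint f <= iint g.
Proof.
elim: n f g => [|n IH] f g f0 fg //=.
apply: ge0_le_integral_nm => t; first exact: iint_ge0.
exact: IH.
Qed.
End shift.

(** * Borel sets, Gaussians and the weights <x>^s *)

Section borel.
Variable R : realType.
(** An open set is the union of the cubes inside it with rational centers and radii 1/(k+1), a
    countable family. This links the topology to the sigma-algebra generated by the coordinates. *)
Lemma open_measurable_rV n (U : set 'rV[R]_n) : open U -> measurable U.
Proof.
move=> oU.
pose B (qk : 'rV[rat]_n * nat) : set 'rV[R]_n :=
  [set y | forall i, `|ratr (qk.1 0 i) - y 0 i| < (qk.2.+1%:R)^-1].
pose F qk := if `[< B qk `<=` U >] then B qk else set0.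
have mB qk : measurable (B qk).
  rewrite (_ : B qk = \bigcap_(i in [set: 'I_n])
      ((fun y : 'rV[R]_n => `|ratr (qk.1 0 i) - y 0 i|) @^-1` `]-oo, (qk.2.+1%:R)^-1[)); last first.
    apply/seteqP; split => [y By i _|y By i].
      by rewrite /= in_itv; exact: By.
    by have := By i Logic.I; rewrite /= in_itv.
  apply: fin_bigcap_measurable => [|i _]; first exact: finite_finset.
  rewrite -[X in measurable X]setTI.
  apply: (_ : measurable_fun setT (fun y : 'rV[R]_n => `|ratr (qk.1 0 i) - y 0 i|)) => //.
  apply: measurableT_comp => //; apply: measurable_funB => //.
  exact: measurable_coord.
have -> : U = \bigcup_qk F qk.
  apply/seteqP; split => [x Ux|x [qk _]]; last first.
    by rewrite /F; case: asboolP => // + Bx => /(_ _ Bx).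
  have /nbhs_ballP[e /= e0 eU] : nbhs x U by exact: open_nbhs_nbhs.
  (* Half of [e]: two points of the same cube differ by less than 2/(k+1) in each coordinate. *)
  have [k ke] : exists k : nat, (k.+1%:R)^-1 < e / 2.
    have [k _ /(_ k (leqnn k)) ke] := near_infty_natSinv_lt (PosNum (divr_gt0 e0 (ltr0n R 2))).
    by exists k.
  have k0 : 0 < (k.+1%:R : R)^-1 by rewrite invr_gt0.
  have /choice[q qP] i : exists q : rat, `|ratr q - x 0 i| < (k.+1%:R)^-1.
    have /rat_in_itvoo[q] : x 0 i - (k.+1%:R)^-1 < x 0 i + (k.+1%:R)^-1.
      by rewrite ltrBlDr -addrA ltrDl addr_gt0.
    by rewrite in_itv/= => /andP[q1 q2]; exists q; rewrite ltr_distl q1.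
  have Bx : B (\row_i q i, k) x by move=> i /=; rewrite mxE.
  exists (\row_i q i, k) => //; rewrite /F.
  case: asboolP => // -[] y By; apply: eU; split => // i j.
  rewrite (ord1 i) /ball/=.
  have := By j; have := Bx j; rewrite /= mxE => xq yq.
  have : `|x 0 j - y 0 j| <= `|ratr (q j) - x 0 j| + `|ratr (q j) - y 0 j|.
    rewrite [X in _ <= X + _]distrC.
    rewrite (_ : x 0 j - y 0 j = (x 0 j - ratr (q j)) + (ratr (q j) - y 0 j)); last by ring.
    exact: ler_normD.
  move: xq yq ke; move: (k.+1%:R^-1) => r; lra.
apply: countable_bigcupT_measurable => [|qk]; first exact: countableP.
by rewrite /F; case: ifP.
Qed.

Lemma continuous_measurable_rV n (f : 'rV[R]_n -> R) :
  continuous f -> measurable_fun setT f.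
Proof.
move=> cf; apply: (measurability _ (RGenOpens.measurableE R)).
move=> _ [_ [a [b ->] <-]]; rewrite setTI; apply: open_measurable_rV.
by apply: open_comp => // x _; exact: cf.
Qed.

Lemma measurable_dotp n d (T : measurableType d) (f g : T -> 'rV[R]_n) :
  measurable_fun setT f -> measurable_fun setT g ->
  measurable_fun setT (fun t => dotp (f t) (g t)).
Proof.
move=> mf mg; apply: measurable_sum => i.
apply: measurable_funM.
  exact: measurableT_comp (measurable_coord i) mf.
exact: measurableT_comp (measurable_coord i) mg.
Qed.

Lemma dotpC n (x y : 'rV[R]_n) : dotp x y = dotp y x.
Proof. by apply: eq_bigr => i _; rewrite mulrC. Qed.

Lemma dotpDl n (x y z : 'rV[R]_n) : dotp (x + y) z = dotp x z + dotp y z.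
Proof. by rewrite /dotp -big_split; apply: eq_bigr => i _; rewrite mxE mulrDl. Qed.

Lemma dotpZl n a (x z : 'rV[R]_n) : dotp (a *: x) z = a * dotp x z.
Proof. by rewrite /dotp mulr_sumr; apply: eq_bigr => i _; rewrite mxE mulrA. Qed.

Lemma dotpNl n (x z : 'rV[R]_n) : dotp (- x) z = - dotp x z.
Proof. by rewrite -scaleN1r dotpZl mulN1r. Qed.

Lemma dotpDr n (x y z : 'rV[R]_n) : dotp z (x + y) = dotp z x + dotp z y.
Proof. by rewrite dotpC dotpDl !(dotpC z). Qed.

Lemma dotpZr n a (x z : 'rV[R]_n) : dotp z (a *: x) = a * dotp z x.
Proof. by rewrite dotpC dotpZl dotpC. Qed.

Lemma dotpNr n (x z : 'rV[R]_n) : dotp z (- x) = - dotp z x.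
Proof. by rewrite dotpC dotpNl dotpC. Qed.

Lemma dotp_ge0 n (x : 'rV[R]_n) : 0 <= dotp x x.
Proof. by apply: sumr_ge0 => i _; rewrite -expr2 sqr_ge0. Qed.

Lemma dotp_consrV n t s (y z : 'rV[R]_n) :
  dotp (consrV (t, y)) (consrV (s, z)) = t * s + dotp y z.
Proof.
rewrite /dotp big_ord_recl /consrV /=; congr (_ + _).
  have -> : ord0 = lshift n (0 : 'I_1) by apply: val_inj.
  by rewrite !(@row_mxEl _ 1 1 n) !mxE.
apply: eq_bigr => i _.
have -> : lift ord0 i = rshift 1 i by apply: val_inj.
by rewrite !(@row_mxEr _ 1 1 n).
Qed.

(** With pi in the exponent, [gauss c] has integral c^(-n/2) and Fourier transform c^(-n/2) [gauss]
    (1/c); [gauss 1] is the window and is its own transform. Exponents add under multiplication,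
    which is how windows are split later. *)
Definition gauss n (c : R) (x : 'rV[R]_n) : R := expR (- (c * pi * dotp x x)).

Lemma gauss_ge0 n c (x : 'rV[R]_n) : 0 <= gauss c x. Proof. exact: expR_ge0. Qed.
Lemma gwinE n (x : 'rV[R]_n) : gwin x = gauss 1 x.
Proof. by rewrite /gwin /gauss mul1r. Qed.

Lemma gaussN n c (x : 'rV[R]_n) : gauss c (- x) = gauss c x.
Proof. by rewrite /gauss dotpNl dotpNr opprK. Qed.

Lemma measurable_gauss n c d (T : measurableType d) (f : T -> 'rV[R]_n) :
  measurable_fun setT f -> measurable_fun setT (fun t => gauss c (f t)).
Proof.
move=> mf; apply: (measurableT_comp (@measurable_expR R)).
by apply: measurable_funN; apply: measurable_funM => //; exact: measurable_dotp.
Qed.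

(** Read off from the total mass of a normal density. *)
Lemma integral_gauss1 (c : R) : 0 < c ->
  (\int[@lebesgue_measure R]_t (expR (- (c * pi * t ^+ 2)))%:E = ((Num.sqrt c)^-1)%:E)%E.
Proof.
move=> c0.
(* The standard deviation with 1/(2 s^2) = pi c; the peak of the density is then sqrt c. *)
pose s : R := (Num.sqrt (2 * pi * c))^-1.
have pc0 : 0 < 2 * pi * c by rewrite !mulr_gt0// pi_gt0.
have s0 : s != 0 by rewrite invr_neq0// gt_eqF// sqrtr_gt0.
have s2 : s ^+ 2 = (2 * pi * c)^-1 by rewrite exprVn sqr_sqrtr// ltW.
have peak : normal_peak s = Num.sqrt c.
  rewrite /normal_peak s2 -sqrtrV; last by rewrite -mulr_natr mulr_ge0// mulr_ge0 ?pi_ge0// invr_ge0 ltW.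
  congr Num.sqrt; rewrite -mulr_natr; move: (gt_eqF (pi_gt0 R)); move: pi => P /negbT P0.
  by field; rewrite P0 gt_eqF.
have := integral_normal_pdf (0 : R) s.
under eq_integral => t _.
  rewrite normal_pdfE//= peak /normal_fun s2 subr0.
  rewrite (_ : - t ^+ 2 / _ = - (c * pi * t ^+ 2)); last first.
    rewrite -mulr_natr; move: (gt_eqF (pi_gt0 R)); move: pi => P /negbT P0.
  by field; rewrite P0 gt_eqF.
  rewrite EFinM.
  over.
rewrite ge0_integralZl//=.
- move=> H.
  have : (((Num.sqrt c)^-1)%:E * ((Num.sqrt c)%:E * \int[lebesgue_measure]_x (expR (- (c * pi * x ^+ 2)))%:E)
     = ((Num.sqrt c)^-1)%:E * 1)%E by rewrite H.
  rewrite muleA -EFinM mulVf; last by rewrite gt_eqF// sqrtr_gt0.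
  by rewrite mul1e mule1.
- apply/measurable_EFinP; apply: (measurableT_comp (@measurable_expR R)).
  by apply: measurable_funN; apply: measurable_funM => //; exact: measurable_funX.
Qed.

Lemma integral_gauss n (c : R) : 0 < c ->
  (\int[leb R n]_x (gauss c x)%:E = ((Num.sqrt c)^-1 ^+ n)%:E)%E.
Proof.
move=> c0; elim: n => [|n IH].
  rewrite -iintE/=; last 2 first.
    by apply/measurable_EFinP; exact: measurable_gauss.
    by move=> x; rewrite lee_fin gauss_ge0.
  by rewrite /gauss /dotp big_ord0 mulr0 oppr0 expR0.
rewrite integral_lebS; last 2 first.
    by apply/measurable_EFinP; exact: measurable_gauss.
    by move=> x; rewrite lee_fin gauss_ge0.
transitivity (\int[@lebesgue_measure R]_t (((Num.sqrt c)^-1 ^+ n)%:E * (expR (- (c * pi * t ^+ 2)))%:E))%E.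
  apply: eq_integral => t _.
  rewrite -IH muleC -ge0_integralZl//=.
  - apply: eq_integral => y _.
    by rewrite -EFinM /gauss dotp_consrV mulrDr opprD expRD.
  - by apply/measurable_EFinP; exact: measurable_gauss.
  - by move=> y _; rewrite lee_fin gauss_ge0.
rewrite ge0_integralZl//=.
- by rewrite integral_gauss1// -EFinM exprSr.
- apply/measurable_EFinP; apply: (measurableT_comp (@measurable_expR R)).
  by apply: measurable_funN; apply: measurable_funM => //; exact: measurable_funX.
Qed.

Lemma jbr_ge1 n (x : 'rV[R]_n) : 1 <= jbr x.
Proof. by rewrite -[leLHS]sqrtr1 ler_sqrt ?lerDl ?addr_ge0 ?dotp_ge0. Qed.

Lemma jbr_gt0 n (x : 'rV[R]_n) : 0 < jbr x.
Proof. exact: lt_le_trans ltr01 (jbr_ge1 x). Qed.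

Lemma jbr_ge0 n (x : 'rV[R]_n) : 0 <= jbr x. Proof. exact/ltW/jbr_gt0. Qed.

Lemma jbr_sqr n (x : 'rV[R]_n) : jbr x ^+ 2 = 1 + dotp x x.
Proof. by rewrite sqr_sqrtr// addr_ge0// dotp_ge0. Qed.

Lemma jbrN n (x : 'rV[R]_n) : jbr (- x) = jbr x.
Proof. by rewrite /jbr dotpNl dotpNr opprK. Qed.

Lemma jbr0 n : jbr (0 : 'rV[R]_n) = 1.
Proof. by rewrite /jbr -(scale0r 0) dotpZl mul0r addr0 sqrtr1. Qed.

Lemma jbr_sqrD n (x y : 'rV[R]_n) : jbr (x + y) ^+ 2 <= 2 * (jbr x ^+ 2 + jbr y ^+ 2).
Proof.
rewrite !jbr_sqr dotpDl !dotpDr (dotpC y x).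
have := dotp_ge0 (x - y); rewrite dotpDl !dotpDr !dotpNl !dotpNr (dotpC y x) opprK.
have := dotp_ge0 x; have := dotp_ge0 y; lra.
Qed.

Lemma jbrD_sum n (x y : 'rV[R]_n) : jbr (x + y) <= 2 * (jbr x + jbr y).
Proof.
rewrite -ler_sqr ?nnegrE ?jbr_ge0 ?mulr_ge0 ?addr_ge0 ?jbr_ge0//.
apply: le_trans (jbr_sqrD x y) _.
have := jbr_ge0 x; have := jbr_ge0 y; nra.
Qed.

Lemma jbrD_prod n (x y : 'rV[R]_n) : jbr (x + y) <= 2 * (jbr x * jbr y).
Proof.
rewrite -ler_sqr ?nnegrE ?jbr_ge0 ?mulr_ge0 ?jbr_ge0//.
apply: le_trans (jbr_sqrD x y) _.
have x1 := jbr_ge1 x; have y1 := jbr_ge1 y.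
have : 1 <= jbr x ^+ 2 by rewrite exprn_ege1.
have : 1 <= jbr y ^+ 2 by rewrite exprn_ege1.
rewrite !exprMn; move: (jbr x ^+ 2) (jbr y ^+ 2) => a b; nra.
Qed.

(** Peetre's inequality. A negative exponent is reduced to a positive one by writing x = (x + y) -
    y. *)
Lemma jbr_powRD n (s : R) (x y : 'rV[R]_n) :
  jbr (x + y) `^ s <= 2 `^ `|s| * (jbr x `^ s * jbr y `^ `|s|).
Proof.
have [s0|s0] := leP 0 s.
  rewrite ger0_norm// -powRM ?jbr_ge0// -powRM ?mulr_ge0 ?jbr_ge0//.
  by apply: ge0_ler_powR; rewrite ?nnegrE ?mulr_ge0 ?jbr_ge0 ?jbrD_prod.
rewrite ltr0_norm// -{1 3}(opprK s) 2!(powRN _ (- s)).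
have : jbr x `^ (- s) <= 2 `^ (- s) * (jbr (x + y) `^ (- s) * jbr y `^ (- s)).
  rewrite -powRM ?jbr_ge0// -powRM ?mulr_ge0 ?jbr_ge0//.
  apply: ge0_ler_powR; rewrite ?nnegrE ?mulr_ge0 ?jbr_ge0//; first by rewrite oppr_ge0 ltW.
  by have := jbrD_prod (x + y) (- y); rewrite addrK jbrN.
have A0 : 0 < jbr (x + y) `^ (- s) by rewrite powR_gt0 ?jbr_gt0.
have B0 : 0 < jbr x `^ (- s) by rewrite powR_gt0 ?jbr_gt0.
move: (jbr (x + y) `^ (- s)) (jbr x `^ (- s)) (jbr y `^ (- s)) (2 `^ (- s)) A0 B0 => A B C D A0 B0 H.
rewrite (_ : D * (B^-1 * C) = D * C / B); last by ring.
by rewrite ler_pdivlMr// mulrC ler_pdivrMr// -mulrA (mulrC C).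
Qed.

Lemma ler_coord_jbr n (x : 'rV[R]_n) i : `|x 0 i| <= jbr x.
Proof.
rewrite -sqrtr_sqr /jbr ler_sqrt ?addr_ge0 ?dotp_ge0//.
rewrite /dotp (bigD1 i)//= -expr2 addrCA lerDl addr_ge0// sumr_ge0// => j _.
by rewrite -expr2 sqr_ge0.
Qed.

Lemma measurable_jbr n d (T : measurableType d) (f : T -> 'rV[R]_n) :
  measurable_fun setT f -> measurable_fun setT (fun t => jbr (f t)).
Proof.
move=> mf; apply: (measurableT_comp (continuous_measurable_fun (@sqrt_continuous R))).
by apply: measurable_funD => //; exact: measurable_dotp.
Qed.

Lemma measurable_jbr_powR n d (T : measurableType d) (f : T -> 'rV[R]_n) s :
  measurable_fun setT f -> measurable_fun setT (fun t => jbr (f t) `^ s).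
Proof.
by move=> mf; apply: (measurableT_comp (measurable_powR s)); exact: measurable_jbr.
Qed.

(** For M > 0 this is u <= exp u with u = l <x>^2, raised to the power M/2. *)
Lemma gauss_le_jbr n (c M : R) : 0 < c ->
  exists2 C, 0 < C & forall x : 'rV[R]_n, gauss c x <= C * jbr x `^ (- M).
Proof.
move=> c0.
wlog M0 : M / 0 < M.
  move=> H; have [M0|M0] := ltP 0 M; first exact: H.
  have [C C0 HC] := H 1 ltr01; exists C => // x.
  apply: le_trans (HC x) _; rewrite ler_pM2l//.
  by apply: ler_powR; [exact: jbr_ge1|lra].
have cpi0 : 0 < c * pi by rewrite mulr_gt0// pi_gt0.
(* Chosen so that l M/2 = c pi, the rate of the Gaussian; the leftover factor is exp(c pi). *)
pose l := c * pi / (M / 2).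
have l0 : 0 < l by rewrite !divr_gt0.
exists (l `^ (- (M / 2)) * expR (c * pi)); first by rewrite mulr_gt0 ?powR_gt0 ?expR_gt0.
move=> x; rewrite /gauss expRN powRN.
rewrite powRN.
have m0 : 0 < M / 2 by rewrite divr_gt0.
have H : l `^ (M / 2) * jbr x `^ M <= expR (c * pi) * expR (c * pi * dotp x x).
  rewrite (_ : jbr x `^ M = (1 + dotp x x) `^ (M / 2)); last first.
    by rewrite -jbr_sqr -powR_mulrn ?jbr_ge0// -powRrM; congr (_ `^ _); field.
  rewrite -powRM; [|exact: ltW|by rewrite addr_ge0 ?dotp_ge0].
  rewrite -expRD -{1}(mulr1 (c * pi)) -mulrDr.
  rewrite (_ : c * pi = l * (M / 2)); last by rewrite /l mulfVK// gt_eqF.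
  rewrite [l * _ * _](_ : _ = l * (1 + dotp x x) * (M / 2)); last by ring.
  have d0 : 0 <= l * (1 + dotp x x) by apply: mulr_ge0; [exact: ltW|rewrite addr_ge0// dotp_ge0].
  rewrite expRM; apply: ge0_ler_powR => //; first exact: ltW.
    by rewrite nnegrE expR_ge0.
  by apply: le_trans (expR_ge1Dx _); rewrite lerDr.
have A0 : 0 < l `^ (M / 2) by rewrite powR_gt0.
have B0 : 0 < jbr x `^ M by rewrite powR_gt0 ?jbr_gt0.
have C0 := expR_gt0 (c * pi * dotp x x).
move: (l `^ (M / 2)) (jbr x `^ M) (expR (c * pi * dotp x x)) (expR (c * pi)) A0 B0 C0 H => A B C D A0 B0 C0 H.
rewrite (_ : A^-1 * D * B^-1 = D / (A * B)); last by rewrite invfM; ring.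
by rewrite ler_pdivlMr ?mulr_gt0// mulrC ler_pdivrMr.
Qed.

Lemma nneseries_geometric_lty (z : R) : 0 <= z -> z < 1 ->
  (\sum_(k <oo) (z ^+ k)%:E < +oo)%E.
Proof.
move=> z0 z1.
have cz : geometric 1 z = (fun k => z ^+ k) by apply/funext => k; rewrite /geometric/= mul1r.
have H := @cvg_geometric_series R 1 z; rewrite ger0_norm// in H.
have {}H := H z1.
rewrite (_ : (\sum_(k <oo) _)%E = (1 / (1 - z))%:E) ?ltry//.
apply/cvg_lim => //.
rewrite (_ : (fun n => _) = EFin \o series (geometric 1 z)); last first.
  by apply/funext => n /=; rewrite /series/= -sumEFin; apply: eq_bigr => i _; rewrite /geometric/= mul1r.
by apply: cvg_EFin; [near=> k|exact: H].
Unshelve. all: by end_near. Qed.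

(* Dyadic superposition of Gaussians: on the shell [2 ^ k <= jbr x < 2 ^ k.+1] the
   Gaussian of width [2 ^ k] is bounded below. *)
Lemma jbr_powR_le_gauss n (a : R) (x : 'rV[R]_n) : 0 < a ->
  ((jbr x `^ (- a))%:E <=
   \sum_(k <oo) (expR (4 * pi) * (2 `^ (- a)) ^+ k * gauss ((4 ^+ k)^-1) x)%:E)%E.
Proof.
move=> a0.
have exk : exists k, jbr x < 2 ^+ k.
  exists (Num.bound (jbr x)); apply: lt_le_trans (archi_boundP (jbr_ge0 x)) _.
  by rewrite -natrX ler_nat ltnW// ltn_expl.
case: (ex_minnP exk) => -[|k] kP kmin.
  by move: kP; rewrite expr0 ltNge jbr_ge1.
have kx : 2 ^+ k <= jbr x.
  by rewrite leNgt; apply/negP => /kmin; rewrite ltnn.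
pose u i := (expR (4 * pi) * (2 `^ (- a)) ^+ i * gauss ((4 ^+ i)^-1) x)%:E.
have u0 i : (0 <= u i)%E.
  by rewrite lee_fin !mulr_ge0 ?expR_ge0 ?exprn_ge0 ?powR_ge0.
apply: (@le_trans _ _ (u k)); last first.
  apply: (le_trans _ (@nneseries_lim_ge R u xpredT 0 k.+1 _)) => //.
  by rewrite big_nat_recr//= leeDr// sume_ge0.
rewrite lee_fin.
have E1 : jbr x `^ (- a) <= (2 `^ (- a)) ^+ k.
  rewrite -powR_mulrn ?powR_ge0// powRAC powR_mulrn// !powRN.
  rewrite lef_pV2 ?posrE ?powR_gt0 ?exprn_gt0 ?jbr_gt0//.
  by apply: ge0_ler_powR => //; rewrite ?nnegrE ?exprn_ge0 ?jbr_ge0// ltW.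
apply: (le_trans E1); rewrite mulrAC ler_peMl ?exprn_ge0 ?powR_ge0//.
rewrite /gauss -expRD -[leLHS]expR0 ler_expR.
(* On the shell 4^(-k) |x|^2 <= 4, which is the origin of the factor exp(4 pi) in the series. *)
have dk : (4 ^+ k)^-1 * dotp x x <= 4.
  rewrite mulrC ler_pdivrMr ?exprn_gt0//.
  apply: (@le_trans _ _ (jbr x ^+ 2)); first by rewrite jbr_sqr lerDr.
  rewrite -exprS (_ : 4 ^+ k.+1 = (2 ^+ k.+1) ^+ 2 :> R); last first.
    by rewrite -exprM mulnC exprM; congr (_ ^+ _); rewrite -natrX.
  by rewrite ler_sqr ?nnegrE ?jbr_ge0 ?exprn_ge0// ltW.
rewrite mulrAC subr_ge0; apply: ler_wpM2r dk; exact: pi_ge0.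
Qed.

(** The Gaussian at scale 2^k has integral 2^(k n), so the dyadic series of [jbr_powR_le_gauss]
    integrates to a geometric series of ratio 2^(n - a) < 1. *)
Lemma integral_jbr_lty n (a : R) : n%:R < a ->
  (\int[leb R n]_x (jbr x `^ (- a))%:E < +oo)%E.
Proof.
move=> na.
have a0 : 0 < a by apply: le_lt_trans na; rewrite ler0n.
have r0 : 0 <= 2 `^ (- a) * 2 ^+ n :> R by rewrite mulr_ge0 ?powR_ge0// exprn_ge0.
have r1 : 2 `^ (- a) * 2 ^+ n < 1 :> R.
  rewrite -powR_mulrn// -powRD; last by rewrite pnatr_eq0 implybT.
  rewrite /powR pnatr_eq0/= -[ltRHS]expR0 ltr_expR pmulr_llt0 ?ln_gt0 ?ltr1n//.
  by rewrite addrC subr_lt0.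
apply: (@le_lt_trans _ _ (\int[leb R n]_x
   \sum_(k <oo) (expR (4 * pi) * (2 `^ (- a)) ^+ k * gauss ((4 ^+ k)^-1) x)%:E)%E).
  by apply: ge0_le_integral_nm => x; [rewrite lee_fin powR_ge0|exact: jbr_powR_le_gauss].
rewrite integral_nneseries//; last 2 first.
  by move=> k; apply/measurable_EFinP; apply: measurable_funM => //; exact: measurable_gauss.
  by move=> k x _; rewrite lee_fin !mulr_ge0 ?expR_ge0 ?exprn_ge0 ?powR_ge0.
rewrite (_ : (fun _ => _) = (fun N => \sum_(0 <= k < N) ((expR (4 * pi))%:E * ((2 `^ (- a) * 2 ^+ n) ^+ k)%:E))%E); last first.
  apply/funext => N; apply: eq_bigr => k _.
  under eq_integral do rewrite EFinM.
  rewrite ge0_integralZl//=.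
  - rewrite integral_gauss ?invr_gt0 ?exprn_gt0//.
    rewrite -!EFinM -mulrA exprMn; congr (_ * (_ * _))%:E.
    rewrite sqrtrV ?exprn_ge0// invrK (_ : 4 ^+ k = (2 ^+ k) ^+ 2 :> R).
      by rewrite sqrtr_sqr ger0_norm ?exprn_ge0// -!exprM mulnC.
    by rewrite -exprM mulnC exprM; congr (_ ^+ _); rewrite -natrX.
  - by apply/measurable_EFinP; exact: measurable_gauss.
  - by move=> x _; rewrite lee_fin gauss_ge0.
rewrite nneseriesZl//.
by rewrite lte_mul_pinfty ?lee_fin ?expR_ge0// nneseries_geometric_lty.
Qed.
End borel.

(** * Complex-valued integrals *)
Section cint.
Variable R : realType.

Lemma cReM (x y : R[i]) : Re (x * y) = Re x * Re y - Im x * Im y.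
Proof. by case: x y => [a b] [c d]. Qed.

Lemma cImM (x y : R[i]) : Im (x * y) = Re x * Im y + Im x * Re y.
Proof. by case: x y => [a b] [c d]. Qed.

Lemma cReD (x y : R[i]) : Re (x + y) = Re x + Re y.
Proof. by case: x y => [a b] [c d]. Qed.

Lemma cImD (x y : R[i]) : Im (x + y) = Im x + Im y.
Proof. by case: x y => [a b] [c d]. Qed.

Lemma cReN (x : R[i]) : Re (- x) = - Re x. Proof. by case: x. Qed.
Lemma cImN (x : R[i]) : Im (- x) = - Im x. Proof. by case: x. Qed.

Lemma normc_ge0 (x : R[i]) : 0 <= normc x.
Proof. by case: x => a b; exact: sqrtr_ge0. Qed.

Lemma Re_le_normc (x : R[i]) : `|Re x| <= normc x.
Proof.
case: x => a b /=; rewrite -sqrtr_sqr ler_sqrt ?addr_ge0 ?sqr_ge0//.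
by rewrite lerDl sqr_ge0.
Qed.

Lemma Im_le_normc (x : R[i]) : `|Im x| <= normc x.
Proof.
case: x => a b /=; rewrite -sqrtr_sqr ler_sqrt ?addr_ge0 ?sqr_ge0//.
by rewrite lerDr sqr_ge0.
Qed.

Lemma normc_le_ReIm (x : R[i]) : normc x <= `|Re x| + `|Im x|.
Proof.
case: x => a b /=; rewrite -ler_sqr ?nnegrE ?sqrtr_ge0 ?addr_ge0//.
rewrite sqr_sqrtr ?addr_ge0 ?sqr_ge0// sqrrD !real_normK ?num_real//.
by rewrite lerD2r lerDl mulrn_wge0 ?mulr_ge0.
Qed.

Lemma normc_RtoC (a : R) : normc (RtoC a) = `|a|.
Proof. by rewrite /= expr0n/= addr0 sqrtr_sqr. Qed.

Lemma normc_cexpi (t : R) : normc (cexpi t) = 1.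
Proof. by rewrite /= cos2Dsin2 sqrtr1. Qed.

Lemma cexpiD (s t : R) : cexpi (s + t) = cexpi s * cexpi t.
Proof.
by rewrite /cexpi cosD sinD; apply/eqP; rewrite eq_complex/= eqxx addrC eqxx.
Qed.

Lemma RtoCM (a b : R) : RtoC (a * b) = RtoC a * RtoC b.
Proof. by apply/eqP; rewrite eq_complex/= !mulr0 mul0r subr0 addr0 !eqxx. Qed.

(** Componentwise, in accordance with [cint], which integrates real and imaginary parts
    separately. *)
Definition cmfun d (T : measurableType d) (f : T -> R[i]) : Prop :=
  measurable_fun setT (fun t => Re (f t)) /\ measurable_fun setT (fun t => Im (f t)).

Lemma cmfunM d (T : measurableType d) (f g : T -> R[i]) :
  cmfun f -> cmfun g -> cmfun (fun t => f t * g t).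
Proof.
move=> [mf1 mf2] [mg1 mg2]; split.
  under eq_fun do rewrite cReM.
  by apply: measurable_funB; apply: measurable_funM.
under eq_fun do rewrite cImM.
by apply: measurable_funD; apply: measurable_funM.
Qed.

Lemma cmfunD d (T : measurableType d) (f g : T -> R[i]) :
  cmfun f -> cmfun g -> cmfun (fun t => f t + g t).
Proof.
move=> [mf1 mf2] [mg1 mg2]; split.
  by under eq_fun do rewrite cReD; apply: measurable_funD.
by under eq_fun do rewrite cImD; apply: measurable_funD.
Qed.

Lemma cmfun_cst d (T : measurableType d) (c : R[i]) : cmfun (fun _ : T => c).
Proof. by split; exact: measurable_cst. Qed.

Lemma cmfun_RtoC d (T : measurableType d) (f : T -> R) :
  measurable_fun setT f -> cmfun (fun t => RtoC (f t)).
Proof. by move=> mf; split => //; exact: measurable_cst. Qed.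

Lemma cmfun_cexpi d (T : measurableType d) (f : T -> R) :
  measurable_fun setT f -> cmfun (fun t => cexpi (f t)).
Proof.
move=> mf; split; apply: measurableT_comp mf; apply: continuous_measurable_fun.
  exact: continuous_cos.
exact: continuous_sin.
Qed.

Lemma cmfun_comp d d' (T : measurableType d) (T' : measurableType d')
    (f : T -> R[i]) (g : T' -> T) :
  cmfun f -> measurable_fun setT g -> cmfun (fun t => f (g t)).
Proof.
move=> [mf1 mf2] mg; split.
  exact: (measurableT_comp mf1 mg).
exact: (measurableT_comp mf2 mg).
Qed.

Lemma cmfun_normc d (T : measurableType d) (f : T -> R[i]) :
  cmfun f -> measurable_fun setT (fun t => normc (f t)).
Proof.
move=> [mf1 mf2].
have -> : (fun t => normc (f t)) = (fun t => Num.sqrt (Re (f t) ^+ 2 + Im (f t) ^+ 2)).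
  by apply/funext => t; case: (f t).
apply: (measurableT_comp (continuous_measurable_fun (@sqrt_continuous R))).
by apply: measurable_funD; apply: measurable_funX.
Qed.

Lemma cmfun_normcE d (T : measurableType d) (f : T -> R[i]) :
  cmfun f -> measurable_fun setT (fun t => (normc (f t))%:E).
Proof. by move=> mf; apply/measurable_EFinP; exact: cmfun_normc. Qed.

(** Each of the two Tonelli integrals is measurable in the parameter, and [fine] keeps
    measurability, sending infinite values to 0. *)
Lemma measurable_rint n d (T : measurableType d) (f : T * 'rV[R]_n -> R) :
  measurable_fun setT f -> measurable_fun setT (fun t => rint (fun y => f (t, y))).
Proof.
move=> mf; rewrite /rint.
have mmax (g : T * 'rV[R]_n -> R) : measurable_fun setT g ->
    measurable_fun setT (fun t => fine (iint (fun y => (Num.max (g (t, y)) 0)%:E))).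
  move=> mg; have mg' : measurable_fun setT (fun z => (Num.max (g z) 0)%:E).
    by apply/measurable_EFinP; exact: measurable_maxr.
  rewrite (_ : (fun t => _) = fine \o (fun t => \int[leb R n]_y (Num.max (g (t, y)) 0)%:E)%E); last first.
    apply/funext => t /=; rewrite iintE//; last by move=> y; rewrite lee_fin le_max lexx orbT.
    by have /= := measurableT_comp mg' (measurable_pair1 t).
  apply: measurableT_comp => //.
  apply: (measurable_fun_fubini_tonelli_F (fun z => (Num.max (g z) 0)%:E)) => // z.
  by rewrite lee_fin le_max lexx orbT.
apply: measurable_funB; first exact: mmax.
by apply: (mmax (fun z => - f z)); exact: measurable_funN.
Qed.

Lemma cmfun_cint n d (T : measurableType d) (F : T -> 'rV[R]_n -> R[i]) :
  cmfun (fun z : T * 'rV[R]_n => F z.1 z.2) -> cmfun (fun t => cint (F t)).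
Proof.
move=> [m1 m2]; split => /=; first exact: (measurable_rint m1).
exact: (measurable_rint m2).
Qed.

Definition cL1 n (f : 'rV[R]_n -> R[i]) : Prop :=
  cmfun f /\ (\int[leb R n]_x (normc (f x))%:E < +oo)%E.

Lemma rint_integrable n (f : 'rV[R]_n -> R) :
  measurable_fun setT f -> (\int[leb R n]_x `|f x|%:E < +oo)%E ->
  (leb R n).-integrable setT (EFin \o f).
Proof.
move=> mf foo; apply/integrableP; split; first exact/measurable_EFinP.
exact: foo.
Qed.

Lemma rintE n (f : 'rV[R]_n -> R) : (leb R n).-integrable setT (EFin \o f) ->
  rint f = \int[leb R n]_x f x.
Proof.
move=> fi; have /measurable_int/measurable_EFinP mf := fi.
rewrite /rint !iintE.
- transitivity (fine (\int[leb R n]_x (EFin \o f)^\+ x)%E - fine (\int[leb R n]_x (EFin \o f)^\- x)%E).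
    congr (_ - _); congr fine; apply: eq_integral => x _ /=.
      by rewrite funeposE EFin_max.
    by rewrite funenegE EFin_max.
  rewrite -fineB.
  + by rewrite /Rintegral [in RHS]integralE.
  + exact: integrable_pos_fin_num.
  + exact: integrable_neg_fin_num.
- by apply/measurable_EFinP; apply: measurable_maxr => //; exact: measurable_funN.
- by move=> x; rewrite lee_fin le_max lexx orbT.
- by apply/measurable_EFinP; exact: measurable_maxr.
- by move=> x; rewrite lee_fin le_max lexx orbT.
Qed.

Lemma cL1_Re n (f : 'rV[R]_n -> R[i]) : cL1 f ->
  (leb R n).-integrable setT (EFin \o (fun x => Re (f x))).
Proof.
move=> [[mf1 mf2] foo]; apply: rint_integrable => //.
apply: le_lt_trans foo; apply: ge0_le_integral_nm => x; rewrite lee_fin//.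
exact: Re_le_normc.
Qed.

Lemma cL1_Im n (f : 'rV[R]_n -> R[i]) : cL1 f ->
  (leb R n).-integrable setT (EFin \o (fun x => Im (f x))).
Proof.
move=> [[mf1 mf2] foo]; apply: rint_integrable => //.
apply: le_lt_trans foo; apply: ge0_le_integral_nm => x; rewrite lee_fin//.
exact: Im_le_normc.
Qed.

Lemma cintE n (f : 'rV[R]_n -> R[i]) : cL1 f ->
  cint f = ((\int[leb R n]_x Re (f x)) +i* (\int[leb R n]_x Im (f x)))%C.
Proof.
by move=> fi; rewrite /cint !rintE//; [exact: cL1_Im|exact: cL1_Re].
Qed.

Lemma cL1_le n (f : 'rV[R]_n -> R[i]) (g : 'rV[R]_n -> R) : cmfun f ->
  (forall x, normc (f x) <= g x) -> (\int[leb R n]_x (g x)%:E < +oo)%E -> cL1 f.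
Proof.
move=> mf fg goo; split => //; apply: le_lt_trans goo.
by apply: ge0_le_integral_nm => x; rewrite lee_fin ?normc_ge0.
Qed.

Lemma cL1_lec n (f g : 'rV[R]_n -> R[i]) : cmfun f ->
  (forall x, normc (f x) <= normc (g x)) -> cL1 g -> cL1 f.
Proof. by move=> mf fg [_ goo]; exact: cL1_le goo. Qed.

Lemma cL1Zl n (c : R[i]) (f : 'rV[R]_n -> R[i]) : cL1 f -> cL1 (fun x => c * f x).
Proof.
move=> [mf foo]; split; first by apply: cmfunM => //; exact: cmfun_cst.
under eq_integral do rewrite Normc.normcM EFinM.
rewrite ge0_integralZl//=.
- by rewrite lte_mul_pinfty// lee_fin normc_ge0.
- exact: cmfun_normcE.
- by move=> x _; rewrite lee_fin normc_ge0.
- by rewrite lee_fin normc_ge0.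
Qed.

Lemma cL1D n (f g : 'rV[R]_n -> R[i]) : cL1 f -> cL1 g -> cL1 (fun x => f x + g x).
Proof.
move=> [mf foo] [mg goo]; split; first exact: cmfunD.
apply: (@le_lt_trans _ _ (\int[leb R n]_x ((normc (f x))%:E + (normc (g x))%:E))%E).
  by apply: ge0_le_integral_nm => x; rewrite ?lee_fin ?normc_ge0// le_normcD.
rewrite ge0_integralD//; last 4 first.
- by move=> x _; rewrite lee_fin normc_ge0.
- exact: cmfun_normcE.
- by move=> x _; rewrite lee_fin normc_ge0.
- exact: cmfun_normcE.
exact: lte_add_pinfty.
Qed.

Lemma eq_cint n (f g : 'rV[R]_n -> R[i]) : f =1 g -> cint f = cint g.
Proof. by move=> fg; congr cint; apply/funext. Qed.

Lemma cintD n (f g : 'rV[R]_n -> R[i]) : cL1 f -> cL1 g ->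
  cint (fun x => f x + g x) = cint f + cint g.
Proof.
move=> fi gi; rewrite !cintE//; last exact: cL1D.
apply/eqP; rewrite eq_complex/=; apply/andP; split; apply/eqP.
  rewrite -RintegralD//; [|exact: cL1_Re|exact: cL1_Re].
  by congr Rintegral; apply/funext => x /=; rewrite cReD.
rewrite -RintegralD//; [|exact: cL1_Im|exact: cL1_Im].
by congr Rintegral; apply/funext => x /=; rewrite cImD.
Qed.

Lemma cintZl n (c : R[i]) (f : 'rV[R]_n -> R[i]) : cL1 f ->
  cint (fun x => c * f x) = c * cint f.
Proof.
move=> fi; rewrite !cintE//; last exact: cL1Zl.
have iR := cL1_Re fi; have iI := cL1_Im fi.
apply/eqP; rewrite eq_complex cReM cImM/=; apply/andP; split; apply/eqP.
  rewrite -!RintegralZl// -RintegralB//.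
  - by congr Rintegral; apply/funext => x /=; rewrite cReM.
  - by under [X in _.-integrable _ X]eq_fun do rewrite /= EFinM; exact: integrableZl.
  - by under [X in _.-integrable _ X]eq_fun do rewrite /= EFinM; exact: integrableZl.
rewrite -!RintegralZl// -RintegralD//.
- by congr Rintegral; apply/funext => x /=; rewrite cImM.
- by under [X in _.-integrable _ X]eq_fun do rewrite /= EFinM; exact: integrableZl.
- by under [X in _.-integrable _ X]eq_fun do rewrite /= EFinM; exact: integrableZl.
Qed.

(* The factor 2 is not sharp: real and imaginary parts are estimated separately. *)
Lemma normc_cint n (f : 'rV[R]_n -> R[i]) : cmfun f ->
  ((normc (cint f))%:E <= 2%:E * \int[leb R n]_x (normc (f x))%:E)%E.
Proof.
move=> mf.
have [foo|] := ltP (\int[leb R n]_x (normc (f x))%:E)%E +oo%E; last first.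
  by rewrite leye_eq => /eqP ->; rewrite mulry gtr0_sg// mul1e leey.
have fi : cL1 f by [].
rewrite cintE//; apply: (@le_trans _ _ (`|\int[leb R n]_x Re (f x)| + `|\int[leb R n]_x Im (f x)|)%:E).
  by rewrite lee_fin; exact: normc_le_ReIm.
rewrite EFinD (_ : 2%:E = 1%:E + 1%:E)%E; last by rewrite -EFinD.
rewrite ge0_muleDl// mul1e; apply: leeD.
  rewrite EFin_normr_Rintegral//; last exact: cL1_Re.
  apply: le_trans (le_abse_integral _ _ _) _ => //; first by case/integrableP: (cL1_Re fi).
  by apply: ge0_le_integral_nm => x //=; rewrite lee_fin Re_le_normc.
rewrite EFin_normr_Rintegral//; last exact: cL1_Im.
apply: le_trans (le_abse_integral _ _ _) _ => //; first by case/integrableP: (cL1_Im fi).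
by apply: ge0_le_integral_nm => x //=; rewrite lee_fin Im_le_normc.
Qed.

Lemma rint_shift n (a : 'rV[R]_n) (f : 'rV[R]_n -> R) : measurable_fun setT f ->
  rint (fun x => f (x + a)) = rint f.
Proof.
have H (g : 'rV[R]_n -> R) : measurable_fun setT g ->
    iint (fun x => (Num.max (g (x + a)) 0)%:E) = iint (fun x => (Num.max (g x) 0)%:E).
  move=> mg; have mg' : measurable_fun setT (fun z => (Num.max (g z) 0)%:E).
    by apply/measurable_EFinP; exact: measurable_maxr.
  have mga := measurableT_comp mg' (measurable_rVD a).
  rewrite !iintE//; try by move=> x; rewrite lee_fin le_max lexx orbT.
  by rewrite -(integral_rVD a mg')// => x; rewrite lee_fin le_max lexx orbT.
by move=> mf; rewrite /rint H// (H (fun x => - f x))//; exact: measurable_funN.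
Qed.

Lemma cint_shift n (a : 'rV[R]_n) (f : 'rV[R]_n -> R[i]) : cmfun f ->
  cint (fun x => f (x + a)) = cint f.
Proof. by move=> [mf1 mf2]; rewrite /cint (rint_shift a mf1) (rint_shift a mf2). Qed.

Lemma rint_opp n (f : 'rV[R]_n -> R) : measurable_fun setT f ->
  rint (fun x => f (- x)) = rint f.
Proof.
have H (g : 'rV[R]_n -> R) : measurable_fun setT g ->
    iint (fun x => (Num.max (g (- x)) 0)%:E) = iint (fun x => (Num.max (g x) 0)%:E).
  move=> mg; have mg' : measurable_fun setT (fun z => (Num.max (g z) 0)%:E).
    by apply/measurable_EFinP; exact: measurable_maxr.
  have mga := measurableT_comp mg' (@measurable_rVN R n).
  rewrite !iintE//; try by move=> x; rewrite lee_fin le_max lexx orbT.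
  by rewrite -(integral_rVN mg')// => x; rewrite lee_fin le_max lexx orbT.
by move=> mf; rewrite /rint H// (H (fun x => - f x))//; exact: measurable_funN.
Qed.

(** Inner integrals in Fubini's theorem are finite only almost everywhere; [fine] sets the
    exceptional values to 0, which affects neither integrability nor the integral. *)
Lemma Rintegral_fine d (T : measurableType d) (mu : {measure set T -> \bar R})
    (P : T -> \bar R) : measurable_fun setT P -> (forall x, (0 <= P x)%E) ->
  (\int[mu]_x P x < +oo)%E ->
  mu.-integrable setT (EFin \o (fun x => fine (P x))) /\
  \int[mu]_x fine (P x) = fine (\int[mu]_x P x)%E.
Proof.
move=> mP P0 Poo.
have iP : mu.-integrable setT P.
  by apply/integrableP; split => //; under eq_integral do rewrite gee0_abs//.
have mfP : measurable_fun setT (EFin \o (fun x => fine (P x))).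
  by apply/measurable_EFinP; apply: measurableT_comp.
have PE : {ae mu, forall x, setT x -> (EFin \o (fun x => fine (P x))) x = P x}.
  have [N [mN N0 NP]] := integrable_ae measurableT iP.
  exists N; split => // x /= H; apply: NP => /= H'; apply: H => _.
  by rewrite fineK// H'.
split; last first.
  rewrite /Rintegral; congr fine; apply: ge0_ae_eq_integral => //.
  by move=> x _ /=; rewrite lee_fin fine_ge0.
apply/integrableP; split => //.
have -> : (\int[mu]_x `|(EFin \o (fun x => fine (P x))) x| = \int[mu]_x P x)%E.
  apply: ge0_ae_eq_integral => //; first exact: measurableT_comp.
  apply: filterS PE => x /= /(_ Logic.I) H _.
  by rewrite ger0_norm ?fine_ge0.
exact: Poo.
Qed.

(** [rint] has a value even where the inner integral diverges. The iterated integral is therefore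
    rewritten, in [key], as a difference of two Tonelli integrals, one for each sign, and these are
    swapped. *)
Lemma rint_Fubini n m (f : 'rV[R]_n * 'rV[R]_m -> R) :
  measurable_fun setT f ->
  (\int[leb R n]_x \int[leb R m]_y `|f (x, y)|%:E < +oo)%E ->
  rint (fun x => rint (fun y => f (x, y))) = rint (fun y => rint (fun x => f (x, y))).
Proof.
have max0 n' (g : 'rV[R]_n' -> R) x : (0 <= (Num.max (g x) 0)%:E)%E.
  by rewrite lee_fin le_max lexx orbT.
have key n1 n2 (g : 'rV[R]_n1 * 'rV[R]_n2 -> R) : measurable_fun setT g ->
    (\int[leb R n1]_x \int[leb R n2]_y `|g (x, y)|%:E < +oo)%E ->
    rint (fun x => rint (fun y => g (x, y))) =
    fine (\int[leb R n1]_x \int[leb R n2]_y (Num.max (g (x, y)) 0)%:E)%E -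
    fine (\int[leb R n1]_x \int[leb R n2]_y (Num.max (- g (x, y)) 0)%:E)%E.
  move=> mg goo.
  have mP (h : 'rV[R]_n1 * 'rV[R]_n2 -> R) : measurable_fun setT h ->
      measurable_fun setT (fun z => (Num.max (h z) 0)%:E).
    by move=> mh; apply/measurable_EFinP; exact: measurable_maxr.
  have mP1 (h : 'rV[R]_n1 * 'rV[R]_n2 -> R) : measurable_fun setT h ->
      measurable_fun setT (fun x => \int[leb R n2]_y (Num.max (h (x, y)) 0)%:E)%E.
    move=> mh; apply: (measurable_fun_fubini_tonelli_F (fun z => (Num.max (h z) 0)%:E)) => // [|z].
      exact: mP.
    by rewrite lee_fin le_max lexx orbT.
  have oo (h : 'rV[R]_n1 * 'rV[R]_n2 -> R) : (forall z, Num.max (h z) 0 <= `|g z|) ->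
      (\int[leb R n1]_x \int[leb R n2]_y (Num.max (h (x, y)) 0)%:E < +oo)%E.
    move=> hg; apply: le_lt_trans goo; apply: ge0_le_integral_nm => x.
      by apply: integral_ge0 => y _; rewrite lee_fin le_max lexx orbT.
    by apply: ge0_le_integral_nm => y; rewrite lee_fin ?le_max ?lexx ?orbT.
  have mng : measurable_fun setT (fun z => - g z) by exact: measurable_funN.
  have pos (h : 'rV[R]_n1 * 'rV[R]_n2 -> R) x : (0 <= \int[leb R n2]_y (Num.max (h (x, y)) 0)%:E)%E.
    by apply: integral_ge0 => y _; rewrite lee_fin le_max lexx orbT.
  have og : forall z, Num.max (g z) 0 <= `|g z|.
    by move=> z; rewrite ge_max ler_norm normr_ge0.
  have ong : forall z, Num.max (- g z) 0 <= `|g z|.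
    by move=> z; rewrite ge_max -normrN ler_norm normr_ge0.
  have [iP EP] := Rintegral_fine (mP1 _ mg) (pos _) (oo _ og).
  have [iN EN] := Rintegral_fine (mP1 _ mng) (pos (fun z => - g z)) (oo _ ong).
  have gE : (fun x => rint (fun y => g (x, y))) = (fun x =>
      fine (\int[leb R n2]_y (Num.max (g (x, y)) 0)%:E)%E -
      fine (\int[leb R n2]_y (Num.max (- g (x, y)) 0)%:E)%E).
    apply/funext => x; rewrite /rint !iintE//.
    - exact: measurableT_comp (mP _ mng) (measurable_pair1 x).
    - by move=> y; rewrite lee_fin le_max lexx orbT.
    - exact: measurableT_comp (mP _ mg) (measurable_pair1 x).
    - by move=> y; rewrite lee_fin le_max lexx orbT.
  rewrite gE rintE; first by rewrite RintegralB// EP EN.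
  under [X in _.-integrable _ X]eq_fun do rewrite /= EFinB.
  exact: integrableB.
move=> mf foo.
have ms : measurable_fun setT (fun z : 'rV[R]_m * 'rV[R]_n => f (z.2, z.1)).
  by apply: (measurableT_comp mf); apply/measurable_fun_pairP; split; [exact: measurable_snd|exact: measurable_fst].
have mP h : measurable_fun setT h -> measurable_fun setT (fun z : 'rV[R]_n * 'rV[R]_m => (h z : R)%:E).
  by move=> mh; apply/measurable_EFinP.
rewrite key// (key _ _ (fun z => f (z.2, z.1)))//; last first.
  rewrite -(fubini_tonelli (fun z => `|f z|%:E))//.
  by apply: mP; exact: measurableT_comp.
congr (fine _ - fine _).
  rewrite (fubini_tonelli (fun z => (Num.max (f z) 0)%:E))//; first by apply: mP; exact: measurable_maxr.
  by move=> z; rewrite lee_fin le_max lexx orbT.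
rewrite (fubini_tonelli (fun z => (Num.max (- f z) 0)%:E))//.
  by apply: mP; apply: measurable_maxr => //; exact: measurable_funN.
by move=> z; rewrite lee_fin le_max lexx orbT.
Qed.

Lemma cint_Fubini n m (F : 'rV[R]_n -> 'rV[R]_m -> R[i]) :
  cmfun (fun z : 'rV[R]_n * 'rV[R]_m => F z.1 z.2) ->
  (\int[leb R n]_x \int[leb R m]_y (normc (F x y))%:E < +oo)%E ->
  cint (fun x => cint (F x)) = cint (fun y => cint (F ^~ y)).
Proof.
move=> [mF1 mF2] Foo; rewrite /cint; congr Complex.
  apply: (rint_Fubini mF1); apply: le_lt_trans Foo; apply: ge0_le_integral_nm => x.
    by apply: integral_ge0 => y _; rewrite lee_fin.
  by apply: ge0_le_integral_nm => y; rewrite lee_fin ?Re_le_normc.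
apply: (rint_Fubini mF2); apply: le_lt_trans Foo; apply: ge0_le_integral_nm => x.
  by apply: integral_ge0 => y _; rewrite lee_fin.
by apply: ge0_le_integral_nm => y; rewrite lee_fin ?Im_le_normc.
Qed.
End cint.

(** * Fourier transform and directional derivatives *)

Section fourier.
Variable R : realType.

Lemma integrable_jbr n (M : R) : n%:R < M ->
  (leb R n).-integrable setT (EFin \o (fun x => jbr x `^ (- M))).
Proof.
move=> nM; apply: rint_integrable; first exact: measurable_jbr_powR.
under eq_integral do rewrite ger0_norm ?powR_ge0//.
exact: integral_jbr_lty.
Qed.

Lemma cL1_jbr n (f : 'rV[R]_n -> R[i]) (C M : R) : n%:R < M -> cmfun f ->
  (forall x, normc (f x) <= C * jbr x `^ (- M)) -> cL1 f.
Proof.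
move=> nM mf fC; apply: (cL1_le mf fC).
have C0 : 0 <= C.
  by have := fC 0; rewrite jbr0 powR1 mulr1; apply: le_trans; exact: normc_ge0.
under eq_integral do rewrite EFinM.
rewrite ge0_integralZl//=.
- by rewrite lte_mul_pinfty ?integral_jbr_lty.
- by apply/measurable_EFinP; exact: measurable_jbr_powR.
- by move=> x _; rewrite lee_fin powR_ge0.
Qed.

(** Along a line the derivative is a one-variable derivative, for which the chain rule and
    differentiation under the integral apply; [is_derive_of_line] is the converse. *)
Lemma is_derive_line n (g : 'rV[R]_n -> R) x v (t l : R) :
  is_derive (x + t *: v) v g l -> is_derive t 1 (fun s : R => g (x + s *: v)) l.
Proof.
have E : (fun h : R => h^-1 *: (g (x + (h *: (1 : R) + t) *: v) - g (x + t *: v))) =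
         (fun h : R => h^-1 *: (g (h *: v + (x + t *: v)) - g (x + t *: v))).
  apply/funext => h; congr (_ *: (g _ - _)).
  have -> : h *: (1 : R) = h by exact: mulr1.
  by rewrite scalerDl addrCA.
case=> dg gl; apply: DeriveDef.
  by move: dg; rewrite /derivable/= E.
by move: gl; rewrite /derive/= E.
Qed.

Lemma is_derive_differentiable n (g : 'rV[R]_n -> R) x v :
  differentiable g x -> is_derive x v g ('D_v g x).
Proof. by move=> dg; apply: DeriveDef => //; exact: diff_derivable. Qed.

(** Stated at 0 with domination over ]-1, 1[; other base points are reached by translating the
    integrand. *)
Lemma is_derive_Rintegral d (T : measurableType d) (mu : {measure set T -> \bar R})
    (f f' : R -> T -> R) (G : T -> R) :
  (forall t : R, -1 < t < 1 -> mu.-integrable setT (EFin \o f t)) ->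
  (forall (t : R) y, -1 < t < 1 -> is_derive t 1 (f ^~ y) (f' t y)) ->
  (forall y, 0 <= G y) -> mu.-integrable setT (EFin \o G) ->
  (forall (t : R) y, -1 < t < 1 -> `|f' t y| <= G y) ->
  is_derive (0 : R) 1 (fun t => \int[mu]_y f t y) (\int[mu]_y f' 0 y).
Proof.
move=> fi df G0 Gi f'G.
have I0 : `]-1, 1[%classic (0 : R) by rewrite /= in_itv/= ltrN10 ltr01.
have E t y : -1 < t < 1 -> partial1of2 f t y = f' t y.
  by move=> t1; rewrite /partial1of2 derive1E; have [] := df t y t1.
have H1 : forall t y, `]-1, 1[%classic t -> setT y -> derivable (f^~ y) t 1.
  by move=> t y; rewrite /= in_itv/= => t1 _; have [] := df t y t1.
have H2 : forall t y, `]-1, 1[%classic t -> setT y -> `|partial1of2 f t y| <= G y.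
  by move=> t y; rewrite /= in_itv/= => t1 _; rewrite E//; exact: f'G.
have H3 : forall t, `]-1, 1[%classic t -> mu.-integrable setT (EFin \o f t).
  by move=> t; rewrite /= in_itv/=; exact: fi.
apply: DeriveDef.
  exact: (derivable_under_integral measurableT I0 H3 H1 G0 Gi H2).
rewrite -derive1E (differentiation_under_integral measurableT I0 H3 H1 G0 Gi H2).
by congr Rintegral; apply/funext => y; rewrite E// ltrN10 ltr01.
Qed.

Definition cder n (v : 'rV[R]_n) (h h' : 'rV[R]_n -> R[i]) : Prop :=
  forall x, is_derive x v (fun y => Re (h y)) (Re (h' x)) /\
            is_derive x v (fun y => Im (h y)) (Im (h' x)).

Lemma cmfun_fker n (x : 'rV[R]_n) d (T : measurableType d) (f : T -> 'rV[R]_n) :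
  measurable_fun setT f -> cmfun (fun t => cexpi (- (2 * pi * dotp (f t) x))).
Proof.
move=> mf; apply: cmfun_cexpi; apply: measurable_funN; apply: measurable_funM => //.
by apply: measurable_dotp.
Qed.

Lemma is_derive_cosM (k t : R) : is_derive t 1 (fun t => cos (k * t)) (- k * sin (k * t)).
Proof.
have H : is_derive t 1 (fun t : R => k * t) k.
  by apply: is_derive_eq; rewrite /GRing.scale/= mulr1.
have := @is_derive1_comp R (fun u => cos u) (fun t => k * t) t _ _ (is_derive_cos (k * t)) H.
by rewrite mulNr mulrC -mulNr.
Qed.

Lemma is_derive_sinM (k t : R) : is_derive t 1 (fun t => sin (k * t)) (k * cos (k * t)).
Proof.
have H : is_derive t 1 (fun t : R => k * t) k.
  by apply: is_derive_eq; rewrite /GRing.scale/= mulr1.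
have := @is_derive1_comp R (fun u => sin u) (fun t => k * t) t _ _ (is_derive_sin (k * t)) H.
by rewrite mulrC.
Qed.

(** Supplies the majorant, uniform in |t| < 1, for differentiating translates under the integral. *)
Lemma jbr_shift_bound n (v : 'rV[R]_n) (M : R) : 0 <= M ->
  exists2 K, 0 < K & forall (x : 'rV[R]_n) t, -1 < t < 1 -> jbr (x + t *: v) `^ (- M) <= K * jbr x `^ (- M).
Proof.
move=> M0; exists (2 `^ M * jbr v `^ M) => [|x t t1].
  by rewrite mulr_gt0 ?powR_gt0 ?jbr_gt0.
apply: le_trans (jbr_powRD _ _ _) _; rewrite normrN ger0_norm// -mulrA ler_pM2l ?powR_gt0// mulrC.
rewrite ler_pM2r ?powR_gt0 ?jbr_gt0//; apply: ge0_ler_powR; rewrite ?nnegrE ?jbr_ge0//.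
rewrite ler_sqrt ?addr_ge0 ?dotp_ge0// lerD2l dotpZl dotpZr mulrA ler_piMl ?dotp_ge0//.
have [t2 t3] := andP t1; nra.
Qed.

Lemma cL1_shift n (a : 'rV[R]_n) (f : 'rV[R]_n -> R[i]) : cL1 f ->
  cL1 (fun x => f (x + a)).
Proof.
move=> [mf foo]; split; first exact: (cmfun_comp mf (measurable_rVD a)).
rewrite (@integral_rVD R n a (fun x => (normc (f x))%:E))//; first exact: cmfun_normcE.
by move=> x; rewrite lee_fin normc_ge0.
Qed.

(* Translating by [t v] multiplies the transform by [cexpi (2 pi t (v . x))]; differentiate at 0. *)
Lemma fourier_derive n (v : 'rV[R]_n) (h h' : 'rV[R]_n -> R[i]) (C M : R) x :
  n%:R < M -> cder v h h' -> cmfun h -> cmfun h' ->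
  (forall y, normc (h y) <= C * jbr y `^ (- M)) ->
  (forall y, normc (h' y) <= C * jbr y `^ (- M)) ->
  fourier h' x = (0 +i* (2 * pi * dotp v x))%C * fourier h x.
Proof.
move=> nM dh mh mh' hC h'C.
have M0 : 0 <= M by apply: ltW; apply: le_lt_trans nM; rewrite ler0n.
have C0 : 0 <= C.
  by have := hC 0; rewrite jbr0 powR1 mulr1; apply: le_trans; exact: normc_ge0.
pose E y : R[i] := cexpi (- (2 * pi * dotp y x)).
have mE : cmfun E by exact: cmfun_fker.
have nE y : normc (E y) = 1 by exact: normc_cexpi.
have mht (t : R) : cmfun (fun y : 'rV[R]_n => h (y + t *: v)) by apply: (cmfun_comp mh (measurable_rVD _)).
have mht' (t : R) : cmfun (fun y : 'rV[R]_n => h' (y + t *: v)) by apply: (cmfun_comp mh' (measurable_rVD _)).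
have [K K0 KP] := jbr_shift_bound v M0.
have ih : cL1 (fun y => h y * E y).
  apply: (@cL1_jbr _ _ C M) => //; first exact: cmfunM.
  by move=> y; rewrite Normc.normcM nE mulr1.
have iht (t : R) : cL1 (fun y => h (y + t *: v) * E y).
  apply: (cL1_lec _ _ (cL1_shift (t *: v) ih)) => [|y]; first exact: cmfunM.
  by rewrite !Normc.normcM !nE.
pose k := 2 * pi * dotp v x.
have shift (t : R) : cint (fun y => h (y + t *: v) * E y) = cexpi (k * t) * fourier h x.
  rewrite /fourier -(@cint_shift R n (t *: v) (fun y => h y * E y)); last by case: ih.
  rewrite -cintZl; last exact: (cL1_shift (t *: v) ih).
  apply: eq_cint => y; rewrite mulrCA; congr (_ * _).
  rewrite /E -cexpiD; congr cexpi; rewrite dotpDl dotpZl /k; ring.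
have G0 (y : 'rV[R]_n) : 0 <= C * K * jbr y `^ (- M) by rewrite !mulr_ge0 ?powR_ge0// ltW.
have Gi : (leb R n).-integrable setT (EFin \o (fun y => C * K * jbr y `^ (- M))).
  under [X in _.-integrable _ X]eq_fun do rewrite /= EFinM.
  by apply: integrableZl => //; exact: integrable_jbr.
have bound t y : -1 < t < 1 -> normc (h' (y + t *: v) * E y) <= C * K * jbr y `^ (- M).
  move=> t1; rewrite Normc.normcM nE mulr1; apply: le_trans (h'C _) _.
  by rewrite -mulrA ler_wpM2l// KP.
have h0 : cL1 (fun y => h' y * E y).
  apply: (@cL1_jbr _ _ C M) => //; first exact: cmfunM.
  by move=> y; rewrite Normc.normcM nE mulr1.
pose fR (t : R) (y : 'rV[R]_n) := Re (h (y + t *: v) * E y).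
pose fR' (t : R) (y : 'rV[R]_n) := Re (h' (y + t *: v) * E y).
pose fI (t : R) (y : 'rV[R]_n) := Im (h (y + t *: v) * E y).
pose fI' (t : R) (y : 'rV[R]_n) := Im (h' (y + t *: v) * E y).
have dR : is_derive (0 : R) 1 (fun t => \int[leb R n]_y fR t y) (\int[leb R n]_y fR' 0 y).
  apply: (@is_derive_Rintegral _ _ (leb R n) fR fR' _ _ _ G0 Gi).
  - by move=> t t1; exact: cL1_Re (iht t).
  - move=> t y t1; rewrite /fR' cReM.
    have -> : fR ^~ y = (fun t : R => Re (h (y + t *: v)) * Re (E y) - Im (h (y + t *: v)) * Im (E y)).
      by apply/funext => t'; rewrite /fR cReM.
    have [/is_derive_line d1 /is_derive_line d2] := dh (y + t *: v).
    by apply: is_derive_eq; rewrite !scaler0 !add0r /GRing.scale/= ![_ * Re (h' _)]mulrC ![_ * Im (h' _)]mulrC.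
  - by move=> t y t1; apply: le_trans (bound t y t1); exact: Re_le_normc.
have dI : is_derive (0 : R) 1 (fun t => \int[leb R n]_y fI t y) (\int[leb R n]_y fI' 0 y).
  apply: (@is_derive_Rintegral _ _ (leb R n) fI fI' _ _ _ G0 Gi).
  - by move=> t t1; exact: cL1_Im (iht t).
  - move=> t y t1; rewrite /fI' cImM.
    have -> : fI ^~ y = (fun t : R => Re (h (y + t *: v)) * Im (E y) + Im (h (y + t *: v)) * Re (E y)).
      by apply/funext => t'; rewrite /fI cImM.
    have [/is_derive_line d1 /is_derive_line d2] := dh (y + t *: v).
    by apply: is_derive_eq; rewrite !scaler0 !add0r /GRing.scale/= ![_ * Re (h' _)]mulrC ![_ * Im (h' _)]mulrC.
  - by move=> t y t1; apply: le_trans (bound t y t1); exact: Im_le_normc.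
have dRI : (fun t => \int[leb R n]_y fR t y) =
    (fun t => cos (k * t) * Re (fourier h x) - sin (k * t) * Im (fourier h x)).
  apply/funext => t; have := shift t; rewrite (cintE (iht t)) => /(congr1 (@complex.Re R)) /=.
  by [].
have dII : (fun t => \int[leb R n]_y fI t y) =
    (fun t => cos (k * t) * Im (fourier h x) + sin (k * t) * Re (fourier h x)).
  apply/funext => t; have := shift t; rewrite (cintE (iht t)) => /(congr1 (@complex.Im R)) /=.
  by [].
have dcos := is_derive_cosM k 0; have dsin := is_derive_sinM k 0.
rewrite mulr0 cos0 sin0 mulr0 mulr1 in dcos dsin.
rewrite [LHS]/fourier (cintE h0).
have ER : \int[leb R n]_y Re (h' y * E y) = \int[leb R n]_y fR' 0 y.
  by congr Rintegral; apply/funext => y; rewrite /fR' scale0r addr0.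
have EI : \int[leb R n]_y Im (h' y * E y) = \int[leb R n]_y fI' 0 y.
  by congr Rintegral; apply/funext => y; rewrite /fI' scale0r addr0.
rewrite ER EI; apply/eqP; rewrite eq_complex cReM cImM /= -/k; apply/andP; split; apply/eqP.
  rewrite -(@derive_val _ _ _ _ _ _ _ dR) dRI.
  rewrite derive_val; rewrite /GRing.scale/=; ring.
rewrite -(@derive_val _ _ _ _ _ _ _ dI) dII.
rewrite derive_val; rewrite /GRing.scale/=; ring.
Qed.
End fourier.

(** * Fourier transform of Gaussians *)

Section gaussian_transform.
Variable R : realType.

Lemma is_derive_of_line (V : normedModType R) (g : V -> R) x v (t l : R) :
  is_derive t 1 (fun s : R => g (x + s *: v)) l -> is_derive (x + t *: v) v g l.
Proof.
have E : (fun h : R => h^-1 *: (g (x + (h *: (1 : R) + t) *: v) - g (x + t *: v))) =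
         (fun h : R => h^-1 *: (g (h *: v + (x + t *: v)) - g (x + t *: v))).
  apply/funext => h; congr (_ *: (g _ - _)).
  have -> : h *: (1 : R) = h by exact: mulr1.
  by rewrite scalerDl addrCA.
case=> dg gl; apply: DeriveDef.
  by move: dg; rewrite /derivable/= E.
by move: gl; rewrite /derive/= E.
Qed.

Lemma dotp_le_jbr n (x y : 'rV[R]_n) : `|dotp x y| <= n%:R * (jbr x * jbr y).
Proof.
apply: le_trans (ler_norm_sum _ _ _) _.
rewrite (_ : n%:R = (\sum_(i < n) 1)); last by rewrite sumr_const card_ord.
rewrite mulr_suml; apply: ler_sum => i _; rewrite mul1r normrM.
by apply: ler_pM => //; exact: ler_coord_jbr.
Qed.

Lemma is_derive_gauss n c (x v a : 'rV[R]_n) :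
  is_derive x v (fun y => gauss c (y - a)) (- (2 * c * pi * dotp v (x - a)) * gauss c (x - a)).
Proof.
suff : is_derive (x + (0 : R) *: v) v (fun y => gauss c (y - a)) (- (2 * c * pi * dotp v (x - a)) * gauss c (x - a)).
  by rewrite scale0r addr0.
apply: is_derive_of_line.
set z := x - a.
pose q (s : R) := - (c * pi * (dotp z z + 2 * s * dotp v z + s ^+ 2 * dotp v v)).
have -> : (fun s : R => gauss c (x + s *: v - a)) = (fun s => expR (q s)).
  apply/funext => s; rewrite /gauss /q; congr (expR (- (_ * _))).
  rewrite (addrAC x) -/z; clearbody z; rewrite dotpDl !dotpDr !dotpZl !dotpZr (dotpC z v).
  by ring.
have dq : is_derive (0 : R) 1 q (- (2 * c * pi * dotp v z)).
  rewrite /q; apply: is_derive_eq; rewrite /GRing.scale/=; ring.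
have := @is_derive1_comp R (@expR R) q 0 _ _ (is_derive_expR (q 0)) dq.
rewrite mulrC /q /gauss; congr (is_derive _ _ _ (_ * expR (- (_ * _)))).
by ring.
Qed.

Lemma rintN n (f : 'rV[R]_n -> R) : rint (fun x => - f x) = - rint f.
Proof.
rewrite /rint opprB (_ : (fun x => (Num.max (- - f x) 0)%:E) = fun x => (Num.max (f x) 0)%:E)//.
by apply/funext => x; rewrite opprK.
Qed.

Lemma gauss_jbr_bound n (c K M : R) : 0 < c -> 0 <= K ->
  exists2 C, 0 < C & forall x : 'rV[R]_n, gauss c x * (K * jbr x) <= C * jbr x `^ (- M) .
Proof.
move=> c0 K0; have [C C0 HC] := @gauss_le_jbr R n c (M + 1) c0.
exists (C * (K + 1)) => [|x]; first by rewrite mulr_gt0// ltr_wpDl.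
apply: (@le_trans _ _ ((C * jbr x `^ (- (M + 1))) * (K * jbr x))).
  by rewrite ler_wpM2r ?mulr_ge0 ?jbr_ge0.
rewrite opprD powRD; last by apply/implyP => _; rewrite gt_eqF ?jbr_gt0.
rewrite powR_inv1 ?jbr_ge0// (_ : _ * _ = C * K * jbr x `^ (- M) * ((jbr x)^-1 * jbr x)); last by ring.
rewrite mulVf ?gt_eqF ?jbr_gt0// mulr1 ler_wpM2r ?powR_ge0// ler_wpM2l ?lerDl//; exact: ltW.
Qed.

Lemma cL1_gauss n c (a : 'rV[R]_n) (f : 'rV[R]_n -> R[i]) : 0 < c -> cmfun f ->
  (forall x, normc (f x) <= 1) -> cL1 (fun x => RtoC (gauss c (x - a)) * f x).
Proof.
move=> c0 mf f1.
have mg : measurable_fun setT (fun x : 'rV[R]_n => gauss c (x - a)).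
  by apply: measurable_gauss; exact: measurable_rVD.
apply: (@cL1_le _ _ _ (fun x => gauss c (x - a))).
- by apply: cmfunM => //; exact: cmfun_RtoC.
- move=> x; rewrite Normc.normcM normc_RtoC ger0_norm ?gauss_ge0//.
  by rewrite ler_piMr ?gauss_ge0.
- rewrite (@integral_rVD R n (- a) (fun x => (gauss c x)%:E)).
  + by rewrite integral_gauss// ltry.
  + by apply/measurable_EFinP; exact: measurable_gauss.
  + by move=> x; rewrite lee_fin gauss_ge0.
Qed.

(** The derivative of the Gaussian in direction x is a multiple of (x . y) times the Gaussian. Its
    transform on the ray t x is computed once by [fourier_derive] and once as the derivative of
    C(t), the real part of the transform at t x; this gives C' = -(2 pi |x|^2 / c) t C. The
    imaginary part vanishes by oddness. *)
Lemma fourier_gauss n (c : R) (x : 'rV[R]_n) : 0 < c ->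
  fourier (fun y => RtoC (gauss c y)) x = RtoC ((Num.sqrt c)^-1 ^+ n * gauss c^-1 x).
Proof.
move=> c0.
have mdx : measurable_fun setT (fun y => dotp y x) by exact: measurable_dotp.
have mgc : measurable_fun setT (fun y : 'rV[R]_n => gauss c y) by exact: measurable_gauss.
have mcos (t : R) : measurable_fun setT (fun y => cos (2 * pi * t * dotp y x)).
  by apply: (measurableT_comp (continuous_measurable_fun (@continuous_cos R))); exact: measurable_funM.
have msin (t : R) : measurable_fun setT (fun y => sin (2 * pi * t * dotp y x)).
  by apply: (measurableT_comp (continuous_measurable_fun (@continuous_sin R))); exact: measurable_funM.
have pi2 : 0 <= 2 * pi :> R by rewrite mulr_ge0// pi_ge0.
pose C (t : R) := \int[leb R n]_y (gauss c y * cos (2 * pi * t * dotp y x)).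
have int_cos t : (leb R n).-integrable setT (EFin \o (fun y => gauss c y * cos (2 * pi * t * dotp y x))).
  apply: rint_integrable; first exact: measurable_funM.
  apply: (@le_lt_trans _ _ (\int[leb R n]_y (gauss c y)%:E)%E); last by rewrite integral_gauss// ltry.
  apply: ge0_le_integral_nm => y; rewrite lee_fin// normrM ger0_norm ?gauss_ge0// ler_piMr ?gauss_ge0//.
  exact: cos_max.
pose h (y : 'rV[R]_n) := RtoC (gauss c y).
pose h' (y : 'rV[R]_n) := RtoC (- (2 * c * pi * dotp x y) * gauss c y).
have dh : cder x h h'.
  move=> y; split => /=; last exact: is_derive_cst.
  have := is_derive_gauss c y x 0; rewrite subr0.
  by under [X in is_derive _ _ X _ -> _]eq_fun do rewrite subr0.
have [C1 C10 C1P] := @gauss_le_jbr R n c (n%:R + 1) c0.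
have K0 : 0 <= 2 * c * pi * (n%:R * jbr x) by rewrite !mulr_ge0 ?pi_ge0 ?jbr_ge0// ltW.
have [C2 C20 C2P] := @gauss_jbr_bound n c _ (n%:R + 1) c0 K0.
have mh' : measurable_fun setT (fun y => - (2 * c * pi * dotp x y) * gauss c y).
  apply: measurable_funM => //; apply: measurable_funN; apply: measurable_funM => //.
  exact: measurable_dotp.
have h'b y : `|- (2 * c * pi * dotp x y) * gauss c y| <= gauss c y * (2 * c * pi * (n%:R * jbr x) * jbr y).
  rewrite normrM (ger0_norm (gauss_ge0 _ _)) mulrC ler_wpM2l ?gauss_ge0// normrN normrM ger0_norm; last first.
    by rewrite !mulr_ge0 ?pi_ge0// ltW.
  have p0 : 0 <= 2 * c * pi by rewrite !mulr_ge0 ?pi_ge0// ltW.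
  by rewrite -[leRHS]mulrA ler_wpM2l// -mulrA; exact: dotp_le_jbr.
have FD t : fourier h' (t *: x) = (0 +i* (2 * pi * dotp x (t *: x)))%C * fourier h (t *: x).
  apply: (@fourier_derive _ _ _ _ _ (C1 + C2) (n%:R + 1)) => //.
  - by rewrite ltrDl.
  - move=> y; rewrite normc_RtoC ger0_norm ?gauss_ge0//; apply: le_trans (C1P y) _.
    by rewrite ler_wpM2r ?powR_ge0// lerDl ltW.
  - move=> y; rewrite normc_RtoC; apply: le_trans (h'b y) _; apply: le_trans (C2P y) _.
    by rewrite ler_wpM2r ?powR_ge0// lerDr ltW.
have iG t : cL1 (fun y => h y * cexpi (- (2 * pi * dotp y (t *: x)))).
  have -> : (fun y => h y * cexpi (- (2 * pi * dotp y (t *: x)))) =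
      (fun y => RtoC (gauss c (y - 0)) * cexpi (- (2 * pi * dotp y (t *: x)))).
    by apply/funext => y; rewrite subr0.
  by apply: cL1_gauss => //; [exact: cmfun_fker|move=> y; rewrite normc_cexpi].
have iG' t : cL1 (fun y => h' y * cexpi (- (2 * pi * dotp y (t *: x)))).
  apply: (@cL1_jbr _ _ _ C2 (n%:R + 1)); first by rewrite ltrDl.
    by apply: cmfunM; [exact: cmfun_RtoC|exact: cmfun_fker].
  move=> y; rewrite Normc.normcM normc_cexpi mulr1 normc_RtoC.
  exact: le_trans (h'b y) (C2P y).
have ReF t : Re (fourier h (t *: x)) = C t.
  rewrite /fourier (cintE (iG t)) /=; congr Rintegral; apply/funext => y.
  by rewrite mul0r subr0 cosN dotpZr; congr (_ * cos _); ring.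
pose S (t : R) := \int[leb R n]_y (gauss c y * - (2 * pi * dotp y x * sin (2 * pi * t * dotp y x))).
have E' t y : Im (h' y * cexpi (- (2 * pi * dotp y (t *: x)))) =
    - c * (gauss c y * - (2 * pi * dotp y x * sin (2 * pi * t * dotp y x))).
  rewrite cImM /= mul0r addr0 sinN dotpZr (dotpC x y).
  rewrite (_ : 2 * pi * (t * dotp y x) = 2 * pi * t * dotp y x); ring.
have iS t : (leb R n).-integrable setT (EFin \o (fun y =>
    gauss c y * - (2 * pi * dotp y x * sin (2 * pi * t * dotp y x)))).
  rewrite (_ : EFin \o _ = (fun y => ((- c)^-1)%:E *
      (Im (h' y * cexpi (- (2 * pi * dotp y (t *: x)))))%:E)%E); last first.
    by apply/funext => y; rewrite -EFinM E' mulrA mulVf ?mul1r// oppr_eq0 gt_eqF.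
  exact: (integrableZl measurableT (- c)^-1 (cL1_Im (iG' t))).
have ImF' t : Im (fourier h' (t *: x)) = - c * S t.
  rewrite /fourier (cintE (iG' t)) /= -RintegralZl//.
  by congr Rintegral; apply/funext => y; exact: E'.
have St t : S t = - (2 * pi * dotp x x / c * t) * C t.
  have := congr1 (@complex.Im R) (FD t); rewrite cImM ImF' ReF [Re _]/= [Im (_ +i* _)%C]/= mul0r add0r dotpZr => H.
  have nc0 : - c != 0 by rewrite oppr_eq0 gt_eqF.
  by apply: (mulfI nc0); rewrite H /=; field; rewrite gt_eqF.
have dC (t0 : R) : is_derive t0 1 C (S t0).
  suff : is_derive (t0 + (0 : R) *: (1 : R)) 1 C (S t0) by rewrite scale0r addr0.
  apply: is_derive_of_line.
  pose f (s : R) (y : 'rV[R]_n) := gauss c y * cos (2 * pi * (t0 + s *: (1 : R)) * dotp y x).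
  pose f' (s : R) (y : 'rV[R]_n) := gauss c y * - (2 * pi * dotp y x * sin (2 * pi * (t0 + s *: (1 : R)) * dotp y x)).
  have -> : S t0 = \int[leb R n]_y f' 0 y.
    by congr Rintegral; apply/funext => y; rewrite /f' scale0r addr0.
  apply: (@is_derive_Rintegral _ _ _ (leb R n) f f' (fun y => C2 / c * jbr y `^ (- (n%:R + 1)))).
  - by move=> t _; exact: int_cos.
  - move=> t y _; rewrite /f /f'.
    have dcos : is_derive t 1 (fun s : R => cos (2 * pi * (t0 + s *: (1 : R)) * dotp y x))
       (- (2 * pi * dotp y x * sin (2 * pi * (t0 + t *: (1 : R)) * dotp y x))).
      have d1 : is_derive t 1 (fun s : R => 2 * pi * (t0 + s *: (1 : R)) * dotp y x) (2 * pi * dotp y x).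
        by apply: is_derive_eq; rewrite /GRing.scale/=; ring.
      apply: (is_derive_eq (@is_derive1_comp R (fun u => cos u) _ t _ _ (is_derive_cos _) d1)).
      by rewrite mulNr mulrC.
    by apply: is_derive_eq; rewrite /GRing.scale/=; ring.
  - by move=> y; rewrite mulr_ge0 ?powR_ge0 ?divr_ge0// ltW.
  - under [X in _.-integrable _ X]eq_fun do rewrite /= EFinM.
    by apply: integrableZl => //; apply: integrable_jbr; rewrite ltrDl.
  - move=> t y _; rewrite mulrAC ler_pdivlMr//.
    apply: le_trans (C2P y); apply: le_trans (h'b y); rewrite /f' mulrC.
    rewrite -[X in X * _](gtr0_norm c0) -normrM.
    rewrite (_ : c * _ = (- (2 * c * pi * dotp x y) * gauss c y) * sin (2 * pi * (t0 + t *: (1 : R)) * dotp y x)); last first.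
      by rewrite (dotpC x y); ring.
    by rewrite normrM ler_piMr// sin_max.
pose k := pi * dotp x x / c.
(* C divided by the expected Gaussian profile: the differential equation makes it constant, and its
   value at 0 is the total mass. *)
pose E (t : R) := C t * expR (k * t ^+ 2).
have dE (t : R) : is_derive t 1 E 0.
  have d1 : is_derive t 1 (fun s : R => k * s ^+ 2) (k * (2 * t)).
    by apply: is_derive_eq; rewrite /GRing.scale/=; ring.
  have d2 := @is_derive1_comp R (@expR R) _ t _ _ (is_derive_expR _) d1.
  have d3 := dC t; rewrite /E; apply: is_derive_eq.
  rewrite St /k /GRing.scale/=; ring.
have E01 : E 1 = E 0 by exact: is_derive_0_is_cst.
have C0E : C 0 = (Num.sqrt c)^-1 ^+ n.
  rewrite /C /Rintegral (_ : (\int[leb R n]_y _)%E = \int[leb R n]_y (gauss c y)%:E)%E.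
    by rewrite integral_gauss.
  by apply: eq_integral => y _; rewrite mulr0 mul0r cos0 mulr1.
have Im0 : Im (fourier h x) = 0.
  have := iG 1; rewrite scale1r => iG1; have [_ mIm] := iG1.1.
  pose g y := Im (h y * cexpi (- (2 * pi * dotp y x))).
  have gN y : g (- y) = - g y.
    by rewrite /g !cImM /= /h gaussN !mul0r !addr0 dotpNl mulrN opprK sinN mulrN opprK.
  have : rint (fun y => g (- y)) = rint g by exact: rint_opp.
  under [X in rint X = _]eq_fun do rewrite gN.
  rewrite rintN => H; rewrite /fourier /cint /=; rewrite -/(rint g) in H.
  move: H; change (- rint g = rint g -> rint g = 0); lra.
have Re1 : Re (fourier h x) = (Num.sqrt c)^-1 ^+ n * gauss c^-1 x.
  have := ReF 1; rewrite scale1r => ->.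
  have : E 1 * expR (- k) = E 0 * expR (- k) by rewrite E01.
  rewrite /E expr1n mulr1 -mulrA -expRD subrr expR0 mulr1 => ->.
  rewrite expr0n/= mulr0 expR0 mulr1 C0E /gauss /k; congr (_ * expR (- _)).
  by rewrite mulrC mulrA.
by apply/eqP; rewrite eq_complex Re1 Im0 /= !eqxx.
Qed.
End gaussian_transform.

(** * Fourier inversion *)
Section inversion.
Variable R : realType.

Lemma integral_prod_lty n m (F : 'rV[R]_n -> 'rV[R]_m -> R) (a : 'rV[R]_n -> R) (b : 'rV[R]_m -> R) :
  measurable_fun setT a -> measurable_fun setT b ->
  (forall x, 0 <= a x) -> (forall y, 0 <= b y) ->
  (\int[leb R n]_x (a x)%:E < +oo)%E -> (\int[leb R m]_y (b y)%:E < +oo)%E ->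
  (forall x y, 0 <= F x y) -> (forall x y, F x y <= a x * b y) ->
  (\int[leb R n]_x \int[leb R m]_y (F x y)%:E < +oo)%E.
Proof.
move=> ma mb a0 b0 aoo boo F0 Fab.
have b1 : (0 <= \int[leb R m]_y (b y)%:E)%E by apply: integral_ge0 => y _; rewrite lee_fin.
apply: (@le_lt_trans _ _ (\int[leb R n]_x ((a x)%:E * \int[leb R m]_y (b y)%:E))%E).
  apply: ge0_le_integral_nm => x; first by apply: integral_ge0 => y _; rewrite lee_fin.
  rewrite -ge0_integralZl//=; last 3 first.
  - exact/measurable_EFinP.
  - by move=> y _; rewrite lee_fin.
  - by rewrite lee_fin.
  by apply: ge0_le_integral_nm => y; rewrite -?EFinM lee_fin.
rewrite ge0_integralZr//=.
- have a1 : (0 <= \int[leb R n]_x (a x)%:E)%E by apply: integral_ge0 => x _; rewrite lee_fin.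
  by rewrite lte_mul_pinfty// ge0_fin_numE.
- exact/measurable_EFinP.
- by move=> x _; rewrite lee_fin.
Qed.

(** Damping an integrable function by a wide Gaussian costs little: the factor 1 - [gauss] tends to
    0 pointwise and is at most 1. The index [k.+2] keeps the parameter at most 1/2, which the
    inversion theorem exploits. *)
Lemma dominated_gauss_lim n (g : 'rV[R]_n -> R) (e : R) : 0 < e ->
  measurable_fun setT g -> (forall x, 0 <= g x) -> (\int[leb R n]_x (g x)%:E < +oo)%E ->
  \forall k \near \oo, (\int[leb R n]_x (g x * (1 - gauss (k.+2%:R)^-1 x))%:E < e%:E)%E.
Proof.
move=> e0 mg g0 goo.
have gi : (leb R n).-integrable setT (EFin \o g).
  by apply: rint_integrable => //; under eq_integral do rewrite ger0_norm//.
have gauss1 k (x : 'rV[R]_n) : 0 <= 1 - gauss (k.+2%:R)^-1 x <= 1.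
  rewrite subr_ge0 lerBlDr lerDl gauss_ge0 andbT /gauss -[leRHS]expR0 ler_expR oppr_le0.
  by rewrite !mulr_ge0 ?pi_ge0 ?dotp_ge0// invr_ge0.
have mf k : measurable_fun setT (fun x => (g x * (1 - gauss (k.+2%:R)^-1 x))%:E).
  apply/measurable_EFinP; apply: measurable_funM => //; apply: measurable_funB => //.
  exact: measurable_gauss.
have H := @dominated_cvg _ _ R (leb R n) setT measurableT
  (fun k x => (g x * (1 - gauss (k.+2%:R)^-1 x))%:E) (cst 0)%E (EFin \o g) mf.
have : (\int[leb R n]_x (g x * (1 - gauss (k.+2%:R)^-1 x))%:E @[k --> \oo] --> (0 : \bar R))%E.
  have := H; rewrite integral_cst// mul0e; apply => //.
  - move=> x _; apply: cvg_EFin; first by near=> k.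
    have h0 : (k.+2%:R^-1 : R) @[k --> \oo] --> (0 : R).
      have := @cvg_harmonic R; rewrite -cvg_shiftS.
      by apply: cvg_trans; apply: near_eq_cvg; near=> k; rewrite /harmonic/=.
    have : (g x * (1 - expR (- (k.+2%:R^-1 * pi * dotp x x)))) @[k --> \oo] -->
        g x * (1 - expR (- (0 * pi * dotp x x))).
      apply: cvgM; first exact: cvg_cst.
      apply: cvgB; first exact: cvg_cst.
      apply: continuous_cvg; first exact: continuous_expR.
      by apply: cvgN; apply: cvgM; [apply: cvgM => //; exact: cvg_cst|exact: cvg_cst].
    by rewrite mul0r mul0r oppr0 expR0 subrr mulr0.
  - move=> k x _ /=; rewrite lee_fin ger0_norm.
      by rewrite ler_piMr//; case/andP: (gauss1 k x).
    by rewrite mulr_ge0//; case/andP: (gauss1 k x).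
move=> H0; apply: (H0 [set y | (y < e%:E)%E]); apply: open_nbhs_nbhs.
by split; [exact: open_ereal_lt_ereal|rewrite /= lte_fin].
Unshelve. all: by end_near. Qed.

(** Away from its center a concentrating Gaussian tends to 0 in spite of its growing peak: with t =
    k + 2, the bound exp(a t) >= (a t)^(n+1) / (n+1)! beats t^(n/2) <= t^n and leaves C / t. *)
Lemma peak_lim n (a e : R) : 0 < a -> 0 < e ->
  \forall k \near \oo, (Num.sqrt (k.+2%:R^-1))^-1 ^+ n * expR (- (a * k.+2%:R)) < e.
Proof.
move=> a0 e0.
pose C := (n.+1)`!%:R / a ^+ n.+1.
have C0 : 0 < C by rewrite divr_gt0 ?exprn_gt0// ltr0n fact_gt0.
near=> k.
have t1 : 1 <= k.+2%:R :> R by rewrite ler1n.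
have t0 : 0 < k.+2%:R :> R by rewrite ltr0n.
have ke : C / e < k.+2%:R.
  apply: (@lt_trans _ _ k%:R); last by rewrite ltr_nat.
  by near: k; exact: nbhs_infty_gtr.
move: t1 t0 ke; move: (k.+2%:R) => t t1 t0 ke.
apply: (@le_lt_trans _ _ (C / t)); last by rewrite ltr_pdivrMr// mulrC -ltr_pdivrMr.
rewrite sqrtrV ?(ltW t0)// invrK expRN.
have st : Num.sqrt t <= t.
  rewrite -ler_sqr ?nnegrE ?sqrtr_ge0 ?(ltW t0)// sqr_sqrtr ?(ltW t0)//.
  by rewrite expr2 ler_peMl ?(ltW t0).
have E1 : (a * t) ^+ n.+1 / n.+1`!%:R <= expR (a * t).
  have := @expR_ge1Dxn R (a * t) n; rewrite mulr_ge0 ?(ltW a0) ?(ltW t0)// => /(_ isT).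
  by apply: le_trans; rewrite lerDr.
have at0 : 0 < (a * t) ^+ n.+1 / n.+1`!%:R.
  by rewrite divr_gt0 ?exprn_gt0 ?mulr_gt0// ltr0n fact_gt0.
have E2 : (expR (a * t))^-1 <= n.+1`!%:R / (a * t) ^+ n.+1.
  by rewrite -[leRHS]invf_div lef_pV2 ?posrE ?expR_gt0.
apply: (@le_trans _ _ (t ^+ n * (n.+1`!%:R / (a * t) ^+ n.+1))).
  apply: ler_pM; rewrite ?exprn_ge0 ?sqrtr_ge0 ?invr_ge0 ?expR_ge0//.
  by rewrite lerXn2r ?nnegrE ?sqrtr_ge0// ltW.
rewrite /C exprMn (exprS t n) le_eqVlt; apply/orP; left; apply/eqP.
have tn0 : t ^+ n != 0 by rewrite gt_eqF// exprn_gt0.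
have an0 : a ^+ n.+1 != 0 by rewrite gt_eqF// exprn_gt0.
move: tn0 an0; move: (t ^+ n) (a ^+ n.+1) => X Y X0 Y0.
by field; rewrite X0 Y0 gt_eqF.
Unshelve. all: by end_near. Qed.

Lemma integral_gauss_sub n c (a : 'rV[R]_n) : 0 < c ->
  (\int[leb R n]_x (gauss c (x - a))%:E = ((Num.sqrt c)^-1 ^+ n)%:E)%E.
Proof.
move=> c0; rewrite (@integral_rVD R n (- a) (fun x => (gauss c x)%:E)) ?integral_gauss//.
  by apply/measurable_EFinP; exact: measurable_gauss.
by move=> x; rewrite lee_fin gauss_ge0.
Qed.

(** Gaussian summation: damping the inversion integral turns it, by Fubini and [fourier_gauss], into
    an average of h against an approximate identity centered at x. *)
Lemma fourier_gauss_mean n (h : 'rV[R]_n -> R[i]) c x : 0 < c -> cL1 h ->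
  cint (fun xi => fourier h xi * (RtoC (gauss c xi) * cexpi (2 * pi * dotp xi x))) =
  cint (fun y => h y * RtoC ((Num.sqrt c)^-1 ^+ n * gauss c^-1 (y - x))).
Proof.
move=> c0 hi; have [mh hoo] := hi.
have mg : cmfun (fun xi : 'rV[R]_n => RtoC (gauss c xi)).
  by apply: cmfun_RtoC; exact: measurable_gauss.
pose F (xi y : 'rV[R]_n) := h y * cexpi (- (2 * pi * dotp y xi)) *
  (RtoC (gauss c xi) * cexpi (2 * pi * dotp xi x)).
have mF : cmfun (fun z : 'rV[R]_n * 'rV[R]_n => F z.1 z.2).
  apply: cmfunM; apply: cmfunM.
  - exact: (cmfun_comp mh measurable_snd).
  - apply: cmfun_cexpi; apply: measurable_funN; apply: measurable_funM => //.
    exact: measurable_dotp.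
  - exact: (cmfun_comp mg measurable_fst).
  - by apply: cmfun_cexpi; apply: measurable_funM => //; exact: measurable_dotp.
have nF xi y : normc (F xi y) = gauss c xi * normc (h y).
  rewrite !Normc.normcM !normc_cexpi !mulr1 normc_RtoC ger0_norm ?gauss_ge0//.
  by rewrite mulrC.
transitivity (cint (fun xi => cint (F xi))).
  apply: eq_cint => xi; rewrite /fourier mulrC -cintZl.
    by apply: eq_cint => y; rewrite mulrC.
  apply: (cL1_lec _ _ hi) => [|y]; first by apply: cmfunM => //; exact: cmfun_fker.
  by rewrite Normc.normcM normc_cexpi mulr1.
rewrite cint_Fubini//; last first.
  apply: (@integral_prod_lty _ _ _ (gauss c) (fun y => normc (h y))) => //.
  - exact: measurable_gauss.
  - exact: cmfun_normc.
  - exact: gauss_ge0.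
  - by move=> y; exact: normc_ge0.
  - by rewrite integral_gauss// ltry.
  - by move=> xi y; exact: normc_ge0.
  - by move=> xi y; rewrite nF.
apply: eq_cint => y; rewrite -(fourier_gauss (y - x) c0) /fourier -cintZl.
  apply: eq_cint => xi; rewrite /F -!mulrA; congr (_ * _).
  rewrite mulrCA; congr (_ * _); rewrite -cexpiD; congr cexpi.
  by rewrite (dotpC y) dotpDr dotpNr; ring.
have := @cL1_gauss R n c 0 (fun xi => cexpi (- (2 * pi * dotp xi (y - x)))) c0.
rewrite (_ : (fun xi => _ * _) = (fun xi => RtoC (gauss c xi) * cexpi (- (2 * pi * dotp xi (y - x))))).
  by apply; [exact: cmfun_fker|move=> xi; rewrite normc_cexpi].
by apply/funext => xi; rewrite subr0.
Qed.

Lemma cintB n (f g : 'rV[R]_n -> R[i]) : cL1 f -> cL1 g ->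
  cint (fun x => f x - g x) = cint f - cint g.
Proof.
move=> fi gi; rewrite -mulN1r -cintZl// -cintD//; last exact: cL1Zl.
by apply: eq_cint => x; rewrite mulN1r.
Qed.

Lemma cint_RtoC n (k : 'rV[R]_n -> R) r : measurable_fun setT k -> (forall x, 0 <= k x) ->
  (\int[leb R n]_x (k x)%:E = r%:E)%E -> cint (fun x => RtoC (k x)) = RtoC r.
Proof.
move=> mk k0 kr; rewrite cintE; last first.
  apply: (@cL1_le _ _ _ k); [exact: cmfun_RtoC| |by rewrite kr ltry].
  by move=> x; rewrite normc_RtoC ger0_norm.
by congr Complex; rewrite /Rintegral ?kr//= integral0.
Qed.

(** The inversion integral L and the value h x are both compared with the Gaussian average A: L - A
    is small by dominated convergence, A - h x by continuity at x and smallness of the kernel away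
    from x. As h is only integrable and continuous at x, the far part is estimated through its L1
    norm. *)
Theorem fourier_inversion n (h : 'rV[R]_n -> R[i]) x :
  cL1 h -> cL1 (fourier h) ->
  (forall e, 0 < e -> exists2 d, 0 < d & forall y, dotp (y - x) (y - x) < d -> normc (h y - h x) <= e) ->
  h x = cint (fun xi => fourier h xi * cexpi (2 * pi * dotp xi x)).
Proof.
move=> hi fhi hc; have [mh hoo] := hi; have [mfh fhoo] := fhi.
set L := cint _.
have W0 : (0 <= \int[leb R n]_y (normc (h y))%:E)%E.
  by apply: integral_ge0 => y _; rewrite lee_fin normc_ge0.
pose W := fine (\int[leb R n]_y (normc (h y))%:E)%E.
have WE : (\int[leb R n]_y (normc (h y))%:E = W%:E)%E by rewrite fineK// ge0_fin_numE.
have mk c : cmfun (fun y : 'rV[R]_n => RtoC ((Num.sqrt c)^-1 ^+ n * gauss c^-1 (y - x))).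
  apply: cmfun_RtoC; apply: measurable_funM => //; apply: measurable_gauss.
  exact: measurable_rVD.
have k0 c (y : 'rV[R]_n) : 0 <= (Num.sqrt c)^-1 ^+ n * gauss c^-1 (y - x).
  by rewrite mulr_ge0 ?gauss_ge0// exprn_ge0// invr_ge0 sqrtr_ge0.
have ik c : 0 < c -> (\int[leb R n]_y ((Num.sqrt c)^-1 ^+ n * gauss c^-1 (y - x))%:E = 1)%E.
  move=> c0; under eq_integral do rewrite EFinM.
  rewrite ge0_integralZl//=.
  - rewrite integral_gauss_sub ?invr_gt0// -EFinM -exprMn sqrtrV ?ltW// invrK.
    by rewrite mulVf ?expr1n// gt_eqF// sqrtr_gt0.
  - by apply/measurable_EFinP; apply: measurable_gauss; exact: measurable_rVD.
  - by move=> y _; rewrite lee_fin gauss_ge0.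
(* 2 e comes from L - A and 4 e from A - h x; both contain the factor 2 of [normc_cint]. *)
suff key e : 0 < e -> normc (L - h x) <= 6 * e.
  have : normc (L - h x) = 0.
    apply/eqP; rewrite eq_le normc_ge0 andbT; apply/ler_addgt0Pr => e e0; rewrite add0r.
    by rewrite (_ : e = 6 * (e / 6)); [apply: key; rewrite divr_gt0|field].
  by move/Normc.eq0_normc/eqP; rewrite subr_eq0 => /eqP.
move=> e0; have [d d0 hd] := hc e e0.
have WH : 0 < e / (W + normc (h x) + 1).
  by rewrite divr_gt0// ltr_wpDl// addr_ge0 ?normc_ge0// fine_ge0.
have d2 : 0 < pi * d / 2 by rewrite divr_gt0// mulr_gt0// pi_gt0.
have [k [k1 k2]] : exists k, (\int[leb R n]_xi (normc (fourier h xi) * (1 - gauss (k.+2%:R)^-1 xi))%:E < e%:E)%E /\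
    (Num.sqrt (k.+2%:R^-1))^-1 ^+ n * expR (- (pi * d / 2 * k.+2%:R)) < e / (W + normc (h x) + 1).
  have [k kP] := filter_ex (filterI (dominated_gauss_lim e0 (cmfun_normc mfh) (fun xi => normc_ge0 _) fhoo) (peak_lim n d2 WH)).
  by exists k.
set c := (k.+2%:R)^-1 in k1 k2.
have c0 : 0 < c by rewrite invr_gt0.
have c12 : c <= 2^-1 by rewrite lef_pV2 ?posrE// ler_nat.
pose A := cint (fun y => h y * RtoC ((Num.sqrt c)^-1 ^+ n * gauss c^-1 (y - x))).
have g1 (xi : 'rV[R]_n) : 0 <= 1 - gauss c xi.
  rewrite subr_ge0 /gauss -[leRHS]expR0 ler_expR oppr_le0.
  by rewrite !mulr_ge0 ?pi_ge0 ?dotp_ge0// ltW.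
have mge (xi : 'rV[R]_n -> 'rV[R]_n) : measurable_fun setT (gauss c : 'rV[R]_n -> R).
  exact: measurable_gauss.
have mexp : cmfun (fun xi => cexpi (2 * pi * dotp xi x)).
  by apply: cmfun_cexpi; apply: measurable_funM => //; exact: measurable_dotp.
have LA : normc (L - A) <= 2 * e.
  rewrite /A -fourier_gauss_mean// /L -cintB; last 2 first.
  - apply: (cL1_lec _ _ fhi) => [|xi]; first exact: cmfunM.
    by rewrite Normc.normcM normc_cexpi mulr1.
  - apply: (cL1_lec _ _ fhi) => [|xi].
      by apply: cmfunM => //; apply: cmfunM => //; apply: cmfun_RtoC; exact: measurable_gauss.
    rewrite !Normc.normcM normc_cexpi mulr1 normc_RtoC ger0_norm ?gauss_ge0//.
    by rewrite ler_piMr ?normc_ge0// -subr_ge0.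
  rewrite -lee_fin; apply: le_trans (normc_cint _) _.
    rewrite (_ : (fun _ => _) = (fun xi => fourier h xi * (RtoC (1 - gauss c xi) * cexpi (2 * pi * dotp xi x)))).
      apply: cmfunM => //; apply: cmfunM => //; apply: cmfun_RtoC; apply: measurable_funB => //.
      exact: measurable_gauss.
    apply/funext => xi; rewrite -mulrBr; congr (_ * _).
    by apply/eqP; rewrite eq_complex/= !mul0r !addr0 !subr0 mulrBl mul1r mulrBl mul1r !eqxx.
  rewrite EFinM lee_pmul2l// ltW//; apply: le_lt_trans k1.
  apply: ge0_le_integral_nm => xi; rewrite lee_fin ?normc_ge0//.
  rewrite -mulrBr Normc.normcM ler_wpM2l ?normc_ge0//.
  rewrite (_ : _ - _ = RtoC (1 - gauss c xi) * cexpi (2 * pi * dotp xi x)); last first.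
    by apply/eqP; rewrite eq_complex/= !mul0r !addr0 !subr0 mulrBl mul1r mulrBl mul1r !eqxx.
  by rewrite Normc.normcM normc_cexpi mulr1 normc_RtoC ger0_norm.
have ikc : cL1 (fun y : 'rV[R]_n => RtoC ((Num.sqrt c)^-1 ^+ n * gauss c^-1 (y - x))).
  apply: (@cL1_le _ _ _ (fun y => (Num.sqrt c)^-1 ^+ n * gauss c^-1 (y - x))) => //.
    by move=> y; rewrite normc_RtoC ger0_norm.
  by rewrite ik// ltry.
have kb (y : 'rV[R]_n) : (Num.sqrt c)^-1 ^+ n * gauss c^-1 (y - x) <= (Num.sqrt c)^-1 ^+ n.
  rewrite ler_piMr ?exprn_ge0 ?invr_ge0 ?sqrtr_ge0// /gauss -[leRHS]expR0 ler_expR oppr_le0.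
  by rewrite !mulr_ge0 ?pi_ge0 ?dotp_ge0// invr_ge0 ltW.
set rho := _ * expR _ in k2.
(* Half of the exponent, at squared distance at least d, produces the small constant [rho]; the
   other half is still dominated by [gauss 1] because c <= 1/2. *)
have far y : d <= dotp (y - x) (y - x) ->
    (Num.sqrt c)^-1 ^+ n * gauss c^-1 (y - x) <= rho * gauss 1 (y - x).
  move=> dy; rewrite /rho -mulrA ler_wpM2l ?exprn_ge0 ?invr_ge0 ?sqrtr_ge0//.
  rewrite /gauss -expRD ler_expR mul1r.
  rewrite (_ : k.+2%:R = c^-1); last by rewrite /c invrK.
  have cV2 : 2 <= c^-1 by rewrite -[leLHS]invrK lef_pV2 ?posrE.
  move: dy cV2 (pi_gt0 R) d0; move: (dotp _ _) (c^-1) pi => D X P dy cV2 P0 d0.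
  rewrite (_ : - (P * d / 2 * X) + - (P * D) = - (P * (d * X / 2 + D))); last by ring.
  rewrite lerN2 (_ : X * P * D = P * (X * D)); last by ring.
  rewrite ler_wpM2l ?(ltW P0)//; nra.
have rho0 : 0 <= rho by rewrite mulr_ge0 ?expR_ge0// exprn_ge0// invr_ge0 sqrtr_ge0.
clearbody rho.
have Ah : normc (A - h x) <= 4 * e.
  have -> : h x = cint (fun y => h x * RtoC ((Num.sqrt c)^-1 ^+ n * gauss c^-1 (y - x))).
    rewrite cintZl// (@cint_RtoC _ _ 1) ?mulr1//; last exact: ik.
    by case: (mk c).
  have iA : cL1 (fun y => h y * RtoC ((Num.sqrt c)^-1 ^+ n * gauss c^-1 (y - x))).
    apply: (cL1_lec _ _ (cL1Zl (RtoC ((Num.sqrt c)^-1 ^+ n)) hi)) => [|y].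
      exact: cmfunM.
    rewrite !Normc.normcM mulrC ler_wpM2r ?normc_ge0// !normc_RtoC ger0_norm//.
    by rewrite ger0_norm// exprn_ge0// invr_ge0 sqrtr_ge0.
  rewrite /A -cintB//; last exact: cL1Zl.
  rewrite -lee_fin; apply: le_trans (normc_cint _) _.
    by case: (cL1D iA (cL1Zl (-1) (cL1Zl (h x) ikc))); under eq_fun do rewrite mulN1r.
  rewrite (_ : 4 * e = 2 * (2 * e)); last by ring.
  rewrite [in leRHS]EFinM lee_pmul2l//.
  apply: (@le_trans _ _ (\int[leb R n]_y ((e * ((Num.sqrt c)^-1 ^+ n * gauss c^-1 (y - x)))%:E +
      ((rho * normc (h y))%:E + (rho * normc (h x) * gauss 1 (y - x))%:E)))%E).
    apply: ge0_le_integral_nm => y; rewrite -?EFinD lee_fin ?normc_ge0//.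
    rewrite -mulrBl Normc.normcM normc_RtoC (ger0_norm (k0 _ _)).
    have gy := gauss_ge0 1 (y - x).
    have [dy|dy] := ltP (dotp (y - x) (y - x)) d.
      apply: le_trans (_ : _ <= e * ((Num.sqrt c)^-1 ^+ n * gauss c^-1 (y - x))) _.
        by rewrite ler_wpM2r// hd.
      by rewrite lerDl addr_ge0 ?mulr_ge0 ?normc_ge0.
    apply: le_trans (_ : _ <= (normc (h y) + normc (h x)) * (rho * gauss 1 (y - x))) _.
      apply: ler_pM => //; rewrite ?normc_ge0// ?far//.
      by apply: le_trans (le_normcD _ _) _; rewrite normcN.
    have gy1 : gauss 1 (y - x) <= 1.
      rewrite /gauss -[leRHS]expR0 ler_expR oppr_le0.
      by rewrite !mulr_ge0 ?pi_ge0 ?dotp_ge0.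
    rewrite mulrDl; apply: le_trans (_ : _ <= rho * normc (h y) + rho * normc (h x) * gauss 1 (y - x)) _.
      rewrite lerD//; last by rewrite mulrCA mulrA.
      by rewrite mulrCA mulrA ler_piMr// mulr_ge0 ?normc_ge0.
    by rewrite lerDr mulr_ge0// ltW.
  have mgx : measurable_fun setT (fun y : 'rV[R]_n => gauss 1 (y - x)).
    by apply: measurable_gauss; exact: measurable_rVD.
  have mgc : measurable_fun setT (fun y : 'rV[R]_n => (Num.sqrt c)^-1 ^+ n * gauss c^-1 (y - x)).
    by case: (mk c).
  rewrite ge0_integralD//; last 4 first.
  - by move=> y _; rewrite lee_fin mulr_ge0// ltW.
  - by apply/measurable_EFinP; exact: measurable_funM.
  - by move=> y _; apply: adde_ge0; rewrite lee_fin ?mulr_ge0 ?normc_ge0 ?gauss_ge0.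
  - by apply: emeasurable_funD; apply/measurable_EFinP; apply: measurable_funM => //; exact: cmfun_normc.
  rewrite ge0_integralD//; last 4 first.
  - by move=> y _; rewrite lee_fin mulr_ge0 ?normc_ge0.
  - by apply/measurable_EFinP; apply: measurable_funM => //; exact: cmfun_normc.
  - by move=> y _; rewrite lee_fin !mulr_ge0 ?normc_ge0 ?gauss_ge0.
  - by apply/measurable_EFinP; exact: measurable_funM.
  under eq_integral do rewrite EFinM.
  under [X in (_ + (X + _))%E]eq_integral do rewrite EFinM.
  under [X in (_ + (_ + X))%E]eq_integral do rewrite EFinM.
  rewrite !ge0_integralZl//=; try (by move=> y _; rewrite lee_fin ?k0 ?normc_ge0 ?gauss_ge0);
    try (by apply/measurable_EFinP => //; exact: cmfun_normc); try (by rewrite lee_fin ?mulr_ge0 ?normc_ge0// ltW).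
  rewrite ik// WE integral_gauss_sub// mule1 -!EFinM -!EFinD lee_fin.
  rewrite sqrtr1 invr1 expr1n mulr1 -mulrDr.
  have : rho * (W + normc (h x)) <= e.
    have := k2; rewrite ltr_pdivlMr; last by rewrite ltr_wpDl// addr_ge0 ?normc_ge0// fine_ge0.
    by move=> /ltW; apply: le_trans; rewrite ler_wpM2l// lerDl.
  lra.
rewrite (_ : L - h x = (L - A) + (A - h x)); last by ring.
by apply: le_trans (le_normcD _ _) _; lra.
Qed.
End inversion.

(** * Polynomial decay under convolution *)

Section convolution.
Variable R : realType.

Definition Ijbr n (N : R) : R := fine (\int[leb R n]_x (jbr x `^ (- N))%:E).

Lemma Ijbr_ge0 n N : 0 <= Ijbr n N.
Proof. by rewrite fine_ge0// integral_ge0// => x _; rewrite lee_fin powR_ge0. Qed.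

Lemma IjbrE n N : n%:R < N -> (\int[leb R n]_x (jbr x `^ (- N))%:E = (Ijbr n N)%:E)%E.
Proof.
move=> nN; rewrite fineK// ge0_fin_numE ?integral_jbr_lty//.
by apply: integral_ge0 => x _; rewrite lee_fin powR_ge0.
Qed.

(** The larger of <z> and <x - z> is at least <x>/4 and takes over the decay in x; what remains is a
    power -N of <z> or of <x - z>. The exchange of powers in [H2] uses k <= N. *)
Lemma jbr_powR_conv_le n (N k : R) (x z : 'rV[R]_n) : 0 <= k -> k <= N ->
  jbr z `^ (- N) * jbr (x - z) `^ (- k) <=
  4 `^ k * jbr x `^ (- k) * (2 * jbr z `^ (- N) + jbr (x - z) `^ (- N)).
Proof.
move=> k0 kN.
have x0 := jbr_gt0 x; have z0 := jbr_gt0 z; have w0 := jbr_gt0 (x - z).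
have H : jbr x `^ k <= 4 `^ k * (jbr z `^ k + jbr (x - z) `^ k).
  have Hx : jbr x <= 2 * (jbr z + jbr (x - z)) by have := jbrD_sum z (x - z); rewrite addrC subrK.
  have [zw|/ltW wz] := leP (jbr z) (jbr (x - z)).
    apply: (@le_trans _ _ (4 `^ k * jbr (x - z) `^ k)); last by rewrite ler_wpM2l ?powR_ge0// lerDr powR_ge0.
    by rewrite -powRM ?(ltW w0)//; apply: ge0_ler_powR; rewrite ?nnegrE ?mulr_ge0 ?(ltW x0) ?(ltW w0)//; lra.
  apply: (@le_trans _ _ (4 `^ k * jbr z `^ k)); last by rewrite ler_wpM2l ?powR_ge0// lerDl powR_ge0.
  by rewrite -powRM ?(ltW z0)//; apply: ge0_ler_powR; rewrite ?nnegrE ?mulr_ge0 ?(ltW x0) ?(ltW z0)//; lra.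
have H2 : jbr z `^ (- N) * (jbr (x - z) `^ (- k) * jbr z `^ k) <= jbr z `^ (- N) + jbr (x - z) `^ (- N).
  have NkE (u : R) : u > 0 -> u `^ (- N) = u `^ (- (N - k)) * u `^ (- k).
    by move=> u0; rewrite -powRD ?(gt_eqF u0) ?implybT//; congr (_ `^ _); ring.
  have [zw|/ltW wz] := leP (jbr z) (jbr (x - z)).
    apply: (@le_trans _ _ (jbr z `^ (- N))); last by rewrite lerDl powR_ge0.
    rewrite ler_piMr ?powR_ge0// powRN mulrC ler_pdivrMr ?powR_gt0// mul1r.
    by apply: ge0_ler_powR; rewrite ?nnegrE ?(ltW z0) ?(ltW w0).
  apply: (@le_trans _ _ (jbr (x - z) `^ (- N))); last by rewrite lerDr powR_ge0.
  have zk : jbr z `^ (- k) * jbr z `^ k = 1 by rewrite powRN mulVf// gt_eqF// powR_gt0.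
  rewrite [leRHS]NkE// [X in X * _]NkE// mulrACA zk mulr1.
  rewrite ler_wpM2r ?powR_ge0// !powRN lef_pV2 ?posrE ?powR_gt0//.
  by apply: ge0_ler_powR; rewrite ?nnegrE ?(ltW z0) ?(ltW w0)// subr_ge0.
have wk : jbr (x - z) `^ (- k) * jbr (x - z) `^ k = 1 by rewrite powRN mulVf// gt_eqF// powR_gt0.
have E : jbr z `^ (- N) * jbr (x - z) `^ (- k) =
    jbr x `^ (- k) * (jbr z `^ (- N) * jbr (x - z) `^ (- k) * jbr x `^ k).
  by rewrite mulrCA (powRN (jbr x)) mulVf ?mulr1// gt_eqF// powR_gt0.
rewrite E (mulrC (4 `^ k)) -[leRHS]mulrA ler_wpM2l ?powR_ge0//.
apply: (@le_trans _ _ (jbr z `^ (- N) * jbr (x - z) `^ (- k) * (4 `^ k * (jbr z `^ k + jbr (x - z) `^ k)))).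
  by rewrite ler_wpM2l// mulr_ge0 ?powR_ge0.
rewrite mulrCA ler_wpM2l ?powR_ge0//.
move: wk H2; move: (jbr z `^ (- N)) (jbr z `^ k) (jbr (x - z) `^ (- k)) (jbr (x - z) `^ k) (jbr (x - z) `^ (- N)).
move=> a b c d e wk H2; rewrite (_ : a * c * (b + d) = a * (c * b) + a * (c * d)); last by ring.
rewrite wk; clear -H2; lra.
Qed.

Lemma integral_jbr_conv n (N k : R) (x : 'rV[R]_n) : n%:R < N -> 0 <= k -> k <= N ->
  (\int[leb R n]_z (jbr z `^ (- N) * jbr (x - z) `^ (- k))%:E <=
   (4 `^ k * 3 * Ijbr n N * jbr x `^ (- k))%:E)%E.
Proof.
move=> nN k0 kN.
have mj : measurable_fun setT (fun z : 'rV[R]_n => jbr z `^ (- N)) by exact: measurable_jbr_powR.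
have mjx : measurable_fun setT (fun z : 'rV[R]_n => jbr (x - z) `^ (- N)).
  apply: measurable_jbr_powR; under eq_fun do rewrite addrC.
  exact: (measurableT_comp (measurable_rVD x) (@measurable_rVN R n)).
apply: (@le_trans _ _ (\int[leb R n]_z ((4 `^ k * jbr x `^ (- k))%:E *
   ((2%:E * (jbr z `^ (- N))%:E) + (jbr (x - z) `^ (- N))%:E)))%E).
  apply: ge0_le_integral_nm => z; first by rewrite lee_fin mulr_ge0 ?powR_ge0.
  by rewrite [leRHS](_ : _ = (4 `^ k * jbr x `^ (- k) * (2 * jbr z `^ (- N) + jbr (x - z) `^ (- N)))%:E)// lee_fin jbr_powR_conv_le.
have p0 (y : 'rV[R]_n) : (0 <= (jbr y `^ (- N))%:E)%E by rewrite lee_fin powR_ge0.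
have mjE : measurable_fun setT (fun z : 'rV[R]_n => (jbr z `^ (- N))%:E) by exact/measurable_EFinP.
have mjxE : measurable_fun setT (fun z : 'rV[R]_n => (jbr (x - z) `^ (- N))%:E) by exact/measurable_EFinP.
have m2 : measurable_fun setT (fun z : 'rV[R]_n => 2%:E * (jbr z `^ (- N))%:E)%E.
  exact: (emeasurable_funM (measurable_cst _) mjE).
have mS := emeasurable_funD m2 mjxE.
have p2 (z : 'rV[R]_n) : (0 <= 2%:E * (jbr z `^ (- N))%:E)%E by apply: mule_ge0.
rewrite (ge0_integralZl_EFin _ measurableT _ mS); last 2 first.
- by move=> z _; apply: adde_ge0.
- by rewrite mulr_ge0 ?powR_ge0.
rewrite (ge0_integralD _ measurableT (fun z _ => p2 z) m2 (fun z _ => p0 _) mjxE).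
rewrite (ge0_integralZl_EFin _ measurableT (fun z _ => p0 z) mjE); last by [].
rewrite (integral_rVB x mjE p0) (IjbrE nN).
rewrite [leLHS](_ : _ = (4 `^ k * jbr x `^ (- k) * (2 * Ijbr n N + Ijbr n N))%:E)//.
rewrite lee_fin; move: (4 `^ k) (jbr x `^ (- k)) (Ijbr n N) => a b d.
by rewrite le_eqVlt; apply/orP; left; apply/eqP; ring.
Qed.

Lemma measurable_rVB n (x : 'rV[R]_n) : measurable_fun setT (fun z : 'rV[R]_n => x - z).
Proof.
under eq_fun do rewrite addrC.
exact: (measurableT_comp (measurable_rVD x) (@measurable_rVN R n)).
Qed.

Lemma cmfun_fourier n (h : 'rV[R]_n -> R[i]) : cmfun h -> cmfun (fourier h).
Proof.
move=> mh; apply: (cmfun_cint (F := fun xi y => h y * cexpi (- (2 * pi * dotp y xi)))).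
apply: cmfunM; first exact: (cmfun_comp mh measurable_snd).
apply: cmfun_cexpi; apply: measurable_funN; apply: measurable_funM => //.
exact: measurable_dotp.
Qed.

Lemma fourier_le n (h : 'rV[R]_n -> R[i]) x : cmfun h ->
  ((normc (fourier h x))%:E <= 2%:E * \int[leb R n]_y (normc (h y))%:E)%E.
Proof.
move=> mh; apply: le_trans (normc_cint _) _.
  by apply: cmfunM => //; exact: cmfun_fker.
by under eq_integral do rewrite Normc.normcM normc_cexpi mulr1.
Qed.

(** B enters only through its representation as a superposition of characters, so that the product
    with A becomes a convolution of b with the transform of A. *)
Lemma fourier_mul n (A B b : 'rV[R]_n -> R[i]) x : cL1 A -> cL1 b ->
  (forall y, B y = cint (fun z => b z * cexpi (2 * pi * dotp z y))) ->
  fourier (fun y => A y * B y) x = cint (fun z => b z * fourier A (x - z)).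
Proof.
move=> Ai bi BE; have [mA Aoo] := Ai; have [mb boo] := bi.
pose F (y z : 'rV[R]_n) := A y * cexpi (- (2 * pi * dotp y x)) * (b z * cexpi (2 * pi * dotp z y)).
have mF : cmfun (fun w : 'rV[R]_n * 'rV[R]_n => F w.1 w.2).
  apply: cmfunM; apply: cmfunM.
  - exact: (cmfun_comp mA measurable_fst).
  - exact: cmfun_fker.
  - exact: (cmfun_comp mb measurable_snd).
  - by apply: cmfun_cexpi; apply: measurable_funM => //; exact: measurable_dotp.
have bei y : cL1 (fun z => b z * cexpi (2 * pi * dotp z y)).
  apply: (cL1_lec _ _ bi) => [|z]; last by rewrite Normc.normcM normc_cexpi mulr1.
  by apply: cmfunM => //; apply: cmfun_cexpi; apply: measurable_funM => //; exact: measurable_dotp.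
have Aei t : cL1 (fun y => A y * cexpi (- (2 * pi * dotp y t))).
  apply: (cL1_lec _ _ Ai) => [|z]; last by rewrite Normc.normcM normc_cexpi mulr1.
  by apply: cmfunM => //; exact: cmfun_fker.
transitivity (cint (fun y => cint (F y))).
  apply: eq_cint => y; rewrite /F cintZl// -BE mulrAC//.
rewrite cint_Fubini//; last first.
  apply: (@integral_prod_lty _ _ _ _ (fun y => normc (A y)) (fun z => normc (b z))) => //.
  - exact: cmfun_normc.
  - exact: cmfun_normc.
  - by move=> y; exact: normc_ge0.
  - by move=> y; exact: normc_ge0.
  - by move=> y z; exact: normc_ge0.
  - by move=> y z; rewrite !Normc.normcM !normc_cexpi !mulr1.
apply: eq_cint => z; rewrite /fourier -cintZl//.
apply: eq_cint => y; rewrite /F.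
rewrite (_ : cexpi (- (2 * pi * dotp y (x - z))) =
    cexpi (- (2 * pi * dotp y x)) * cexpi (2 * pi * dotp z y)); last first.
  by rewrite -cexpiD; congr cexpi; rewrite dotpDr dotpNr (dotpC z); ring.
ring.
Qed.

(** Since b occurs only under an integral, its bound can be used almost everywhere, which is the
    form in which an essential supremum delivers it. *)
Lemma fourier_mul_le n (A B b : 'rV[R]_n -> R[i]) (N k C1 C2 : R) x :
  n%:R < N -> 0 <= k -> k <= N -> 0 <= C1 -> 0 <= C2 ->
  cL1 A -> cL1 b ->
  (forall y, B y = cint (fun z => b z * cexpi (2 * pi * dotp z y))) ->
  (forall z, normc (fourier A z) <= C1 * jbr z `^ (- k)) ->
  {ae leb R n, forall z, normc (b z) <= C2 * jbr z `^ (- N)} ->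
  normc (fourier (fun y => A y * B y) x) <= 2 * (4 `^ k * 3 * Ijbr n N) * (C1 * C2) * jbr x `^ (- k).
Proof.
move=> nN k0 kN C10 C20 Ai bi BE AC bC; have [mA Aoo] := Ai; have [mb boo] := bi.
rewrite (fourier_mul x Ai bi BE).
have mAx : cmfun (fun z : 'rV[R]_n => fourier A (x - z)).
  exact: (cmfun_comp (cmfun_fourier mA) (measurable_rVB x)).
rewrite -lee_fin; apply: le_trans (normc_cint _) _; first exact: cmfunM.
rewrite -!mulrA EFinM lee_pmul2l//.
apply: (@le_trans _ _ (\int[leb R n]_z ((C1 * C2)%:E * (jbr z `^ (- N) * jbr (x - z) `^ (- k))%:E))%E).
  apply: ae_ge0_le_integral => //.
  - by move=> z _; rewrite lee_fin normc_ge0.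
  - by apply: cmfun_normcE; exact: cmfunM.
  - by move=> z _; rewrite -EFinM lee_fin !mulr_ge0 ?powR_ge0.
  - apply: emeasurable_funM => //; apply/measurable_EFinP; apply: measurable_funM.
      exact: measurable_jbr_powR.
    by apply: measurable_jbr_powR; exact: measurable_rVB.
  apply: filterS bC => z bz _; rewrite -EFinM lee_fin Normc.normcM.
  rewrite (mulrC C1) mulrACA.
  by apply: ler_pM bz (AC _); exact: normc_ge0.
rewrite ge0_integralZl//=; last 3 first.
- apply/measurable_EFinP; apply: measurable_funM.
    exact: measurable_jbr_powR.
  by apply: measurable_jbr_powR; exact: measurable_rVB.
- by move=> z _; rewrite lee_fin !mulr_ge0 ?powR_ge0.
- by rewrite lee_fin mulr_ge0.
apply: le_trans (lee_wpmul2l _ (integral_jbr_conv x nN k0 kN)) _.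
  by rewrite lee_fin mulr_ge0.
by rewrite -EFinM lee_fin le_eqVlt; apply/orP; left; apply/eqP; ring.
Qed.

(** Passes from the sup-norm balls of the topology to the Euclidean form of continuity in
    [fourier_inversion]. *)
Lemma continuous_dotp n (f : 'rV[R]_n -> R) x e : {for x, continuous f} -> 0 < e ->
  exists2 d, 0 < d & forall y, dotp (y - x) (y - x) < d -> `|f y - f x| <= e.
Proof.
move=> cf e0.
have /cvgrPdist_le /(_ _ e0) /nbhs_ballP [d /= d0 dP] := cf.
exists (d ^+ 2) => [|y yx]; first by rewrite exprn_gt0.
rewrite distrC; apply: dP; split => // i j; rewrite (ord1 i) /ball/= distrC.
rewrite -ltr_sqr ?nnegrE ?(ltW d0)// real_normK ?num_real//; apply: le_lt_trans yx.
rewrite /dotp (bigD1 j)//= !mxE -expr2 lerDl sumr_ge0// => l _.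
by rewrite -expr2 sqr_ge0.
Qed.

(** The decay, of order N > n, makes the transform integrable, as inversion requires. *)
Lemma fourier_repr n (B : 'rV[R]_n -> R[i]) (C N : R) : n%:R < N -> 0 <= C -> cL1 B ->
  (continuous (fun y => Re (B y))) -> (continuous (fun y => Im (B y))) ->
  {ae leb R n, forall z, normc (fourier B z) <= C * jbr z `^ (- N)} ->
  cL1 (fourier B) /\ forall y, B y = cint (fun z => fourier B z * cexpi (2 * pi * dotp z y)).
Proof.
move=> nN C0 Bi cR cI BC; have [mB Boo] := Bi.
have fBi : cL1 (fourier B).
  split; first exact: cmfun_fourier.
  apply: (@le_lt_trans _ _ (\int[leb R n]_z (C%:E * (jbr z `^ (- N))%:E))%E).
    apply: ae_ge0_le_integral => //.
    - by move=> z _; rewrite lee_fin normc_ge0.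
    - by apply: cmfun_normcE; exact: cmfun_fourier.
    - by move=> z _; rewrite -EFinM lee_fin mulr_ge0 ?powR_ge0.
    - by apply: emeasurable_funM => //; apply/measurable_EFinP; exact: measurable_jbr_powR.
    by apply: filterS BC => z Bz _; rewrite -EFinM lee_fin.
  rewrite ge0_integralZl//=.
  - by rewrite IjbrE// -EFinM ltry.
  - by apply/measurable_EFinP; exact: measurable_jbr_powR.
  - by move=> z _; rewrite lee_fin powR_ge0.
split => // y; apply: fourier_inversion => // e e0.
have e2 : 0 < e / 2 by rewrite divr_gt0.
have [d1 d10 H1] := continuous_dotp (cR y) e2.
have [d2 d20 H2] := continuous_dotp (cI y) e2.
exists (Num.min d1 d2) => [|w]; first by rewrite lt_min d10.
rewrite lt_min => /andP[w1 w2]; apply: le_trans (normc_le_ReIm _) _.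
rewrite cReD cImD cReN cImN (_ : e = e / 2 + e / 2); last by field.
by rewrite lerD ?H1 ?H2.
Qed.
End convolution.

(** * Functions with a decaying Fourier transform *)
Section wiener.
Variable R : realType.

(** A weighted Fourier algebra, with [b] in the role of the Fourier transform of B. Keeping [b] as a
    witness makes sums, scalar multiples and products with integrable functions direct. *)
Definition wien n (N C : R) (B : 'rV[R]_n -> R[i]) := exists b,
  [/\ cL1 b, forall y, B y = cint (fun z => b z * cexpi (2 * pi * dotp z y)) &
      {ae leb R n, forall z, normc (b z) <= C * jbr z `^ (- N)}].

Lemma wien_cmfun n N C (B : 'rV[R]_n -> R[i]) : wien N C B -> cmfun B.
Proof.
move=> [b [[mb _] BE _]]; rewrite (funext BE).
apply: (cmfun_cint (F := fun y z => b z * cexpi (2 * pi * dotp z y))).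
apply: cmfunM; first exact: (cmfun_comp mb measurable_snd).
by apply: cmfun_cexpi; apply: measurable_funM => //; exact: measurable_dotp.
Qed.

Lemma wien_bound n N C (B : 'rV[R]_n -> R[i]) y : n%:R < N -> 0 <= C -> wien N C B ->
  normc (B y) <= 2 * (C * Ijbr n N).
Proof.
move=> nN C0 [b [[mb _] BE bC]]; rewrite -lee_fin EFinM BE.
have mE : cmfun (fun z : 'rV[R]_n => cexpi (2 * pi * dotp z y)).
  by apply: cmfun_cexpi; apply: measurable_funM => //; exact: measurable_dotp.
apply: le_trans (normc_cint (cmfunM mb mE)) _; apply: lee_wpmul2l => //.
have mj : measurable_fun setT (fun z : 'rV[R]_n => (jbr z `^ (- N))%:E).
  by apply/measurable_EFinP; exact: measurable_jbr_powR.
have j0 (z : 'rV[R]_n) : (0 <= (jbr z `^ (- N))%:E)%E by rewrite lee_fin powR_ge0.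
apply: (@le_trans _ _ (\int[leb R n]_z (C%:E * (jbr z `^ (- N))%:E))%E).
  apply: ae_ge0_le_integral => //.
  - by move=> z _; rewrite lee_fin normc_ge0.
  - by apply: cmfun_normcE; exact: cmfunM.
  - by move=> z _; apply: mule_ge0.
  - exact: (emeasurable_funM (measurable_cst _) mj).
  - by apply: filterS bC => z bz _; rewrite Normc.normcM normc_cexpi mulr1 -EFinM lee_fin.
by rewrite (ge0_integralZl_EFin _ measurableT (fun z _ => j0 z) mj C0) IjbrE.
Qed.

Lemma wienZ n N C k (B : 'rV[R]_n -> R[i]) : wien N C B -> wien N (normc k * C) (fun y => k * B y).
Proof.
move=> [b [bi BE bC]]; exists (fun z => k * b z); split; first exact: cL1Zl.
  move=> y; rewrite BE -cintZl; first by apply: eq_cint => z; rewrite mulrA.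
  apply: (cL1_lec _ _ bi) => [|z]; last by rewrite Normc.normcM normc_cexpi mulr1.
  apply: (cmfunM bi.1); apply: cmfun_cexpi; apply: measurable_funM => //; exact: measurable_dotp.
by apply: filterS bC => z bz; rewrite Normc.normcM -mulrA ler_wpM2l// normc_ge0.
Qed.

Lemma wienD n N C1 C2 (B1 B2 : 'rV[R]_n -> R[i]) : wien N C1 B1 -> wien N C2 B2 ->
  wien N (C1 + C2) (fun y => B1 y + B2 y).
Proof.
move=> [b1 [b1i B1E b1C]] [b2 [b2i B2E b2C]]; exists (fun z => b1 z + b2 z); split; first exact: cL1D.
  move=> y; have H b : cL1 b -> cL1 (fun z : 'rV[R]_n => b z * cexpi (2 * pi * dotp z y)).
    move=> bi; apply: (cL1_lec _ _ bi) => [|z]; last by rewrite Normc.normcM normc_cexpi mulr1.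
    apply: (cmfunM bi.1); apply: cmfun_cexpi; apply: measurable_funM => //; exact: measurable_dotp.
  rewrite B1E B2E -cintD; [|exact: H|exact: H].
  by apply: eq_cint => z; rewrite -mulrDl.
apply: filterS2 b1C b2C => z b1z b2z; rewrite mulrDl.
apply: le_trans (le_normcD _ _) _.
exact: lerD.
Qed.

(** Members of the class act as multipliers on functions whose transform decays to order k <= N;
    every term of an integration by parts is estimated through this. *)
Lemma wien_mul n (A B : 'rV[R]_n -> R[i]) (N k C1 C2 : R) x : n%:R < N -> 0 <= k -> k <= N ->
  0 <= C1 -> 0 <= C2 -> cL1 A -> wien N C2 B ->
  (forall z, normc (fourier A z) <= C1 * jbr z `^ (- k)) ->
  normc (fourier (fun y => A y * B y) x) <=
    2 * (4 `^ k * 3 * Ijbr n N) * (C1 * C2) * jbr x `^ (- k).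
Proof. by move=> nN k0 kN C10 C20 Ai [b [bi BE bC]] hA; exact: (@fourier_mul_le R n A B b N k C1 C2 x nN k0 kN C10 C20 Ai bi BE hA bC). Qed.

Lemma fourier_shift n (f : 'rV[R]_n -> R[i]) (a x : 'rV[R]_n) : cL1 f ->
  fourier (fun y => f (y - a)) x = cexpi (- (2 * pi * dotp a x)) * fourier f x.
Proof.
move=> mf; rewrite /fourier.
have mE : cmfun (fun y : 'rV[R]_n => cexpi (- (2 * pi * dotp y x))) by exact: cmfun_fker.
rewrite -(@cint_shift R n a (fun y => f (y - a) * cexpi (- (2 * pi * dotp y x)))); last first.
  by apply: cmfunM => //; exact: (cmfun_comp mf.1 (measurable_rVD _)).
rewrite -cintZl; last first.
  by apply: (cL1_lec (cmfunM mf.1 mE) _ mf) => y; rewrite Normc.normcM normc_cexpi mulr1.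
by apply: eq_cint => y; rewrite addrK mulrCA -cexpiD dotpDl; congr (_ * cexpi _); ring.
Qed.

Lemma normc_fourier_shift n (f : 'rV[R]_n -> R[i]) (a x : 'rV[R]_n) : cL1 f ->
  normc (fourier (fun y => f (y - a)) x) = normc (fourier f x).
Proof. by move=> fi; rewrite fourier_shift// Normc.normcM normc_cexpi mul1r. Qed.

Lemma is_derive_jbr_powR n (x v : 'rV[R]_n) k :
  is_derive x v (fun y => jbr y `^ k) (k * dotp v x * jbr x `^ (k - 2)).
Proof.
suff : is_derive (x + (0 : R) *: v) v (fun y => jbr y `^ k) (k * dotp v x * jbr x `^ (k - 2)).
  by rewrite scale0r addr0.
apply: is_derive_of_line.
have jE (y : 'rV[R]_n) l : jbr y `^ l = (1 + dotp y y) `^ (2^-1 * l).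
  by rewrite /jbr -powR12_sqrt ?addr_ge0 ?dotp_ge0// powRrM.
pose q (s : R) := 1 + (dotp x x + 2 * s * dotp v x + s ^+ 2 * dotp v v).
have -> : (fun s : R => jbr (x + s *: v) `^ k) = (fun s => q s `^ (2^-1 * k)).
  apply/funext => s; rewrite jE /q; congr ((1 + _) `^ _).
  by rewrite dotpDl !dotpDr !dotpZl !dotpZr (dotpC x v); ring.
have dq : is_derive (0 : R) 1 q (2 * dotp v x).
  rewrite /q; apply: is_derive_eq; rewrite /GRing.scale/=; ring.
have q0E : q 0 = 1 + dotp x x by rewrite /q; ring.
have q0 : 0 < q 0 by rewrite q0E ltr_pwDl// dotp_ge0.
have := @is_derive1_comp R (fun s => s `^ (2^-1 * k)) q 0 _ _ (is_derive1_powR (2^-1 * k) q0) dq.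
rewrite q0E jE (_ : 2^-1 * (k - 2) = 2^-1 * k - 1); last by field.
by congr is_derive; move: (_ `^ _) (dotp v x) => a b; field.
Qed.

Lemma dotp_ebasis n (j : 'I_n) (x : 'rV[R]_n) : dotp (ebasis R j) x = x 0 j.
Proof.
rewrite /dotp (bigD1 j)//= big1 => [|i /negPf ij]; first by rewrite mxE !eqxx mul1r addr0.
by rewrite mxE ij andbF mul0r.
Qed.

(** Recovers a factor <x> from separate estimates for the |x_j|, one per partial derivative. *)
Lemma jbr_le_sum n (x : 'rV[R]_n) : jbr x <= 1 + \sum_j `|dotp (ebasis R j) x|.
Proof.
have s0 : 0 <= \sum_j `|dotp (ebasis R j) x| by apply: sumr_ge0.
rewrite -ler_sqr ?nnegrE ?jbr_ge0 ?addr_ge0// jbr_sqr.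
have : dotp x x <= (\sum_j `|dotp (ebasis R j) x|) ^+ 2.
  rewrite expr2 mulr_suml; apply: ler_sum => j _; rewrite dotp_ebasis.
  rewrite -expr2 -real_normK ?num_real// expr2; apply: ler_wpM2l => //.
  by rewrite (bigD1 j)//= dotp_ebasis lerDl sumr_ge0.
move: (dotp x x) (\sum_j _) s0 => a b; nra.
Qed.

Lemma continuous_rV_dotp n (f g : 'rV[R]_n -> 'rV[R]_n) : continuous f -> continuous g ->
  continuous (fun y => dotp (f y) (g y)).
Proof.
move=> cf cg x; rewrite /dotp; elim: (index_enum _) => [|i r IH].
  by under eq_fun do rewrite big_nil; exact: cst_continuous.
under eq_fun do rewrite big_cons; apply: continuousD IH; apply: continuousM.
  by apply: (@continuous_comp _ _ _ f (fun M : 'rV[R]_n => M 0 i)); [exact: cf|exact: coord_continuous].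
by apply: (@continuous_comp _ _ _ g (fun M : 'rV[R]_n => M 0 i)); [exact: cg|exact: coord_continuous].
Qed.

Lemma continuous_gauss n c (a : 'rV[R]_n) : continuous (fun y : 'rV[R]_n => gauss c (y - a)).
Proof.
have cB : continuous (fun y : 'rV[R]_n => y - a) by move=> y; apply: continuousB; [exact: cvg_id|exact: cst_continuous].
move=> x; apply: (@continuous_comp _ _ _ (fun y : 'rV[R]_n => - (c * pi * dotp (y - a) (y - a))) expR); last exact: continuous_expR.
by apply: continuousN; apply: continuousM; [exact: cst_continuous|exact: continuous_rV_dotp].
Qed.

Lemma continuous_jbr_powR n k : continuous (fun y : 'rV[R]_n => jbr y `^ k).
Proof.
move=> x; apply: (@continuous_comp _ _ _ (fun y : 'rV[R]_n => jbr y) (fun t => t `^ k)).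
  apply: (@continuous_comp _ _ _ (fun y : 'rV[R]_n => 1 + dotp y y) Num.sqrt); last exact: sqrt_continuous.
  by apply: continuousD; [exact: cst_continuous|apply: continuous_rV_dotp => y; exact: cvg_id].
apply: differentiable_continuous; apply/derivable1_diffP.
by apply: ex_derive; apply: is_derive1_powR; exact: jbr_gt0.
Qed.
End wiener.

(** * Gaussian windows as multipliers *)

Section wiener_gauss.
Variable R : realType.

Lemma wien_repr n (B : 'rV[R]_n -> R[i]) (C N : R) : n%:R < N -> 0 <= C -> cL1 B ->
  continuous (fun y => Re (B y)) -> continuous (fun y => Im (B y)) ->
  {ae leb R n, forall z, normc (fourier B z) <= C * jbr z `^ (- N)} -> wien N C B.
Proof.
move=> nN C0 Bi cR cI BC; have [fBi BE] := fourier_repr nN C0 Bi cR cI BC.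
by exists (fourier B).
Qed.

Lemma cL1_gauss0 n (c : R) (xi : 'rV[R]_n) : 0 < c -> cL1 (fun y => RtoC (gauss c (y - xi))).
Proof.
move=> c0; have := @cL1_gauss R n c xi (fun=> 1) c0 (@cmfun_cst _ _ _ 1).
under [X in _ -> cL1 X]eq_fun do rewrite -[RtoC _]mulr1.
by apply => x; rewrite Normc.normc1.
Qed.

Lemma normc_fourier_gauss n (c : R) (xi z : 'rV[R]_n) : 0 < c ->
  normc (fourier (fun y => RtoC (gauss c (y - xi))) z) = (Num.sqrt c)^-1 ^+ n * gauss c^-1 z.
Proof.
move=> c0; have i0 : cL1 (fun y : 'rV[R]_n => RtoC (gauss c y)).
  by have := cL1_gauss0 (0 : 'rV[R]_n) c0; under [X in cL1 X -> _]eq_fun do rewrite subr0.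
rewrite (normc_fourier_shift xi z i0) fourier_gauss// normc_RtoC ger0_norm//.
by rewrite mulr_ge0 ?gauss_ge0// exprn_ge0// invr_ge0 sqrtr_ge0.
Qed.

Lemma fourier_gauss_le n (N c : R) : 0 < c ->
  exists2 C, 0 < C & forall xi z : 'rV[R]_n,
    normc (fourier (fun y => RtoC (gauss c (y - xi))) z) <= C * jbr z `^ (- N).
Proof.
move=> c0; have ci0 : 0 < c^-1 by rewrite invr_gt0.
have [C C0 HC] := @gauss_le_jbr R n c^-1 N ci0.
have k0 : 0 < (Num.sqrt c)^-1 ^+ n by rewrite exprn_gt0// invr_gt0 sqrtr_gt0.
exists ((Num.sqrt c)^-1 ^+ n * C) => [|xi z]; first by rewrite mulr_gt0.
by rewrite normc_fourier_gauss// -mulrA (ler_pM2l k0).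
Qed.

Lemma wien_gauss n (N c : R) : n%:R < N -> 0 < c ->
  exists2 C, 0 < C & forall xi : 'rV[R]_n, wien N C (fun y => RtoC (gauss c (y - xi))).
Proof.
move=> nN c0; have [C C0 HC] := fourier_gauss_le n N c0; exists C => // xi.
apply: (wien_repr nN (ltW C0) (cL1_gauss0 xi c0)).
- exact: continuous_gauss.
- exact: cst_continuous.
- by apply: aeW.
Qed.

(** The transform of (v . y) [gauss 1] y comes from differentiating [gauss 1] in direction v: up to
    a unimodular factor it is (v . x) [gauss 1] x. The linear factor costs one power, whence [N + 1]
    in the choice of C. *)
Lemma wien_dgauss n (N : R) : n%:R < N ->
  exists2 C, 0 < C & forall (xi : 'rV[R]_n) j,
    wien N C (fun y => RtoC (dotp (ebasis R j) (y - xi) * gauss 1 (y - xi))).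
Proof.
move=> nN; have [C C0 HC] := @gauss_le_jbr R n 1 (N + 1) ltr01.
have [C1 C10 HC1] := @gauss_jbr_bound R n 1 1 (n%:R + 1) ltr01 ler01.
exists C => // xi j; set v := ebasis R j.
have vle (y : 'rV[R]_n) : `|dotp v y| <= jbr y by rewrite dotp_ebasis ler_coord_jbr.
have n1 : n%:R < n%:R + 1 :> R by rewrite ltrDl.
pose B (y : 'rV[R]_n) := RtoC (dotp v y * gauss 1 y).
have mB : cmfun B.
  apply: cmfun_RtoC; apply: measurable_funM; [exact: measurable_dotp|exact: measurable_gauss].
have Bb y : normc (B y) <= C1 * jbr y `^ (- (n%:R + 1)).
  apply: le_trans (HC1 y); rewrite normc_RtoC normrM (ger0_norm (gauss_ge0 _ _)) mulrC mul1r.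
  by rewrite ler_wpM2l ?gauss_ge0.
have iB : cL1 B by exact: (cL1_jbr n1 mB Bb).
have FB x : normc (fourier B x) <= C * jbr x `^ (- N).
  pose h (y : 'rV[R]_n) := RtoC (gauss 1 y).
  pose h' (y : 'rV[R]_n) := RtoC (- (2 * pi)) * B y.
  have E : fourier h' x = (0 +i* (2 * pi * dotp v x))%C * fourier h x.
    have [C2 C20 HC2] := @gauss_le_jbr R n 1 (n%:R + 1) ltr01.
    apply: (@fourier_derive _ _ _ _ _ (C2 + 2 * pi * C1) (n%:R + 1)) => //.
    - move=> y; split; last first.
        by rewrite /h' cImM /= mulr0 mul0r addr0; exact: is_derive_cst.
      have := is_derive_gauss 1 y v 0; rewrite subr0 /h' cReM /= mulr0 subr0.
      under [X in is_derive _ _ X _ -> _]eq_fun do rewrite subr0.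
      by rewrite mulrA !mulNr !mulr1.
    - by apply: cmfun_RtoC; exact: measurable_gauss.
    - by apply: cmfunM => //; exact: cmfun_cst.
    - move=> y; rewrite normc_RtoC ger0_norm ?gauss_ge0//; apply: le_trans (HC2 y) _.
      by rewrite ler_wpM2r ?powR_ge0// lerDl !mulr_ge0 ?pi_ge0// ltW.
    - move=> y; rewrite Normc.normcM normc_RtoC normrN ger0_norm ?mulr_ge0 ?pi_ge0//.
      apply: (@le_trans _ _ (2 * pi * (C1 * jbr y `^ (- (n%:R + 1))))).
        by rewrite ler_wpM2l ?mulr_ge0 ?pi_ge0.
      by rewrite mulrA ler_wpM2r ?powR_ge0// lerDr ltW.
  have E2 : fourier h' x = RtoC (- (2 * pi)) * fourier B x.
    rewrite /fourier -cintZl; first by apply: eq_cint => y; rewrite mulrA.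
    by apply: (cL1_lec (cmfunM mB (cmfun_fker _ _)) _ iB) => [|y] //; rewrite Normc.normcM normc_cexpi mulr1.
  have := congr1 (@Normc.normc R) E; rewrite E2 !Normc.normcM normc_RtoC normrN.
  have p2 : 0 < 2 * pi :> R by rewrite mulr_gt0 ?pi_gt0.
  rewrite ger0_norm ?(ltW p2)// (_ : normc (0 +i* _)%C = 2 * pi * `|dotp v x|); last first.
    by rewrite /= expr0n add0r sqrtr_sqr normrM ger0_norm// ltW.
  rewrite /h fourier_gauss// normc_RtoC sqrtr1 invr1 expr1n mul1r (ger0_norm (gauss_ge0 _ _)).
  rewrite -(mulrA _ `|_|) => /(mulfI (lt0r_neq0 p2)) ->.
  apply: (@le_trans _ _ (jbr x * (C * jbr x `^ (- (N + 1))))).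
    by apply: ler_pM; rewrite ?gauss_ge0.
  rewrite mulrCA ler_wpM2l ?(ltW C0)// -{1}[jbr x]powRr1 ?jbr_ge0// -powRD ?(gt_eqF (jbr_gt0 x)) ?implybT//.
  by rewrite (_ : 1 + - (N + 1) = - N)//; ring.
have cB : continuous (fun y : 'rV[R]_n => dotp v (y - xi) * gauss 1 (y - xi)).
  have c1 : continuous (fun y : 'rV[R]_n => dotp v (y - xi)).
    by apply: continuous_rV_dotp => w; [exact: cst_continuous|apply: continuousB; [exact: cvg_id|exact: cst_continuous]].
  move=> y; exact: (continuousM (c1 y) (@continuous_gauss R n 1 xi y)).
apply: (wien_repr nN (ltW C0) (cL1_shift (- xi) iB) cB); first exact: cst_continuous.
by apply: aeW => z; rewrite (normc_fourier_shift xi z iB).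
Qed.
End wiener_gauss.

(** * Decay of the windowed phase *)
Section bootstrap.
Variable R : realType.

(** Near xi the weight <y>^k is comparable to <xi>^k; Peetre's inequality loses <y - xi>^|k|, which
    the Gaussian absorbs. *)
Lemma jbr_gauss_le n (k c M : R) : 0 < c ->
  exists2 C, 0 < C & forall xi y : 'rV[R]_n,
    jbr y `^ k * gauss c (y - xi) <= C * jbr xi `^ k * jbr (y - xi) `^ (- M).
Proof.
move=> c0; have [C C0 HC] := @gauss_le_jbr R n c (M + `|k|) c0.
exists (2 `^ `|k| * C) => [|xi y]; first by rewrite mulr_gt0 ?powR_gt0.
have j0 : 0 < jbr (y - xi) by exact: jbr_gt0.
apply: (@le_trans _ _ (2 `^ `|k| * (jbr xi `^ k * jbr (y - xi) `^ `|k|) * (C * jbr (y - xi) `^ (- (M + `|k|))))).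
  apply: ler_pM; rewrite ?powR_ge0 ?gauss_ge0//.
  by have := jbr_powRD k xi (y - xi); rewrite addrC subrK.
rewrite (_ : - M = `|k| + - (M + `|k|)); last by ring.
rewrite [X in _ <= _ * X]powRD ?(gt_eqF j0) ?implybT// le_eqVlt; apply/orP; left; apply/eqP.
by move: (jbr xi `^ k) (jbr (y - xi) `^ `|k|) (jbr (y - xi) `^ (- _)) (2 `^ `|k|) => a b d e; ring.
Qed.

Lemma gauss_mul n (c d : R) (w : 'rV[R]_n) : gauss c w * gauss d w = gauss (c + d) w.
Proof. by rewrite /gauss -expRD; congr expR; ring. Qed.

(* Membership in W^{oo,oo} is an essential supremum, so the windowed transform of
   <.>^{-s} D_j mu is controlled only for almost every center; this moves the window
   from [xi] to a good center [x0] close to it. *)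
Lemma gauss_recenter n (c : R) (y xi x0 : 'rV[R]_n) : c != 1 ->
  gauss c (y - xi) = expR (c / (c - 1) * pi * dotp (x0 - xi) (x0 - xi)) *
    (gauss (c - 1) (y - (xi + - (c - 1)^-1 *: (x0 - xi))) * gauss 1 (y - x0)).
Proof.
move=> c1; have c10 : c - 1 != 0 by rewrite subr_eq0.
rewrite /gauss -!expRD; congr expR.
set w := y - xi; set d := x0 - xi.
have -> : y - x0 = w + - 1 *: d by rewrite scaleN1r /w /d opprB addrA subrK.
have -> : y - (xi + - (c - 1)^-1 *: d) = w + (c - 1)^-1 *: d.
  by rewrite opprD addrA scaleNr opprK.
clearbody w d; rewrite !dotpDl !dotpDr !dotpZl !dotpZr (dotpC d w).
move: (dotp w w) (dotp w d) (dotp d d) => a b e; move: (@pi R) => p; by field.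
Qed.

Lemma cL1_mul_wien n (N C : R) (A B : 'rV[R]_n -> R[i]) : n%:R < N -> 0 <= C ->
  cL1 A -> wien N C B -> cL1 (fun y => A y * B y).
Proof.
move=> nN C0 Ai Bw; apply: (cL1_lec (cmfunM Ai.1 (wien_cmfun Bw)) _ (cL1Zl (RtoC (2 * (C * Ijbr n N))) Ai)).
move=> y; rewrite !Normc.normcM normc_RtoC mulrC ler_wpM2r ?normc_ge0//.
exact: le_trans (wien_bound y nN C0 Bw) (ler_norm _).
Qed.

Lemma fourierD n (f g : 'rV[R]_n -> R[i]) x : cL1 f -> cL1 g ->
  fourier (fun y => f y + g y) x = fourier f x + fourier g x.
Proof.
move=> fi gi; have H h : cL1 h -> cL1 (fun y : 'rV[R]_n => h y * cexpi (- (2 * pi * dotp y x))).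
  by move=> hi; apply: (cL1_lec (cmfunM hi.1 (cmfun_fker _ _)) _ hi) => [|y] //; rewrite Normc.normcM normc_cexpi mulr1.
rewrite /fourier -cintD; [|exact: H|exact: H].
by apply: eq_cint => y; rewrite -mulrDl.
Qed.

(** Integration by parts in abstract form: the transform of the derivative is 2 pi i (v . x) times
    that of A, and [wien_mul] bounds the transform of each product. The three products come from
    differentiating the weight, the Gaussian and the phase. [rapid] justifies differentiation under
    the integral; its constants do not enter the bound. *)
Lemma fourier_cder_wien n (v x : 'rV[R]_n) (N k : R) (A A1 A2 A3 B1 B2 B3 : 'rV[R]_n -> R[i])
    (C1 C2 C3 w1 w2 w3 : R) : n%:R < N -> 0 <= k -> k <= N ->
  let rapid h := cmfun h /\ exists2 E : R, 0 <= E & forall y : 'rV[R]_n, normc (h y) <= E * jbr y `^ (- (n%:R + 1)) in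
  let fdec h (C : R) := 0 <= C /\ forall z, normc (fourier h z) <= C * jbr z `^ (- k) in
  let wn w B := 0 <= w /\ wien N w B in
  rapid A -> rapid A1 -> rapid A2 -> rapid A3 ->
  fdec A1 C1 -> fdec A2 C2 -> fdec A3 C3 -> wn w1 B1 -> wn w2 B2 -> wn w3 B3 ->
  cder v A (fun y => A1 y * B1 y + A2 y * B2 y + A3 y * B3 y) ->
  `|dotp v x| * normc (fourier A x) <=
    2 * (4 `^ k * 3 * Ijbr n N) * (C1 * w1 + C2 * w2 + C3 * w3) * jbr x `^ (- k).
Proof.
move=> nN k0 kN rapid fdec wn [mA [E0 E00 HE0]] rA1 rA2 rA3 [C10 H1] [C20 H2] [C30 H3] [w10 W1] [w20 W2] [w30 W3] dA.
have n1 : n%:R < n%:R + 1 :> R by rewrite ltrDl.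
have core (h1 h2 h3 : 'rV[R]_n -> R[i]) (K w1' w2' w3' : R) : cder v A (fun y => h1 y + h2 y + h3 y) ->
    cmfun h1 -> cmfun h2 -> cmfun h3 -> cL1 h1 -> cL1 h2 -> cL1 h3 ->
    (exists2 E : R, 0 <= E & forall y, normc (h1 y + h2 y + h3 y) <= E * jbr y `^ (- (n%:R + 1))) ->
    normc (fourier h1 x) <= K * w1' * jbr x `^ (- k) ->
    normc (fourier h2 x) <= K * w2' * jbr x `^ (- k) ->
    normc (fourier h3 x) <= K * w3' * jbr x `^ (- k) ->
    `|dotp v x| * normc (fourier A x) <= K * (w1' + w2' + w3') * jbr x `^ (- k).
  move=> dh m1 m2 m3 i1 i2 i3 [E E0' HE] F1 F2 F3.
  have FD : fourier (fun y => h1 y + h2 y + h3 y) x = (0 +i* (2 * pi * dotp v x))%C * fourier A x.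
    apply: (@fourier_derive R n v A _ (E0 + E) (n%:R + 1) x n1 dh mA).
    - by apply: cmfunD m3; exact: cmfunD.
    - by move=> y; apply: le_trans (HE0 y) _; rewrite ler_wpM2r ?powR_ge0// lerDl.
    - by move=> y; apply: le_trans (HE y) _; rewrite ler_wpM2r ?powR_ge0// lerDr.
  have le0 : `|dotp v x| * normc (fourier A x) <= normc (fourier (fun y => h1 y + h2 y + h3 y) x).
    rewrite FD Normc.normcM ler_wpM2r ?normc_ge0//= expr0n add0r sqrtr_sqr normrM ler_peMl//.
    rewrite ger0_norm ?mulr_ge0 ?pi_ge0//; have := @pi_ge2 R; clear; lra.
  apply: le_trans le0 _; rewrite fourierD; [|exact: cL1D|exact: i3].
  rewrite (fourierD x i1 i2); apply: le_trans (le_normcD _ _) _.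
  apply: le_trans (lerD (le_trans (le_normcD _ _) (lerD F1 F2)) F3) _.
  by rewrite -!mulrDl -!mulrDr.
have hb h w B : rapid h -> wn w B -> cL1 h /\ rapid (fun y => h y * B y).
  move=> [mh [C C0 HC]] [w0 Bw]; split; first exact: (cL1_jbr n1 mh HC).
  split; first by apply: cmfunM => //; exact: wien_cmfun Bw.
  exists (C * (2 * (w * Ijbr n N))) => [|y]; first by rewrite !mulr_ge0 ?Ijbr_ge0.
  rewrite Normc.normcM mulrAC; apply: ler_pM; rewrite ?normc_ge0 ?HC//.
  exact: wien_bound.
have [i1 [m1 [E1 E10 HE1]]] := hb _ _ _ rA1 (conj w10 W1).
have [i2 [m2 [E2 E20 HE2]]] := hb _ _ _ rA2 (conj w20 W2).
have [i3 [m3 [E3 E30 HE3]]] := hb _ _ _ rA3 (conj w30 W3).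
have F1 := wien_mul x nN k0 kN C10 w10 i1 W1 H1.
have F2 := wien_mul x nN k0 kN C20 w20 i2 W2 H2.
have F3 := wien_mul x nN k0 kN C30 w30 i3 W3 H3.
have {}i1 := cL1_jbr n1 m1 HE1.
have {}i2 := cL1_jbr n1 m2 HE2.
have {}i3 := cL1_jbr n1 m3 HE3.
apply: (core _ _ _ _ _ _ _ dA m1 m2 m3 i1 i2 i3 _ F1 F2 F3).
exists (E1 + E2 + E3) => [|y]; first by rewrite !addr_ge0.
rewrite !mulrDl; apply: le_trans (le_normcD _ _) _; apply: lerD (HE3 y).
by apply: le_trans (le_normcD _ _) _; exact: lerD (HE1 y) (HE2 y).
Qed.

Variables (n : nat) (mu : 'rV[R]_n -> R) (s N Cg : R).
Hypotheses (nN : n%:R < N) (s0 : 0 < s) (Cg0 : 0 <= Cg).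
Hypothesis muC : C1 mu.
(** The hypothesis on D_j mu in usable form: a good window center in every unit ball, with one
    constant for all centers and all j. It is provided by [inW_wien]. *)
Hypothesis Hg : forall (j : 'I_n) (xi : 'rV[R]_n), exists2 x0 : 'rV[R]_n,
  dotp (x0 - xi) (x0 - xi) <= 1 &
  wien N Cg (fun y => RtoC (jbr y `^ (- s) * 'D_(ebasis R j) mu y) * RtoC (gauss 1 (y - x0))).

(** Carrying a weight keeps the family stable under differentiation: the growth <.>^s of D_j mu is
    absorbed by raising k to k + s. *)
Definition agauss (k c : R) (xi y : 'rV[R]_n) : R[i] :=
  RtoC (jbr y `^ k * gauss c (y - xi)) * cexpi (mu y).

Lemma mu_continuous : continuous mu.
Proof. by move=> x; apply: differentiable_continuous; exact: muC.1. Qed.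

Lemma cmfun_agauss k c xi : cmfun (agauss k c xi).
Proof.
apply: cmfunM; last by apply: cmfun_cexpi; exact: (continuous_measurable_rV mu_continuous).
apply: cmfun_RtoC; apply: measurable_funM; first exact: measurable_jbr_powR.
by apply: measurable_gauss; exact: measurable_rVD.
Qed.

Lemma normc_agauss k c xi y : normc (agauss k c xi y) = jbr y `^ k * gauss c (y - xi).
Proof.
rewrite /agauss Normc.normcM normc_cexpi mulr1 normc_RtoC ger0_norm//.
by rewrite mulr_ge0 ?powR_ge0 ?gauss_ge0.
Qed.

(** Qualitative: the constant depends on xi and serves to justify integrability. *)
Lemma agauss_bound k c xi M : 0 < c -> 0 <= M ->
  exists2 C, 0 <= C & forall y, normc (agauss k c xi y) <= C * jbr y `^ (- M).
Proof.
move=> c0 M0; have [C C0 HC] := @jbr_gauss_le n k c M c0.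
exists (C * jbr xi `^ k * (2 `^ M * jbr xi `^ M)) => [|y].
  by rewrite !mulr_ge0 ?powR_ge0// ltW.
rewrite normc_agauss; apply: le_trans (HC _ _) _.
rewrite -[leRHS]mulrA ler_wpM2l ?mulr_ge0 ?powR_ge0 ?(ltW C0)//.
apply: le_trans (jbr_powRD _ _ _) _; rewrite jbrN normrN ger0_norm//.
by rewrite -mulrA (mulrC (jbr xi `^ M)).
Qed.

(* Each derivative spends one unit of the Gaussian exponent [c] on the window of
   <.>^{-s} D_j mu, whence [k + 1 <= c]. *)
Definition fbound (k : R) := forall sg c : R, k + 1 <= c ->
  exists2 C, 0 <= C & forall xi x, normc (fourier (agauss sg c xi) x) <=
    C * jbr xi `^ (sg + s * k) * jbr x `^ (- k).

(** The transform is bounded by the L1 norm, and the Gaussian turns the weight into <xi>^sg. *)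
Lemma fbound0 : fbound 0.
Proof.
move=> sg c; rewrite add0r => c1; have c0 : 0 < c by exact: lt_le_trans c1.
have [C C0 HC] := @jbr_gauss_le n sg c N c0.
exists (2 * (C * Ijbr n N)) => [|xi x]; first by rewrite !mulr_ge0 ?Ijbr_ge0// ltW.
rewrite mulr0 addr0 oppr0 powRr0 mulr1 -lee_fin.
apply: le_trans (fourier_le _ (cmfun_agauss _ _ _)) _.
have j0 (y : 'rV[R]_n) : (0 <= (jbr y `^ (- N))%:E)%E by rewrite lee_fin powR_ge0.
have mj : measurable_fun setT (fun y : 'rV[R]_n => (jbr (y - xi) `^ (- N))%:E).
  by apply/measurable_EFinP; apply: measurable_jbr_powR; exact: measurable_rVD.
have mj' : measurable_fun setT (fun y : 'rV[R]_n => (jbr y `^ (- N))%:E).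
  by apply/measurable_EFinP; exact: measurable_jbr_powR.
have k0 : 0 <= C * jbr xi `^ sg by rewrite mulr_ge0 ?powR_ge0 ?(ltW C0).
rewrite [leRHS](_ : _ = 2%:E * (C * jbr xi `^ sg * Ijbr n N)%:E)%E; last first.
  by rewrite -EFinM; congr EFin; move: (jbr xi `^ sg) (Ijbr n N) => a b; ring.
apply: lee_wpmul2l => //.
apply: (@le_trans _ _ (\int[leb R n]_y ((C * jbr xi `^ sg)%:E * (jbr (y - xi) `^ (- N))%:E))%E).
  apply: ge0_le_integral_nm => y; first by rewrite lee_fin normc_ge0.
  by rewrite -EFinM lee_fin normc_agauss.
rewrite (ge0_integralZl_EFin _ measurableT (fun y _ => j0 _) mj k0).
by rewrite (@integral_rVD R n (- xi) (fun y => (jbr y `^ (- N))%:E) mj' j0) IjbrE.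
Qed.

(** Every term keeps a window of exponent c - 1 and gives up [gauss 1] to its second factor. For the
    weight and the Gaussian both windows are centered at xi. For the phase the unit window must sit
    at the good center x0, and the remaining one moves to xi' at the price of the factor [kap]. *)
Lemma cder_agauss (sg c kap : R) (j : 'I_n) (xi xi' x0 : 'rV[R]_n) :
  (forall y, gauss c (y - xi) = kap * (gauss (c - 1) (y - xi') * gauss 1 (y - x0))) ->
  cder (ebasis R j) (agauss sg c xi) (fun y =>
    agauss (sg - 2) (c - 1) xi y * (RtoC sg *
       (RtoC (dotp (ebasis R j) (y - xi) * gauss 1 (y - xi)) + RtoC (dotp (ebasis R j) xi) * RtoC (gauss 1 (y - xi)))) +
    agauss sg (c - 1) xi y * (RtoC (- (2 * c * pi)) * RtoC (dotp (ebasis R j) (y - xi) * gauss 1 (y - xi))) +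
    agauss (sg + s) (c - 1) xi' y * ((0 +i* kap)%C *
       (RtoC (jbr y `^ (- s) * 'D_(ebasis R j) mu y) * RtoC (gauss 1 (y - x0))))).
Proof.
move=> E y; set v := ebasis R j.
have dj := is_derive_jbr_powR y v sg.
have dg := is_derive_gauss c y v xi.
have dm : is_derive y v mu ('D_v mu y) by apply: is_derive_differentiable; exact: muC.1.
(* Chain rule through mu, carried out along the line in direction v. *)
have dl (f : R -> R) (f' : R) : is_derive (mu y) 1 f f' -> is_derive y v (fun z => f (mu z)) (f' * 'D_v mu y).
  move=> df; suff : is_derive (y + (0 : R) *: v) v (fun z => f (mu z)) (f' * 'D_v mu y) by rewrite scale0r addr0.
  apply: is_derive_of_line.
  have dm0 : is_derive (0 : R) 1 (fun t : R => mu (y + t *: v)) ('D_v mu y).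
    by apply: is_derive_line; rewrite scale0r addr0.
  have df0 : is_derive (mu (y + (0 : R) *: v)) 1 f f' by rewrite scale0r addr0.
  by have := @is_derive1_comp R f _ 0 _ _ df0 dm0; rewrite mulrC.
have dc := dl _ _ (is_derive_cos (mu y)).
have ds := dl _ _ (is_derive_sin (mu y)).
have jE : jbr y `^ sg = jbr y `^ (sg + s) * jbr y `^ (- s).
  by rewrite -powRD ?(gt_eqF (jbr_gt0 y)) ?implybT// addrK.
have dE : dotp v y = dotp v (y - xi) + dotp v xi by rewrite -dotpDr subrK.
have g1E : gauss c (y - xi) = gauss (c - 1) (y - xi) * gauss 1 (y - xi) by rewrite gauss_mul subrK.
have g2E := E y.
have ReE z : Re (agauss sg c xi z) = jbr z `^ sg * gauss c (z - xi) * cos (mu z).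
  by rewrite /agauss cReM /= mul0r subr0.
have ImE z : Im (agauss sg c xi z) = jbr z `^ sg * gauss c (z - xi) * sin (mu z).
  by rewrite /agauss cImM /= mul0r addr0.
rewrite (funext ReE) (funext ImE) /agauss !(cReD, cImD, cReM, cImM) /=.
move: jE dE g1E g2E dj dg dc ds.
move: (jbr y `^ (sg - 2)) (jbr y `^ (sg + s)) (jbr y `^ (- s)) (dotp v y) (dotp v (y - xi)) (dotp v xi) => j2 js jms vy vyx vx.
move: (gauss (c - 1) (y - xi)) (gauss 1 (y - xi)) (gauss (c - 1) (y - xi')) (gauss 1 (y - x0)) => g1 g2 g3 g4.
move: ('D_v mu y) (@pi R) => D p jE dE g1E g2E dj dg dc ds; split.
  apply: is_derive_eq; rewrite /GRing.scale/=.
  transitivity (cos (mu y) * gauss c (y - xi) * (sg * vy * j2) - cos (mu y) * jbr y `^ sg * (2 * c * p * vyx * gauss c (y - xi))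
     - sin (mu y) * D * (jbr y `^ sg * gauss c (y - xi))); first by ring.
  rewrite {3}g2E {1 2}g1E dE {2}jE; clear; ring.
apply: is_derive_eq; rewrite /GRing.scale/=.
transitivity (sin (mu y) * gauss c (y - xi) * (sg * vy * j2) - sin (mu y) * jbr y `^ sg * (2 * c * p * vyx * gauss c (y - xi))
     + cos (mu y) * D * (jbr y `^ sg * gauss c (y - xi))); first by ring.
rewrite {3}g2E {1 2}g1E dE {2}jE; clear; ring.
Qed.

(** Recentering moves xi by |d| / (c - 1) <= 1, so weights at the new center are comparable to those
    at xi. *)
Lemma jbr_recenter_le (c t : R) (xi d : 'rV[R]_n) : 2 <= c -> dotp d d <= 1 ->
  jbr (xi + - (c - 1)^-1 *: d) `^ t <= 2 `^ `|t| * 2 `^ `|t| * jbr xi `^ t.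
Proof.
move=> c2 d1; apply: le_trans (jbr_powRD _ _ _) _.
rewrite -mulrA ler_wpM2l ?powR_ge0// mulrC ler_wpM2r ?powR_ge0//.
apply: ge0_ler_powR => //; rewrite ?nnegrE ?jbr_ge0//.
rewrite -ler_sqr ?nnegrE ?jbr_ge0// jbr_sqr dotpZl dotpZr mulrA mulrNN.
have c1 : 0 <= (c - 1)^-1 <= 1.
  rewrite invr_ge0 (_ : 0 <= c - 1) /=; last by lra.
  rewrite invf_le1; lra.
have := dotp_ge0 d; move: c1 d1; move: (c - 1)^-1 (dotp d d) => a b; nra.
Qed.

(** Powers of <xi>: differentiating the weight gives sg - 2 and (v . xi) returns one, the Gaussian
    term keeps sg, and the phase term gives sg + s. Each is at most sg + s, which together with the
    s k of the given bound makes sg + s (k + 1). *)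
Lemma fbound_deriv (k : R) : 0 <= k -> k <= N -> fbound k -> forall sg c : R, k + 2 <= c ->
  exists2 D, 0 <= D & forall (j : 'I_n) xi x,
    `|dotp (ebasis R j) x| * normc (fourier (agauss sg c xi) x) <=
    D * jbr xi `^ (sg + s * (k + 1)) * jbr x `^ (- k).
Proof.
move=> k0 kN fk sg c kc.
have c2 : 2 <= c by apply: le_trans kc; rewrite lerDr.
have c1 : k + 1 <= c - 1 by lra.
have c1p : 0 < c - 1 by lra.
have cn1 : c != 1 by apply/eqP; lra.
have cp : 0 < c by lra.
have [D1 D10 H1] := fk (sg - 2) (c - 1) c1.
have [D2 D20 H2] := fk sg (c - 1) c1.
have [D3 D30 H3] := fk (sg + s) (c - 1) c1.
have [Cw Cw0 HCw] := wien_gauss nN ltr01.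
have [Cd Cd0 HCd] := wien_dgauss nN.
pose K := 2 * (4 `^ k * 3 * Ijbr n N).
have K0 : 0 <= K by rewrite !mulr_ge0 ?powR_ge0 ?Ijbr_ge0.
pose t := sg + s + s * k.
have pi0 : 0 <= @pi R by exact: pi_ge0.
pose D := K * (D1 * (`|sg| * (Cd + Cw)) + D2 * (2 * c * pi * Cd) + D3 * (2 `^ `|t| * 2 `^ `|t|) * (expR (2 * pi) * Cg)).
have w1p : 0 <= `|sg| * (Cd + Cw) by rewrite mulr_ge0// addr_ge0 ?(ltW Cd0) ?(ltW Cw0).
have w2p : 0 <= 2 * c * pi * Cd by rewrite !mulr_ge0 ?(ltW Cd0) ?(ltW cp).
have w3p : 0 <= expR (2 * pi) * Cg by rewrite mulr_ge0 ?expR_ge0.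
exists D => [|j xi x].
  by apply: mulr_ge0 => //; rewrite !addr_ge0//; apply: mulr_ge0 => //; rewrite !mulr_ge0 ?powR_ge0.
set v := ebasis R j.
have [x0 x01 W3] := Hg j xi.
set d := x0 - xi in x01.
pose xi' := xi + - (c - 1)^-1 *: d.
pose kap := expR (c / (c - 1) * pi * dotp d d).
have kap0 : 0 <= kap by exact: expR_ge0.
have kapE y : gauss c (y - xi) = kap * (gauss (c - 1) (y - xi') * gauss 1 (y - x0)).
  exact: gauss_recenter.
(* Since c / (c - 1) <= 2 and |d| <= 1, the constant is uniform in the good center. *)
have kap2 : kap <= expR (2 * pi).
  rewrite /kap ler_expR (mulrAC _ pi) ler_wpM2r//.
  have cc : 0 <= c / (c - 1) <= 2 by rewrite divr_ge0 ?(ltW c1p) ?(ltW cp)//= ler_pdivrMr//; lra.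
  have := dotp_ge0 d; move: cc x01; move: (c / (c - 1)) (dotp d d) => a b; nra.
have jt : jbr xi' `^ t <= 2 `^ `|t| * 2 `^ `|t| * jbr xi `^ t by exact: jbr_recenter_le.
have W1 := wienZ (RtoC sg) (wienD (HCd xi j) (wienZ (RtoC (dotp v xi)) (HCw xi))).
have W2 := wienZ (RtoC (- (2 * c * pi))) (HCd xi j).
have {}W3 := wienZ (0 +i* kap)%C W3.
have nk : normc (0 +i* kap)%C = kap by rewrite /= expr0n add0r sqrtr_sqr ger0_norm.
rewrite nk in W3; rewrite !normc_RtoC in W1; rewrite normc_RtoC in W2.
have dh := cder_agauss sg j kapE.
have M0 : 0 <= n%:R + 1 :> R by rewrite addr_ge0.
have p0 (a b : R) (y : 'rV[R]_n) : 0 <= a -> 0 <= a * jbr y `^ b by move=> a0; rewrite mulr_ge0 ?powR_ge0.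
have w10 : 0 <= `|sg| * (Cd + `|dotp v xi| * Cw) by rewrite mulr_ge0// addr_ge0 ?mulr_ge0 ?(ltW Cd0) ?(ltW Cw0).
have w20 : 0 <= `|- (2 * c * pi)| * Cd by rewrite mulr_ge0 ?(ltW Cd0).
have w30 : 0 <= kap * Cg by rewrite mulr_ge0.
have le0 := fourier_cder_wien x nN k0 kN
  (conj (cmfun_agauss _ _ _) (agauss_bound sg xi cp M0))
  (conj (cmfun_agauss _ _ _) (agauss_bound (sg - 2) xi c1p M0))
  (conj (cmfun_agauss _ _ _) (agauss_bound sg xi c1p M0))
  (conj (cmfun_agauss _ _ _) (agauss_bound (sg + s) xi' c1p M0))
  (conj (p0 _ _ _ D10) (H1 xi)) (conj (p0 _ _ _ D20) (H2 xi)) (conj (p0 _ _ _ D30) (H3 xi'))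
  (conj w10 W1) (conj w20 W2) (conj w30 W3) dh.
apply: le_trans le0 _; rewrite ler_wpM2r ?powR_ge0// -/K /D -[leRHS]mulrA ler_wpM2l//.
clear dh W1 W2 W3 H1 H2 H3 HCw HCd fk kapE.
have tE : sg + s * (k + 1) = t by rewrite /t; ring.
have j1 := jbr_ge1 xi.
have jmono a b : a <= b -> jbr xi `^ a <= jbr xi `^ b by move=> ab; apply: ler_powR.
have le1 : jbr xi `^ (sg - 2 + s * k) * (`|sg| * (Cd + `|dotp v xi| * Cw)) <= `|sg| * (Cd + Cw) * jbr xi `^ t.
  apply: (@le_trans _ _ (jbr xi `^ (sg - 2 + s * k) * (`|sg| * ((Cd + Cw) * jbr xi)))).
    rewrite ler_wpM2l ?powR_ge0// ler_wpM2l// mulrDl lerD ?ler_peMr ?(ltW Cd0)//.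
    by rewrite mulrC ler_wpM2l ?(ltW Cw0)// /v dotp_ebasis ler_coord_jbr.
  rewrite (_ : jbr xi `^ (sg - 2 + s * k) * (`|sg| * ((Cd + Cw) * jbr xi)) = `|sg| * (Cd + Cw) * (jbr xi `^ (sg - 2 + s * k) * jbr xi)); last first.
    by move: (jbr xi `^ _) (`|sg|) => a b; ring.
  rewrite ler_wpM2l// -{2}[jbr xi]powRr1 ?jbr_ge0// -powRD ?(gt_eqF (jbr_gt0 xi)) ?implybT//.
  by apply: jmono; rewrite -subr_ge0 /t (_ : _ - _ = s + 1); [rewrite addr_ge0 ?(ltW s0)|clear; ring].
have le2 : jbr xi `^ (sg + s * k) * (`|- (2 * c * pi)| * Cd) <= 2 * c * pi * Cd * jbr xi `^ t.
  rewrite mulrC normrN ger0_norm; last by rewrite !mulr_ge0 ?(ltW cp).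
  by rewrite ler_wpM2l//; apply: jmono; rewrite -subr_ge0 /t (_ : _ - _ = s); [exact: ltW|clear; ring].
have le3 : jbr xi' `^ (sg + s + s * k) * (kap * Cg) <= 2 `^ `|t| * 2 `^ `|t| * (expR (2 * pi) * Cg) * jbr xi `^ t.
  rewrite -/t mulrAC; apply: ler_pM; rewrite ?powR_ge0//.
  by rewrite ler_wpM2r.
rewrite tE [leRHS]mulrDl (mulrDl (D1 * _) _ (jbr xi `^ t)).
have fin (a b g e f : R) : 0 <= a -> b * g <= e * f -> a * b * g <= a * e * f.
  by move=> a0 bg; rewrite -!mulrA ler_wpM2l.
apply: lerD; [apply: lerD|]; [exact: fin|exact: fin|].
by rewrite -(mulrA D3 _ (expR _ * _)); exact: fin.
Qed.

(** The multipliers preserve orders up to N and the factors x_j bring one more, so integer orders up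
    to N + 1 are reached; hence there is an admissible integer above every a <= N. *)
Lemma fbound_nat (k : nat) : k%:R <= N + 1 -> fbound k%:R.
Proof.
elim: k => [_|k IH kN]; first exact: fbound0.
have kN' : k%:R <= N by move: kN; rewrite -natr1 lerD2r.
have fk : fbound k%:R by apply: IH; apply: le_trans kN' _; rewrite lerDl.
move=> sg c kc.
have kc2 : k%:R + 2 <= c by move: kc; rewrite -natr1; lra.
have kc1 : k%:R + 1 <= c by move: kc2; lra.
have [D D0 HD] := fbound_deriv (ler0n _ _) kN' fk sg kc2.
have [C C0 HC] := fk sg c kc1.
exists (C + n%:R * D) => [|xi x]; first by rewrite addr_ge0 ?mulr_ge0.
have jx := jbr_gt0 x.
have E : jbr x `^ (- k.+1%:R) = jbr x `^ (- k%:R) / jbr x.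
  by rewrite -natr1 opprD powRD ?(gt_eqF jx) ?implybT// powR_inv1// ltW.
rewrite E mulrA ler_pdivlMr// mulrC.
set F := normc _; have F0 : 0 <= F by exact: normc_ge0.
apply: (@le_trans _ _ ((1 + \sum_j `|dotp (ebasis R j) x|) * F)).
  by rewrite ler_wpM2r// jbr_le_sum.
rewrite mulrDl mul1r mulr_suml -natr1.
apply: (@le_trans _ _ (C * jbr xi `^ (sg + s * (k%:R + 1)) * jbr x `^ (- k%:R) +
   \sum_(j < n) (D * jbr xi `^ (sg + s * (k%:R + 1)) * jbr x `^ (- k%:R)))).
  apply: lerD; last by apply: ler_sum => j _; exact: HD.
  apply: le_trans (HC xi x) _; rewrite ler_wpM2r ?powR_ge0// ler_wpM2l//.
  by apply: ler_powR; rewrite ?jbr_ge1// lerD2l ler_wpM2l ?(ltW s0)// lerDl.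
by rewrite sumr_const card_ord -[X in _ + X]mulr_natl !(mulrA n%:R) -!mulrDl.
Qed.

(** With T = <xi>^s / <x>, the bounds of order 0 and k are C0 and C1 T^k; for 0 <= a <= k the
    smaller of 1 and T^k is at most T^a. *)
Lemma fourier_gauss_decay (a : R) : 0 <= a -> a <= N ->
  exists2 c, 2 <= c & exists2 C, 0 < C & forall xi x : 'rV[R]_n,
    normc (fourier (fun y => RtoC (gauss c (y - xi)) * cexpi (mu y)) x) <=
    C * jbr xi `^ (s * a) * jbr x `^ (- a).
Proof.
move=> a0 aN; pose k := (Num.truncn a).+1.
have /andP[ka ak] := truncn_itv a0.
have kN : k%:R <= N + 1 by rewrite /k -natr1 lerD2r (le_trans ka).
have k1 : 1 <= k%:R :> R by rewrite ler1n.
exists (k%:R + 1); first by move: k1; lra.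
have [C0 C00 H0] := @fbound0 0 (k%:R + 1) (lerD (ler0n _ _) (lexx _)).
have [C1 C10 H1] := fbound_nat kN 0 (lexx (k%:R + 1)).
exists (C0 + C1 + 1) => [|xi x]; first by rewrite ltr_wpDl// addr_ge0.
rewrite (_ : (fun y => _) = agauss 0 (k%:R + 1) xi); last first.
  by apply/funext => y; rewrite /agauss powRr0 mul1r.
have jxi := jbr_gt0 xi; have jx := jbr_gt0 x.
pose T := jbr xi `^ s / jbr x.
have T0 : 0 < T by rewrite divr_gt0 ?powR_gt0.
have TE (b : R) : jbr xi `^ (s * b) * jbr x `^ (- b) = T `^ b.
  by rewrite powRM ?powR_ge0 ?invr_ge0 ?ltW// -powRrM -powR_inv1 ?(ltW jx)// -powRrM mulN1r.
rewrite -mulrA TE.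
have {}H0 := H0 xi x; have {}H1 := H1 xi x.
rewrite mulr0 addr0 oppr0 !powRr0 !mulr1 in H0.
rewrite add0r -mulrA TE in H1.
have [T1|T1] := leP 1 T.
  apply: le_trans H0 _; rewrite -[leLHS]mulr1; apply: ler_pM => //.
    by rewrite -addrA lerDl addr_ge0.
  rewrite [leLHS](_ : 1 = 1 `^ a); last by rewrite powR1.
  by apply: ge0_ler_powR; rewrite ?nnegrE ?(ltW T0).
apply: le_trans H1 _; apply: ler_pM; rewrite ?powR_ge0//.
  by rewrite (addrC C0) -addrA lerDl addr_ge0.
have lnT : ln T <= 0 by rewrite ln_le0// ltW.
rewrite /powR gt_eqF// ler_expR; have := ltW ak; rewrite -/k; move: lnT; move: (ln T) k%:R => l b; nra.
Qed.
End bootstrap.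

(** * From essential suprema to good window centers *)

Section window_centers.
Variable R : realType.

Lemma stftE n (f : 'rV[R]_n -> R[i]) x xi :
  stft f x xi = fourier (fun y => f y * RtoC (gauss 1 (y - x))) xi.
Proof. by apply: eq_cint => y; rewrite gwinE. Qed.

Lemma nulln_le n (A B : set 'rV[R]_n) : A `<=` B -> nulln B -> nulln A.
Proof.
move=> AB B0; apply/eqP; rewrite eq_le; apply/andP; split; last first.
  by apply: iint_ge0 => x; rewrite lee_fin.
rewrite -B0; apply: le_iint => x; rewrite lee_fin//.
rewrite !indicE; case: (boolP (x \in A)) => // /set_mem/AB/mem_set -> //.
Qed.

Lemma nulln_leb n (A : set 'rV[R]_n) : measurable A -> nulln A -> leb R n A = 0%E.
Proof.
move=> mA; rewrite /nulln iintE//; first by rewrite integral_indic// setIT.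
by apply/measurable_EFinP; exact: measurable_indic.
Qed.

Lemma esssupn_lt n (g : 'rV[R]_n -> \bar R) (T : R) : (esssupn g < T%:E)%E ->
  nulln [set x | (T%:E < g x)%E].
Proof.
move=> /ereal_inf_lt[t /= t0 tT]; apply: nulln_le t0 => x /=.
exact: lt_trans.
Qed.

(** If the ball were null, only the part of [gauss c] outside it would count, and that part is at
    most exp(-(c - 1) pi) [gauss 1]. Comparing total masses gives c^(-n/2) <= exp(-(c - 1) pi),
    which [peak_lim] refutes for a suitable c. *)
Lemma ball_not_null n (xi : 'rV[R]_n) : ~ nulln [set x : 'rV[R]_n | dotp (x - xi) (x - xi) <= 1].
Proof.
set B := [set x | _] => B0.
have mB : measurable B.
  have m := measurable_dotp (measurable_rVD (- xi)) (measurable_rVD (- xi)).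
  have := m measurableT _ (@measurable_itv R `]-oo, 1]); rewrite setTI.
  by rewrite (_ : _ @^-1` _ = B)//; apply/seteqP; split => x /=; rewrite in_itv.
have [k _ /(_ k (leqnn _))] := @peak_lim R n pi (expR (- pi)) (pi_gt0 R) (expR_gt0 _).
set c : R := k.+2%:R.
have c0 : 0 < c by rewrite ltr0n.
have c1 : 0 <= c - 1 by rewrite /c -natr1 addrK.
clearbody c.
apply/negP; rewrite -leNgt.
have mi : measurable_fun setT (fun x => (\1_B x : R)%:E) by apply/measurable_EFinP; exact: measurable_indic.
have mg d : measurable_fun setT (fun x : 'rV[R]_n => (gauss d (x - xi))%:E).
  by apply/measurable_EFinP; apply: measurable_gauss; exact: measurable_rVD.
have k0 : 0 <= expR (- ((c - 1) * pi)) by exact: expR_ge0.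
have H : (\int[leb R n]_x (gauss c (x - xi))%:E <=
    \int[leb R n]_x ((\1_B x : R)%:E + (expR (- ((c - 1) * pi)))%:E * (gauss 1 (x - xi))%:E))%E.
  apply: ge0_le_integral_nm => x; first by rewrite lee_fin gauss_ge0.
  rewrite -EFinM -EFinD lee_fin indicE; case: (boolP (x \in B)) => xB.
    have g1 : gauss c (x - xi) <= 1.
      by rewrite /gauss -[leRHS]expR0 ler_expR oppr_le0 !mulr_ge0 ?pi_ge0 ?dotp_ge0// ltW.
    by apply: (le_trans g1); rewrite lerDl; exact: mulr_ge0 k0 (gauss_ge0 _ _).
  rewrite add0r -(subrK 1 c) -gauss_mul addrK ler_wpM2r ?gauss_ge0// ler_expR lerN2.
  have /negP/negP := xB; rewrite notin_setE /= => /negP; rewrite -ltNge => /ltW d1.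
  by rewrite ler_peMr// mulr_ge0 ?pi_ge0.
rewrite integral_gauss_sub// in H.
rewrite ge0_integralD//= in H; last 2 first.
- by move=> x _; rewrite -EFinM lee_fin; exact: mulr_ge0 k0 (gauss_ge0 _ _).
- by apply: emeasurable_funM => //; exact: mg.
rewrite -(iintE mi) in H; last by move=> x; rewrite lee_fin.
rewrite B0 add0e (ge0_integralZl_EFin _ measurableT _ (mg 1) k0) in H; last first.
  by move=> x _; rewrite lee_fin gauss_ge0.
rewrite integral_gauss_sub// sqrtr1 invr1 expr1n mule1 lee_fin in H.
rewrite sqrtrV ?(ltW c0)// invrK.
have s0 : 0 < Num.sqrt c ^+ n by rewrite exprn_gt0 ?sqrtr_gt0.
move: H; rewrite exprVn -lef_pV2 ?posrE ?expR_gt0 ?invr_gt0// invrK -expRN opprK => H.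
rewrite (_ : - pi = (c - 1) * pi + - (pi * c)); last by ring.
by rewrite expRD ler_wpM2r ?expR_ge0.
Qed.

(** The outer essential supremum controls almost every center, hence some x0 in each unit ball. At
    x0 the inner one bounds the transform of g times the window almost everywhere, and inversion
    puts the product in the class. *)
Lemma inW_wien n (g : 'rV[R]_n -> R) (N : R) : n%:R < N -> continuous g ->
  inW +oo%E +oo%E N (fun xi => RtoC (g xi)) ->
  exists2 C, 0 <= C & forall xi : 'rV[R]_n, exists2 x0 : 'rV[R]_n, dotp (x0 - xi) (x0 - xi) <= 1 &
    wien N C (fun y => RtoC (g y) * RtoC (gauss 1 (y - x0))).
Proof.
move=> nN cg [fi]; rewrite /Wnorm /Lpn eqxx => Woo.
set S := (fun x => esssupn _) in Woo.
have [T0 T00] : exists2 T : R, 0 <= T & (esssupn S < T%:E)%E.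
  move: Woo; case: (esssupn S) => [t _|//|_]; last by exists 0; rewrite ?ltNyr.
  by exists (`|t| + 1); rewrite ?addr_ge0// lte_fin ltr_pwDr// ler_norm.
(* The extra 1 gives the strict inequality that [esssupn_lt] asks for at the inner supremum. *)
move=> /esssupn_lt bad0; exists (T0 + 1) => [|xi]; first by rewrite addr_ge0.
have [x0 x01 x0g] : exists2 x0, dotp (x0 - xi) (x0 - xi) <= 1 & (S x0 <= T0%:E)%E.
  apply: contrapT => H; apply: (@ball_not_null n xi); apply: nulln_le bad0 => x /= x1.
  by rewrite ltNge; apply/negP => Sx; apply: H; exists x.
exists x0 => //; set B := (fun y => _ * _).
have mg : measurable_fun setT g by exact: continuous_measurable_rV.
have mB : cmfun B.
  apply: cmfunM; apply: cmfun_RtoC => //; apply: measurable_gauss; exact: measurable_rVD.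
have Bi : cL1 B.
  split=> //; have := fi x0; rewrite /integrable_n iintE//.
    apply: le_lt_trans; apply: ge0_le_integral_nm => y; first by rewrite lee_fin normc_ge0.
    by rewrite lee_fin /B Normc.normcM (normc_RtoC (gauss _ _)) normrM gwinE ler_wpM2r// ler_norm.
  apply/measurable_EFinP; apply: measurableT_comp => //; apply: measurable_funM.
    exact: (cmfun_normc (cmfun_RtoC mg)).
  by under eq_fun do rewrite gwinE; apply: measurable_gauss; exact: measurable_rVD.
have BE y : B y = RtoC (g y * gauss 1 (y - x0)) by rewrite /B RtoCM.
have cB : continuous (fun y : 'rV[R]_n => g y * gauss 1 (y - x0)).
  by move=> y; exact: (continuousM (cg y) (@continuous_gauss R n 1 x0 y)).
have T10 : 0 <= T0 + 1 by rewrite addr_ge0.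
apply: (wien_repr nN T10 Bi).
- by under [X in continuous X]eq_fun do rewrite BE.
- by under [X in continuous X]eq_fun do rewrite BE /=; exact: cst_continuous.
have T1 : (S x0 < (T0 + 1)%:E)%E by apply: le_lt_trans x0g _; rewrite lte_fin ltrDl.
have := esssupn_lt T1; set A := [set _ | _] => A0.
have mA : measurable A.
  have m : measurable_fun setT (fun z => normc (fourier B z) * jbr z `^ N).
    by apply: measurable_funM; [apply: cmfun_normc; exact: cmfun_fourier|exact: measurable_jbr_powR].
  have := m measurableT _ (@measurable_itv R `]T0 + 1, +oo[); rewrite setTI.
  rewrite (_ : _ @^-1` _ = A)//.
  by apply/seteqP; split => z; rewrite /preimage /A /mkset stftE in_itv /= andbT lte_fin.
exists A; split => //; first exact: nulln_leb.
move=> z; rewrite /setC /mkset => nz; rewrite /A /mkset lte_fin stftE ltNge; apply/negP => zT; apply: nz.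
by rewrite powRN ler_pdivlMr ?powR_gt0 ?jbr_gt0.
Qed.
End window_centers.

(** * Fourier transform of Schwartz functions *)

Section schwartz_decay.
Variable R : realType.

Lemma schwartzR_deriv n (g : 'rV[R]_n -> R) j : schwartzR g -> schwartzR ('D_(ebasis R j) g).
Proof.
(* The innermost derivative of a [foldr] is the last index of the list. *)
move=> [dg bg]; have E js : pderiv js ('D_(ebasis R j) g) = pderiv (rcons js j) g.
  by rewrite /pderiv foldr_rcons.
by split => [js x|js k]; rewrite E.
Qed.

Definition cderiv n (j : 'I_n) (f : 'rV[R]_n -> R[i]) (x : 'rV[R]_n) : R[i] :=
  ('D_(ebasis R j) (fun y => Re (f y)) x +i* 'D_(ebasis R j) (fun y => Im (f y)) x)%C.

Lemma schwartz_cderiv n (f : 'rV[R]_n -> R[i]) j : schwartz f -> schwartz (cderiv j f).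
Proof. by move=> [fR fI]; split; exact: schwartzR_deriv. Qed.

Lemma cder_schwartz n (f : 'rV[R]_n -> R[i]) j : schwartz f -> cder (ebasis R j) f (cderiv j f).
Proof.
move=> [[dR _] [dI _]] x.
by split; apply: is_derive_differentiable; [exact: (dR [::])|exact: (dI [::])].
Qed.

Lemma schwartz_continuous n (f : 'rV[R]_n -> R[i]) : schwartz f ->
  continuous (fun x => Re (f x)) /\ continuous (fun x => Im (f x)).
Proof.
move=> [[dR _] [dI _]].
by split=> x; apply: differentiable_continuous; [exact: (dR [::])|exact: (dI [::])].
Qed.

Lemma schwartz_cmfun n (f : 'rV[R]_n -> R[i]) : schwartz f -> cmfun f.
Proof. by move=> /schwartz_continuous[cR cI]; split; exact: continuous_measurable_rV. Qed.

Lemma schwartz_bound n (f : 'rV[R]_n -> R[i]) (k : nat) : schwartz f ->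
  exists2 C, 0 <= C & forall x, normc (f x) <= C * jbr x `^ (- k%:R).
Proof.
move=> [[_ bR] [_ bI]]; have [M1 H1] := bR [::] k; have [M2 H2] := bI [::] k.
exists (M1 + M2) => [|x].
  have := H1 0; have := H2 0; rewrite jbr0 expr1n !mul1r => h2 h1.
  by rewrite addr_ge0// (le_trans _ h1, le_trans _ h2).
have j0 : 0 < jbr x ^+ k by rewrite exprn_gt0// jbr_gt0.
rewrite powRN powR_mulrn ?jbr_ge0// ler_pdivlMr// mulrC.
apply: (@le_trans _ _ (jbr x ^+ k * (`|Re (f x)| + `|Im (f x)|))).
  by rewrite ler_wpM2l ?(ltW j0)// normc_le_ReIm.
by rewrite mulrDr lerD ?H1 ?H2.
Qed.

Lemma schwartz_cL1 n (f : 'rV[R]_n -> R[i]) : schwartz f -> cL1 f.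
Proof.
move=> sf; have [C _ HC] := schwartz_bound n.+1 sf.
by apply: (cL1_jbr _ (schwartz_cmfun sf) HC); rewrite ltr_nat.
Qed.

(** The induction runs over all Schwartz functions at once, since its step applies the bound to
    every partial derivative. *)
Lemma fourier_schwartz_nat n (k : nat) (f : 'rV[R]_n -> R[i]) : schwartz f ->
  exists2 C, 0 <= C & forall x, normc (fourier f x) <= C * jbr x `^ (- k%:R).
Proof.
elim: k f => [|k IH] f sf.
  have [mf foo] := schwartz_cL1 sf.
  have f0 : (0 <= \int[leb R n]_x (normc (f x))%:E)%E.
    by apply: integral_ge0 => x _; rewrite lee_fin normc_ge0.
  exists (2 * fine (\int[leb R n]_x (normc (f x))%:E)) => [|x]; first by rewrite mulr_ge0// fine_ge0.
  rewrite oppr0 powRr0 mulr1 -lee_fin EFinM fineK; first exact: fourier_le.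
  by rewrite ge0_fin_numE.
have [C C0 HC] := IH f sf.
have /choice[D HD] : forall j : 'I_n, exists D, 0 <= D /\ forall x, normc (fourier (cderiv j f) x) <= D * jbr x `^ (- k%:R).
  by move=> j; have [D D0 HD] := IH _ (schwartz_cderiv j sf); exists D.
exists (C + \sum_j D j) => [|x].
  by rewrite addr_ge0// sumr_ge0// => j _; case: (HD j).
have jx := jbr_gt0 x.
have -> : jbr x `^ (- k.+1%:R) = jbr x `^ (- k%:R) / jbr x.
  by rewrite -natr1 opprD powRD ?(gt_eqF jx) ?implybT// powR_inv1// ltW.
rewrite mulrA ler_pdivlMr// mulrC.
have F0 := normc_ge0 (fourier f x).
apply: (@le_trans _ _ ((1 + \sum_j `|dotp (ebasis R j) x|) * normc (fourier f x))).
  by rewrite ler_wpM2r// jbr_le_sum.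
rewrite mulrDl mul1r mulr_suml mulrDl; apply: lerD => //.
rewrite mulr_suml; apply: ler_sum => j _.
have [_ HDj] := HD j; apply: le_trans (HDj x).
have [C1 C10 HC1] := schwartz_bound n.+1 sf.
have [C2 C20 HC2] := schwartz_bound n.+1 (schwartz_cderiv j sf).
rewrite (@fourier_derive R n (ebasis R j) f (cderiv j f) (C1 + C2) n.+1%:R x).
- rewrite Normc.normcM ler_wpM2r//= expr0n add0r sqrtr_sqr normrM ler_peMl//.
  rewrite ger0_norm ?mulr_ge0 ?pi_ge0//; have := @pi_ge2 R; lra.
- by rewrite ltr_nat.
- exact: cder_schwartz.
- exact: schwartz_cmfun.
- exact/schwartz_cmfun/schwartz_cderiv.
- by move=> y; apply: le_trans (HC1 y) _; rewrite ler_wpM2r ?powR_ge0// lerDl.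
- by move=> y; apply: le_trans (HC2 y) _; rewrite ler_wpM2r ?powR_ge0// lerDr.
Qed.

Lemma fourier_schwartz n (M : R) (f : 'rV[R]_n -> R[i]) : schwartz f ->
  exists2 C, 0 <= C & forall x, normc (fourier f x) <= C * jbr x `^ (- M).
Proof.
move=> /(fourier_schwartz_nat (Num.bound `|M|).+1)[C C0 HC]; exists C => // x.
apply: le_trans (HC x) _; rewrite ler_wpM2l//; apply: ler_powR; first exact: jbr_ge1.
rewrite lerN2; apply: le_trans (ler_norm M) _.
have := archi_boundP (normr_ge0 M); rewrite -natr1 => /ltW/le_trans; apply.
by rewrite lerDl.
Qed.

Lemma schwartz_inversion n (f : 'rV[R]_n -> R[i]) x : schwartz f ->
  f x = cint (fun xi => fourier f xi * cexpi (2 * pi * dotp xi x)).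
Proof.
move=> sf; have fi := schwartz_cL1 sf.
have [C C0 HC] := fourier_schwartz (n%:R + 1) sf.
have nN : n%:R < n%:R + 1 :> R by rewrite ltrDl.
have [cR cI] := schwartz_continuous sf.
have bnd : {ae leb R n, forall z, normc (fourier f z) <= C * jbr z `^ (- (n%:R + 1))} by exact: aeW.
by have [_ ->] := fourier_repr nN C0 fi cR cI bnd.
Qed.
End schwartz_decay.

(** * Short-time Fourier transform *)
Section stft_synthesis.
Variable R : realType.

Lemma cmfun_ebr n d (T : measurableType d) (f g : T -> 'rV[R]_n) :
  measurable_fun setT f -> measurable_fun setT g ->
  cmfun (fun t => cexpi (2 * pi * dotp (f t) (g t))).
Proof.
move=> mf mg; apply: cmfun_cexpi; apply: measurable_funM => //; exact: measurable_dotp.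
Qed.

Lemma measurable_rVsub n d (T : measurableType d) (f g : T -> 'rV[R]_n) :
  measurable_fun setT f -> measurable_fun setT g -> measurable_fun setT (fun t => f t - g t).
Proof.
move=> mf mg; apply: measurable_rVP => i.
under eq_fun do rewrite !mxE.
by apply: measurable_funB; apply: (measurableT_comp (measurable_coord _)).
Qed.

(** The transform of a translated Gaussian at -th; as [gauss 1] is self-dual, the window looks the
    same on the frequency side. *)
Lemma cint_gauss_cexpi n (x th : 'rV[R]_n) :
  cint (fun y => RtoC (gauss 1 (y - x)) * cexpi (2 * pi * dotp y th)) =
  RtoC (gauss 1 th) * cexpi (2 * pi * dotp x th).
Proof.
have i0 : cL1 (fun y : 'rV[R]_n => RtoC (gauss 1 y)).
  by have := cL1_gauss0 (0 : 'rV[R]_n) ltr01; under [X in cL1 X -> _]eq_fun do rewrite subr0.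
have := fourier_shift x (- th) i0.
rewrite fourier_gauss// sqrtr1 !invr1 expr1n mul1r gaussN dotpNr mulrN opprK mulrC => <-.
by apply: eq_cint => y; rewrite dotpNr mulrN opprK.
Qed.

(** Frequency-side form of the short-time transform. It is applied to f with W = F f, and to e^{i
    mu(D)} f with W = e^{i mu} F f. *)
Lemma stft_synthesis n (W : 'rV[R]_n -> R[i]) x xi : cL1 W ->
  stft (fun y => cint (fun eta => W eta * cexpi (2 * pi * dotp y eta))) x xi =
  cint (fun eta => W eta * RtoC (gauss 1 (eta - xi)) * cexpi (2 * pi * dotp x (eta - xi))).
Proof.
move=> Wi; have [mW Woo] := Wi.
pose P (y eta : 'rV[R]_n) := RtoC (gauss 1 (y - x)) * cexpi (- (2 * pi * dotp y xi)) *
  (W eta * cexpi (2 * pi * dotp y eta)).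
have mP : cmfun (fun w : 'rV[R]_n * 'rV[R]_n => P w.1 w.2).
  apply: cmfunM; apply: cmfunM.
  - by apply: cmfun_RtoC; apply: measurable_gauss; apply: measurable_rVsub.
  - exact: cmfun_fker.
  - exact: (cmfun_comp mW measurable_snd).
  - exact: cmfun_ebr.
have Poo : (\int[leb R n]_y \int[leb R n]_eta (normc (P y eta))%:E < +oo)%E.
  apply: (@integral_prod_lty R n n _ (fun y => gauss 1 (y - x)) (fun eta => normc (W eta))).
  - by apply: measurable_gauss; exact: measurable_rVD.
  - exact: cmfun_normc.
  - by move=> y; exact: gauss_ge0.
  - by move=> y; exact: normc_ge0.
  - by rewrite integral_gauss_sub// ltry.
  - exact: Woo.
  - by move=> y eta; exact: normc_ge0.
  - move=> y eta; rewrite /P !Normc.normcM !normc_cexpi !mulr1 normc_RtoC.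
    by rewrite (ger0_norm (gauss_ge0 _ _)).
have WEi y : cL1 (fun eta => W eta * cexpi (2 * pi * dotp y eta)).
  apply: (cL1_lec _ _ Wi) => [|eta]; first by apply: cmfunM => //; exact: cmfun_ebr.
  by rewrite Normc.normcM normc_cexpi mulr1.
transitivity (cint (fun y => cint (P y))).
  rewrite stftE; apply: eq_cint => y; rewrite /P (cintZl _ (WEi y)).
  by rewrite -mulrA mulrC.
rewrite (cint_Fubini mP Poo); apply: eq_cint => eta.
rewrite (eq_cint (g := fun y => W eta * (RtoC (gauss 1 (y - x)) * cexpi (2 * pi * dotp y (eta - xi))))).
  rewrite cintZl ?cint_gauss_cexpi ?mulrA//.
  apply: (cL1_lec _ _ (cL1_gauss0 x ltr01)) => [|y].
    apply: cmfunM; last exact: cmfun_ebr.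
    by apply: cmfun_RtoC; apply: measurable_gauss; exact: measurable_rVD.
  by rewrite Normc.normcM normc_cexpi mulr1.
move=> y; rewrite /P mulrA (mulrC _ (W eta)) -!mulrA; congr (_ * (_ * _)).
by rewrite -cexpiD dotpDr dotpNr; congr cexpi; ring.
Qed.

Lemma cmfun_stft n (f : 'rV[R]_n -> R[i]) : cmfun f ->
  cmfun (fun w : 'rV[R]_n * 'rV[R]_n => stft f w.1 w.2).
Proof.
move=> mf; have -> : (fun w : 'rV[R]_n * 'rV[R]_n => stft f w.1 w.2) =
    (fun w => cint (fun y => f y * RtoC (gauss 1 (y - w.1)) * cexpi (- (2 * pi * dotp y w.2)))).
  by apply/funext => w; rewrite stftE.
apply: (cmfun_cint (F := fun (w : 'rV[R]_n * 'rV[R]_n) (y : 'rV[R]_n) => f y * RtoC (gauss 1 (y - w.1)) * cexpi (- (2 * pi * dotp y w.2)))).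
apply: cmfunM.
  apply: cmfunM; first exact: (cmfun_comp mf measurable_snd).
  apply: cmfun_RtoC; apply: measurable_gauss; apply: measurable_rVsub => //.
  exact: (measurableT_comp measurable_fst measurable_fst).
apply: cmfun_cexpi; apply: measurable_funN; apply: measurable_funM => //; apply: measurable_dotp => //.
exact: (measurableT_comp measurable_snd measurable_fst).
Qed.

Lemma integral_gauss_subr n c (a : 'rV[R]_n) : 0 < c ->
  (\int[leb R n]_x (gauss c (a - x))%:E = ((Num.sqrt c)^-1 ^+ n)%:E)%E.
Proof.
by move=> c0; rewrite -(integral_gauss_sub a c0); apply: eq_integral => x _; rewrite -gaussN opprB.
Qed.

Lemma stft_cL1 n (f : 'rV[R]_n -> R[i]) z : cL1 f -> cL1 (fun y => stft f y z).
Proof.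
move=> [mf foo]; split; first exact: (cmfun_comp (cmfun_stft mf) (measurable_pair2 z)).
have mP : measurable_fun setT (fun w : 'rV[R]_n * 'rV[R]_n => (normc (f w.2) * gauss 1 (w.2 - w.1))%:E).
  apply/measurable_EFinP; apply: measurable_funM.
    exact: (cmfun_normc (cmfun_comp mf measurable_snd)).
  by apply: measurable_gauss; exact: measurable_rVsub.
have P0 (w : 'rV[R]_n * 'rV[R]_n) : (0 <= (normc (f w.2) * gauss 1 (w.2 - w.1))%:E)%E.
  by rewrite lee_fin; apply: mulr_ge0; [exact: normc_ge0|exact: gauss_ge0].
apply: (@le_lt_trans _ _ (\int[leb R n]_y (2%:E * \int[leb R n]_u (normc (f u) * gauss 1 (u - y))%:E))%E).
  apply: ge0_le_integral_nm => y; first by rewrite lee_fin normc_ge0.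
  rewrite stftE; apply: le_trans (fourier_le _ _) _.
    by apply: cmfunM => //; apply: cmfun_RtoC; apply: measurable_gauss; exact: measurable_rVD.
  under eq_integral do rewrite Normc.normcM normc_RtoC (ger0_norm (gauss_ge0 _ _)).
  by [].
rewrite ge0_integralZl_EFin//; last 2 first.
- by move=> y _; apply: integral_ge0 => u _; exact: (P0 (y, u)).
- exact: (measurable_fun_fubini_tonelli_F _ mP P0).
rewrite (fubini_tonelli _ mP P0)/=.
under eq_integral => u _.
  under eq_integral do rewrite EFinM.
  rewrite ge0_integralZl_EFin//; last 3 first.
  - by move=> y _; rewrite lee_fin gauss_ge0.
  - apply/measurable_EFinP; apply: measurable_gauss; exact: measurable_rVsub.
  - exact: normc_ge0.
  rewrite integral_gauss_subr// sqrtr1 invr1 expr1n mule1.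
  over.
by apply: lte_mul_pinfty.
Qed.
End stft_synthesis.

(** * Convolution bound for the transform of a Fourier multiplier *)

Section stft_convolution.
Variable R : realType.

(** For fixed z, y -> V f(y, z) is the convolution of a modulation of f with the window, so its
    Fourier transform is a translate of F f times a Gaussian: the spectrum of f near z is recovered
    from V f(., z). *)
Lemma stft_analysis n (f : 'rV[R]_n -> R[i]) (eta z : 'rV[R]_n) : cL1 f ->
  cint (fun y => stft f y z * cexpi (2 * pi * dotp y (z - eta))) =
  fourier f eta * RtoC (gauss 1 (eta - z)).
Proof.
move=> fi; have [mf foo] := fi.
pose P (u y : 'rV[R]_n) := f u * cexpi (- (2 * pi * dotp u z)) *
  (RtoC (gauss 1 (y - u)) * cexpi (2 * pi * dotp y (z - eta))).
have mP : cmfun (fun w : 'rV[R]_n * 'rV[R]_n => P w.1 w.2).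
  apply: cmfunM; apply: cmfunM.
  - exact: (cmfun_comp mf measurable_fst).
  - exact: cmfun_fker.
  - by apply: cmfun_RtoC; apply: measurable_gauss; exact: measurable_rVsub.
  - exact: cmfun_ebr.
have nP u y : normc (P u y) = normc (f u) * gauss 1 (y - u).
  by rewrite /P !Normc.normcM !normc_cexpi !mulr1 normc_RtoC (ger0_norm (gauss_ge0 _ _)).
have Poo : (\int[leb R n]_u \int[leb R n]_y (normc (P u y))%:E < +oo)%E.
  under eq_integral => u _.
    under eq_integral do rewrite nP EFinM.
    rewrite ge0_integralZl_EFin//; last 3 first.
    - by move=> y _; rewrite lee_fin gauss_ge0.
    - apply/measurable_EFinP; apply: measurable_gauss; exact: measurable_rVD.
    - exact: normc_ge0.
    rewrite integral_gauss_sub// sqrtr1 invr1 expr1n mule1.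
    over.
  exact: foo.
transitivity (cint (fun y => cint (P ^~ y))).
  apply: eq_cint => y; rewrite stftE /fourier mulrC -cintZl; last first.
    apply: (cL1_lec _ _ fi) => [|u].
      apply: cmfunM; last exact: cmfun_fker.
      by apply: cmfunM => //; apply: cmfun_RtoC; apply: measurable_gauss; exact: measurable_rVD.
    rewrite !Normc.normcM normc_cexpi mulr1 ler_piMr ?normc_ge0// normc_RtoC (ger0_norm (gauss_ge0 _ _)).
    by rewrite /gauss -[leRHS]expR0 ler_expR oppr_le0 !mulr_ge0 ?pi_ge0 ?dotp_ge0.
  apply: eq_cint => u; rewrite /P -(gaussN 1 (u - y)) opprB.
  by move: (cexpi _) (cexpi _) (RtoC _) (f u) => X Y Z U; ring.
rewrite -(cint_Fubini mP Poo) /fourier.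
rewrite mulrC -cintZl; last first.
  by apply: (cL1_lec _ _ fi) => [|u]; [apply: cmfunM => //; exact: cmfun_fker|rewrite Normc.normcM normc_cexpi mulr1].
apply: eq_cint => u; rewrite /P cintZl.
  rewrite cint_gauss_cexpi -gaussN opprB -!mulrA (mulrCA (RtoC _)); congr (_ * _).
  rewrite mulrCA; congr (_ * _); rewrite -cexpiD; congr cexpi; rewrite dotpDr dotpNr; ring.
apply: (cL1_lec _ _ (cL1_gauss0 u ltr01)) => [|y].
  apply: cmfunM; last exact: cmfun_ebr.
  by apply: cmfun_RtoC; apply: measurable_gauss; exact: measurable_rVD.
by rewrite Normc.normcM normc_cexpi mulr1.
Qed.

(** The parallelogram identity in the exponent. *)
Lemma gauss_midpoint n (eta a b : 'rV[R]_n) :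
  gauss 1 (eta - a) * gauss 1 (eta - b) = gauss 2^-1 (a - b) * gauss 2 (eta - 2^-1 *: (a + b)).
Proof.
have -> : a - b = (eta - b) + -1 *: (eta - a) by apply/rowP => i; rewrite !mxE; ring.
have -> : eta - 2^-1 *: (a + b) = 2^-1 *: ((eta - b) + (eta - a)) by apply/rowP => i; rewrite !mxE; field.
move: (eta - a) (eta - b) => u v; rewrite /gauss -!expRD; congr expR.
rewrite !dotpZl !dotpZr !dotpDl !dotpDr !dotpZl !dotpZr (dotpC v u).
by move: (dotp u u) (dotp u v) (dotp v v) (@pi R) => x1 x2 x3 p; field.
Qed.

Lemma gauss_le1 n c (x : 'rV[R]_n) : 0 <= c -> gauss c x <= 1.
Proof. by move=> c0; rewrite /gauss -[leRHS]expR0 ler_expR oppr_le0 !mulr_ge0 ?pi_ge0 ?dotp_ge0. Qed.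

(** Of the exponent c + 1 at z, the unit part merges with the window at xi into [gauss 2^-1] (z -
    xi) times a Gaussian at the midpoint, which is a multiplier of the class. Up to a unimodular
    factor the integral is then a transform at y - x, and the part of exponent c together with w
    decays by hypothesis. *)
Lemma phase_kernel_le n (N a t c C : R) (w : 'rV[R]_n -> R[i]) :
  n%:R < N -> 0 <= a -> a <= N -> 0 < c -> 0 <= C ->
  cmfun w -> (forall y, normc (w y) <= 1) ->
  (forall xi x : 'rV[R]_n, normc (fourier (fun y => RtoC (gauss c (y - xi)) * w y) x) <=
     C * jbr xi `^ t * jbr x `^ (- a)) ->
  exists2 K, 0 <= K & forall x xi y z : 'rV[R]_n,
    normc (cint (fun eta => w eta * RtoC (gauss (c + 1) (eta - z)) * RtoC (gauss 1 (eta - xi)) *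
      cexpi (2 * pi * dotp x (eta - xi)) * cexpi (2 * pi * dotp y (z - eta)))) <=
    K * (jbr z `^ t * gauss 2^-1 (z - xi) * jbr (x - y) `^ (- a)).
Proof.
move=> nN a0 aN c0 C0 mw w1 wC.
have [D D0 HD] := wien_gauss nN (ltr0n R 2).
exists (2 * (4 `^ a * 3 * Ijbr n N) * (C * D)) => [|x xi y z].
  by rewrite !mulr_ge0 ?powR_ge0 ?Ijbr_ge0 ?(ltW D0).
have W := wienZ (RtoC (gauss 2^-1 (z - xi))) (HD (2^-1 *: (z + xi))).
have g0 : 0 <= gauss 2^-1 (z - xi) by exact: gauss_ge0.
rewrite normc_RtoC ger0_norm// in W.
have p0 : 0 <= C * jbr z `^ t by rewrite mulr_ge0 ?powR_ge0.
have q0 : 0 <= gauss 2^-1 (z - xi) * D by rewrite mulr_ge0 ?(ltW D0).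
have H := wien_mul (y - x) nN a0 aN p0 q0 (cL1_gauss z c0 mw w1) W (wC z).
rewrite -(opprB y x) jbrN.
rewrite (_ : normc (cint _) = normc (fourier (fun eta => RtoC (gauss c (eta - z)) * w eta *
    (RtoC (gauss 2^-1 (z - xi)) * RtoC (gauss 2 (eta - 2^-1 *: (z + xi))))) (y - x))).
  apply: (le_trans H); rewrite le_eqVlt; apply/orP; left; apply/eqP.
  by move: (jbr z `^ t) (jbr _ `^ _) (gauss _ _) => X Y Z; ring.
set F := fourier _ _.
transitivity (normc (cexpi (2 * pi * (dotp y z - dotp x xi)) * F)); last first.
  by rewrite Normc.normcM normc_cexpi mul1r.
congr normc.
rewrite /F /fourier -cintZl; last first.
  apply: (cL1_lec _ _ (cL1_mul_wien nN q0 (cL1_gauss z c0 mw w1) W)) => [|eta]; last first.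
    by rewrite !Normc.normcM normc_cexpi mulr1.
  apply: cmfunM; last exact: cmfun_fker.
  exact: (cmfunM (cL1_gauss z c0 mw w1).1 (wien_cmfun W)).
apply: eq_cint => eta; rewrite -RtoCM -gauss_midpoint RtoCM -gauss_mul RtoCM.
have E : cexpi (2 * pi * dotp x (eta - xi)) * cexpi (2 * pi * dotp y (z - eta)) =
    cexpi (2 * pi * (dotp y z - dotp x xi)) * cexpi (- (2 * pi * dotp eta (y - x))) :> R[i].
  rewrite -!cexpiD; congr cexpi; rewrite (dotpDr _ _ x) (dotpDr _ _ y) (dotpDr _ _ eta) !dotpNr (dotpC eta y) (dotpC eta x).
  by move: (dotp x eta) (dotp x xi) (dotp y z) (dotp y eta) (@pi R) => x1 x2 x3 x4 p; ring.
move: E; move: (cexpi (_ * dotp x _)) (cexpi (_ * dotp y _)) (cexpi (_ * (_ - _))) (cexpi (- _)) => X1 X2 X3 X4 E.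
move: (w eta) (RtoC (gauss c _)) (RtoC (gauss 1 (eta - z))) (RtoC (gauss 1 (eta - xi))) => Y1 Y2 Y3 Y4.
transitivity (Y1 * Y2 * Y3 * Y4 * (X1 * X2)); first by ring.
by rewrite E; ring.
Qed.

(** Stated for a bounded multiplier w because it serves twice: w = e^{i mu} gives the bound on T,
    and w = 1 bounds V f by itself. One unit of the inserted Gaussian of exponent c + 2 turns F f
    into V f(., z) by [stft_analysis]; the rest forms the kernel of [phase_kernel_le]. *)
Lemma stft_convolution n (N a t c C : R) (w : 'rV[R]_n -> R[i]) :
  n%:R < N -> 0 <= a -> a <= N -> 0 < c -> 0 <= C ->
  cmfun w -> (forall y, normc (w y) <= 1) ->
  (forall xi x : 'rV[R]_n, normc (fourier (fun y => RtoC (gauss c (y - xi)) * w y) x) <=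
     C * jbr xi `^ t * jbr x `^ (- a)) ->
  exists2 K, 0 <= K & forall f : 'rV[R]_n -> R[i], cL1 f -> cL1 (fourier f) -> forall x xi,
    ((normc (stft (fun u => cint (fun eta => w eta * fourier f eta * cexpi (2 * pi * dotp u eta))) x xi))%:E
     <= K%:E * \int[leb R n]_z \int[leb R n]_y
        (normc (stft f y z) * (jbr z `^ t * gauss 2^-1 (z - xi) * jbr (x - y) `^ (- a)))%:E)%E.
Proof.
move=> nN a0 aN c0 C0 mw w1 wC.
have [K0 K00 HK] := phase_kernel_le nN a0 aN c0 C0 mw w1 wC.
(* The mass of the Gaussian of exponent c + 2; after division by it the translates in z form a
   partition of unity. *)
pose k : R := (Num.sqrt (c + 1 + 1))^-1 ^+ n.
have c1 : 0 < c + 1 by rewrite addr_gt0.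
have c2 : 0 < c + 1 + 1 by rewrite addr_gt0.
have k0 : 0 < k by rewrite exprn_gt0// invr_gt0 sqrtr_gt0.
(* The 4 is the factor 2 of [normc_cint], once for the integral in z and once for that in y. *)
exists (k^-1 * (4 * K0)) => [|f fi Fi x xi]; first by rewrite !mulr_ge0// invr_ge0 ltW.
set F := fourier f.
have mF : cmfun F by exact: cmfun_fourier fi.1.
have Wi : cL1 (fun eta => w eta * F eta).
  apply: (cL1_lec (cmfunM mw mF) _ Fi) => y.
  by rewrite Normc.normcM ler_piMl ?normc_ge0.
rewrite (stft_synthesis x xi Wi).
pose A (eta z : 'rV[R]_n) := w eta * RtoC (gauss (c + 1) (eta - z)) * RtoC (gauss 1 (eta - xi)) *
  cexpi (2 * pi * dotp x (eta - xi)).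
pose B (eta z : 'rV[R]_n) := A eta z * (F eta * RtoC (gauss 1 (eta - z))).
have nA eta z : normc (A eta z) <= gauss 1 (eta - xi).
  rewrite /A !Normc.normcM normc_cexpi mulr1 !normc_RtoC !(ger0_norm (gauss_ge0 _ _)).
  by rewrite ler_piMl ?gauss_ge0// mulr_ile1 ?normc_ge0 ?gauss_ge0// gauss_le1// ltW.
have mA : cmfun (fun v : 'rV[R]_n * 'rV[R]_n => A v.1 v.2).
  apply: cmfunM; first apply: cmfunM; first apply: cmfunM.
  - exact: (cmfun_comp mw measurable_fst).
  - by apply: cmfun_RtoC; apply: measurable_gauss; exact: measurable_rVsub.
  - by apply: cmfun_RtoC; apply: measurable_gauss; exact: measurable_rVsub.
  - by apply: cmfun_ebr => //; exact: measurable_rVsub.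
have mB : cmfun (fun v : 'rV[R]_n * 'rV[R]_n => B v.1 v.2).
  apply: (cmfunM mA); apply: cmfunM; first exact: (cmfun_comp mF measurable_fst).
  by apply: cmfun_RtoC; apply: measurable_gauss; exact: measurable_rVsub.
pose E (eta : 'rV[R]_n) := w eta * F eta * RtoC (gauss 1 (eta - xi)) * cexpi (2 * pi * dotp x (eta - xi)).
have BE eta z : B eta z = E eta * RtoC (gauss (c + 1 + 1) (eta - z)).
  rewrite /B /A /E -(gauss_mul (c + 1) 1) RtoCM.
  move: (cexpi _) (w eta) (F eta) (RtoC _) (RtoC _) (RtoC _) => X1 X2 X3 X4 X5 X6; ring.
have Ei : cL1 E.
  apply: (cL1_lec _ _ Wi) => [|eta].
    apply: cmfunM; first apply: cmfunM; first exact: cmfunM.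
      by apply: cmfun_RtoC; apply: measurable_gauss; exact: measurable_rVD.
    by apply: cmfun_ebr => //; exact: measurable_rVD.
  rewrite /E Normc.normcM normc_cexpi mulr1 Normc.normcM normc_RtoC (ger0_norm (gauss_ge0 _ _)).
  by rewrite ler_piMr ?normc_ge0// gauss_le1.
have mg (eta : 'rV[R]_n) : measurable_fun setT (fun z : 'rV[R]_n => gauss (c + 1 + 1) (eta - z)).
  by apply: measurable_gauss; exact: measurable_rVsub.
have ig (eta : 'rV[R]_n) : (\int[leb R n]_z (gauss (c + 1 + 1) (eta - z))%:E = k%:E)%E.
  exact: integral_gauss_subr.
have S1 : RtoC k * cint E = cint (fun eta => cint (B eta)).
  rewrite -cintZl//; apply: eq_cint => eta.
  rewrite (eq_cint (g := fun z => E eta * RtoC (gauss (c + 1 + 1) (eta - z)))) => [|z]; last exact: BE.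
  rewrite cintZl ?(cint_RtoC (mg eta) _ (ig eta)) 1?mulrC//; first by move=> z; exact: gauss_ge0.
  apply: (@cL1_le _ _ _ (fun z => gauss (c + 1 + 1) (eta - z))); first exact: cmfun_RtoC.
    by move=> z; rewrite normc_RtoC (ger0_norm (gauss_ge0 _ _)).
  by rewrite ig ltry.
have Boo : (\int[leb R n]_eta \int[leb R n]_z (normc (B eta z))%:E < +oo)%E.
  under eq_integral => eta _.
    under eq_integral do rewrite BE Normc.normcM normc_RtoC (ger0_norm (gauss_ge0 _ _)) EFinM.
    rewrite ge0_integralZl_EFin//; last 3 first.
    - by move=> z _; rewrite lee_fin gauss_ge0.
    - exact/measurable_EFinP.
    - exact: normc_ge0.
    rewrite ig muleC.
    over.
  rewrite ge0_integralZl_EFin//; last 3 first.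
  - by move=> z _; rewrite lee_fin normc_ge0.
  - exact: cmfun_normcE Ei.1.
  - exact: ltW.
  by apply: lte_mul_pinfty => //; [rewrite lee_fin ltW|exact: Ei.2].
pose V y z := stft f y z.
pose I y z := cint (fun eta => A eta z * cexpi (2 * pi * dotp y (z - eta))).
have mAe z : cmfun (fun v : 'rV[R]_n * 'rV[R]_n => A v.2 z * cexpi (2 * pi * dotp v.1 (z - v.2))).
  apply: cmfunM; last by apply: cmfun_ebr => //; exact: measurable_rVsub.
  apply: (cmfun_comp mA (g := fun v : 'rV[R]_n * 'rV[R]_n => (v.2, z))).
  exact: measurable_fun_pair.
have Vi z : cL1 (V ^~ z) by exact: stft_cL1.
have S3 z : cint (B ^~ z) = cint (fun y => V y z * I y z).
  pose G (eta y : 'rV[R]_n) := A eta z * (V y z * cexpi (2 * pi * dotp y (z - eta))).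
  have Vei eta : cL1 (fun y => V y z * cexpi (2 * pi * dotp y (z - eta))).
    apply: (cL1_lec _ _ (Vi z)) => [|y]; last by rewrite Normc.normcM normc_cexpi mulr1.
    by apply: (cmfunM (Vi z).1); exact: cmfun_ebr.
  transitivity (cint (fun eta => cint (G eta))).
    by apply: eq_cint => eta; rewrite /B -stft_analysis// -cintZl.
  have mG : cmfun (fun v : 'rV[R]_n * 'rV[R]_n => G v.1 v.2).
    apply: cmfunM.
      apply: (cmfun_comp mA (g := fun v : 'rV[R]_n * 'rV[R]_n => (v.1, z))).
      exact: measurable_fun_pair.
    apply: cmfunM; first exact: (cmfun_comp (Vi z).1 measurable_snd).
    by apply: cmfun_ebr => //; exact: measurable_rVsub.
  rewrite (cint_Fubini mG); last first.
    apply: (@integral_prod_lty R n n _ (fun eta => gauss 1 (eta - xi)) (fun y => normc (V y z))).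
    - by apply: measurable_gauss; exact: measurable_rVD.
    - exact: cmfun_normc (Vi z).1.
    - by move=> eta; exact: gauss_ge0.
    - by move=> y; exact: normc_ge0.
    - by rewrite integral_gauss_sub// ltry.
    - exact: (Vi z).2.
    - by move=> eta y; exact: normc_ge0.
    - move=> eta y; rewrite /G (Normc.normcM (A eta z)) (Normc.normcM (V y z)) normc_cexpi mulr1.
      by rewrite ler_wpM2r ?normc_ge0.
  apply: eq_cint => y; rewrite /I -cintZl; last first.
    apply: (@cL1_le _ _ _ (fun eta => gauss 1 (eta - xi))).
    - exact: (cmfun_comp (mAe z) (g := fun eta => (y, eta)) (measurable_pair1 y)).
    - by move=> eta; rewrite Normc.normcM normc_cexpi mulr1.
    - by rewrite integral_gauss_sub// ltry.
  by apply: eq_cint => eta; rewrite /G mulrCA.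
have S4 : RtoC k * cint E = cint (fun z => cint (B ^~ z)) by apply: (etrans S1); exact: (cint_Fubini mB Boo).
pose P (v : 'rV[R]_n * 'rV[R]_n) : R :=
  normc (stft f v.2 v.1) * (jbr v.1 `^ t * gauss 2^-1 (v.1 - xi) * jbr (x - v.2) `^ (- a)).
have P0 v : 0 <= P v by rewrite !mulr_ge0 ?normc_ge0 ?powR_ge0 ?gauss_ge0.
have mP : measurable_fun setT P.
  apply: measurable_funM.
    apply: (cmfun_normc (cmfun_comp (cmfun_stft fi.1) (g := fun v : 'rV[R]_n * 'rV[R]_n => (v.2, v.1)) _)).
    exact: measurable_fun_pair.
  apply: measurable_funM; first apply: measurable_funM.
  - exact: measurable_jbr_powR.
  - by apply: measurable_gauss; exact: measurable_rVsub.
  - by apply: measurable_jbr_powR; exact: measurable_rVsub.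
have mPE : measurable_fun setT (fun v => (P v)%:E) by exact/measurable_EFinP.
have P0E v : (0 <= (P v)%:E)%E by rewrite lee_fin.
have inner z : ((normc (cint (B ^~ z)))%:E <= (2 * K0)%:E * \int[leb R n]_y (P (z, y))%:E)%E.
  rewrite S3; apply: le_trans (normc_cint _) _.
    apply: (cmfunM (Vi z).1).
    exact: (cmfun_cint (F := fun y eta => A eta z * cexpi (2 * pi * dotp y (z - eta)))).
  rewrite EFinM -muleA; apply: lee_wpmul2l => //.
  rewrite -ge0_integralZl_EFin//; last exact: (measurableT_comp mPE (measurable_pair1 z)).
  apply: ge0_le_integral_nm => y; first by rewrite lee_fin normc_ge0.
  rewrite -EFinM lee_fin Normc.normcM mulrCA ler_wpM2l ?normc_ge0//.
  exact: HK.
have final : ((k * normc (cint E))%:E <= (4 * K0)%:E * \int[leb R n]_z \int[leb R n]_y (P (z, y))%:E)%E.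
  rewrite (_ : k * normc (cint E) = normc (RtoC k * cint E)); last first.
    by rewrite Normc.normcM normc_RtoC ger0_norm// ltW.
  rewrite S4; apply: le_trans (normc_cint _) _.
    apply: (cmfun_cint (F := fun z eta => B eta z)).
    apply: (cmfun_comp mB (g := fun v : 'rV[R]_n * 'rV[R]_n => (v.2, v.1))).
    exact: measurable_fun_pair.
  rewrite (_ : 4 * K0 = 2 * (2 * K0)); last by ring.
  rewrite EFinM -muleA; apply: lee_wpmul2l => //.
  rewrite -ge0_integralZl_EFin//; last 3 first.
  - by move=> z _; apply: integral_ge0 => y _.
  - exact: (measurable_fun_fubini_tonelli_F _ mPE P0E).
  - by rewrite mulr_ge0.
  by apply: ge0_le_integral_nm => z //; rewrite lee_fin normc_ge0.
rewrite (_ : normc _ = k^-1 * (k * normc (cint E))); last by rewrite mulKf// gt_eqF.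
rewrite !(EFinM k^-1) -muleA; apply: lee_wpmul2l => //.
by rewrite lee_fin invr_ge0 ltW.
Qed.
End stft_convolution.

(** * Mixed quasi-norms and convolution *)
Section mixed_norms.
Variable R : realType.

(** Young's inequality for the product of h / c and 1 with exponent Q and its conjugate, multiplied
    by c. For Q = 1 the conjugate exponent is infinite, so that case is separate. *)
Lemma young_scaled (Q h c : R) : 1 <= Q -> 0 <= h -> 0 < c ->
  h <= (1 - Q^-1) * c + Q^-1 * (c `^ (1 - Q) * h `^ Q).
Proof.
move=> Q1 h0 c0; have Q0 : 0 < Q by exact: lt_le_trans Q1.
have [->|Qn1] := eqVneq Q 1.
  by rewrite invr1 !subrr mul0r add0r mul1r powRr0 mul1r powRr1.
have Qgt1 : 1 < Q by rewrite lt_neqAle eq_sym Qn1.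
have Qi : 0 < 1 - Q^-1 by rewrite subr_gt0 invf_lt1.
have := @conjugate_powR R (h / c) 1 Q (1 - Q^-1)^-1.
rewrite divr_ge0 ?(ltW c0)// => /(_ isT ler01 Q0).
rewrite invr_gt0 => /(_ Qi); rewrite invrK addrC subrK => /(_ erefl).
rewrite mulr1 powR1 mul1r => H.
have E : c * (h / c) `^ Q = c `^ (1 - Q) * h `^ Q.
  rewrite powRM ?invr_ge0 ?(ltW c0)// -(powR_inv1 (ltW c0)) -powRrM mulN1r.
  by rewrite -{1}(powRr1 (ltW c0)) mulrCA -powRD ?(gt_eqF c0) ?implybT// mulrC.
rewrite -E -[leLHS](divfK (lt0r_neq0 c0)) mulrC.
apply: le_trans (ler_wpM2l (ltW c0) H) _; rewrite le_eqVlt; apply/orP; left; apply/eqP.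
by move: (_ `^ _) (Q^-1) => a b; ring.
Qed.

(** Hoelder's inequality for the measure of density u b, with an upper bound G for its mass in place
    of normalization; [young_scaled] is integrated at the scale t b. *)
Lemma jensen_scaled d (T : measurableType d) (mu : {measure set T -> \bar R})
    (u h b : T -> R) (Q G J : R) : 1 <= Q -> 0 < G ->
  measurable_fun setT u -> measurable_fun setT h -> measurable_fun setT b ->
  (forall x, 0 <= u x) -> (forall x, 0 <= h x) -> (forall x, 0 < b x) ->
  (\int[mu]_x (u x * h x)%:E = J%:E)%E -> (\int[mu]_x (u x * b x)%:E <= G%:E)%E ->
  ((J `^ Q)%:E <= (G `^ (Q - 1))%:E * \int[mu]_x (u x * (b x `^ (1 - Q) * h x `^ Q))%:E)%E.
Proof.
move=> Q1 G0 mu' mh mb u0 h0 b0 JE bG.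
have Q0 : 0 < Q by exact: lt_le_trans Q1.
have Qi : 0 <= Q^-1 by rewrite invr_ge0 ltW.
have Qi' : 0 <= 1 - Q^-1 by rewrite subr_ge0 invf_le1.
have J0 : 0 <= J by rewrite -lee_fin -JE; apply: integral_ge0 => x _; rewrite lee_fin mulr_ge0.
have X0 : (0 <= \int[mu]_x (u x * (b x `^ (1 - Q) * h x `^ Q))%:E)%E.
  by apply: integral_ge0 => x _; rewrite lee_fin !mulr_ge0 ?powR_ge0.
have [J00|Jn0] := eqVneq J 0.
  by rewrite J00 powR0 ?gt_eqF//; apply: mule_ge0; rewrite // lee_fin powR_ge0.
have {Jn0}J0 : 0 < J by rewrite lt_neqAle eq_sym Jn0.
pose X := (\int[mu]_x (u x * (b x `^ (1 - Q) * h x `^ Q))%:E)%E.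
rewrite -/X in X0 *.
have [Xoo|] := eqVneq X +oo%E; first by rewrite Xoo gt0_muley ?leey// lte_fin powR_gt0.
rewrite -ltey => Xoo.
have /fineK XE : X \is a fin_num by rewrite ge0_fin_numE.
set x := fine X in XE.
(* The optimal scale: the first Young term integrates to at most (1 - 1/Q) J and is absorbed on the
   left. *)
pose t := J / G.
have t0 : 0 < t by rewrite divr_gt0.
have mub : measurable_fun setT (fun y => (u y * b y)%:E) by apply/measurable_EFinP; exact: measurable_funM.
have mX : measurable_fun setT (fun y => (u y * (b y `^ (1 - Q) * h y `^ Q))%:E).
  apply/measurable_EFinP; apply: measurable_funM => //; apply: measurable_funM.
    exact: (measurableT_comp (measurable_powR _) mb).
  exact: (measurableT_comp (measurable_powR _) mh).
have ub0 y : (0 <= (u y * b y)%:E)%E by rewrite lee_fin mulr_ge0// ltW.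
have X0' y : (0 <= (u y * (b y `^ (1 - Q) * h y `^ Q))%:E)%E by rewrite lee_fin !mulr_ge0 ?powR_ge0.
have c10 : 0 <= (1 - Q^-1) * t by rewrite mulr_ge0// ltW.
have c20 : 0 <= Q^-1 * t `^ (1 - Q) by rewrite mulr_ge0// powR_ge0.
have : (J%:E <= ((1 - Q^-1) * t)%:E * G%:E + (Q^-1 * t `^ (1 - Q))%:E * x%:E)%E.
  rewrite -JE.
  apply: (@le_trans _ _ (\int[mu]_y (((1 - Q^-1) * t)%:E * (u y * b y)%:E +
      (Q^-1 * t `^ (1 - Q))%:E * (u y * (b y `^ (1 - Q) * h y `^ Q))%:E))%E).
    apply: ge0_le_integral_nm => y; first by rewrite lee_fin mulr_ge0.
    rewrite -!EFinM -EFinD lee_fin.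
    have bt : 0 < b y * t by rewrite mulr_gt0.
    have := young_scaled Q1 (h0 y) bt; rewrite powRM ?(ltW t0) ?(ltW (b0 y))// => H.
    apply: le_trans (ler_wpM2l (u0 y) H) _; rewrite le_eqVlt; apply/orP; left; apply/eqP.
    by move: (b y) (u y) (Q^-1) (b y `^ _) (t `^ _) (h y `^ _) => a1 a2 a3 a4 a5 a6; ring.
  rewrite ge0_integralD//; last 4 first.
  - by move=> y _; apply: mule_ge0.
  - by apply: emeasurable_funM.
  - by move=> y _; apply: mule_ge0.
  - by apply: emeasurable_funM.
  rewrite (ge0_integralZl_EFin _ measurableT (fun y _ => ub0 y) mub c10).
  rewrite (ge0_integralZl_EFin _ measurableT (fun y _ => X0' y) mX c20) -/X -XE.
  by rewrite leeD2r// lee_wpmul2l.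
rewrite -!EFinM -EFinD lee_fin /t -[X in X <= _]mul1r => H.
have {}H : J <= t `^ (1 - Q) * x.
  have : Q^-1 * J <= Q^-1 * (t `^ (1 - Q) * x).
    move: H; rewrite -/t (_ : (1 - Q^-1) * t * G = (1 - Q^-1) * J); last by rewrite /t mulrA divfK ?gt_eqF.
    rewrite -(mulrA Q^-1); move: (t `^ _ * x) => a; rewrite mul1r; lra.
  by rewrite ler_pM2l// invr_gt0.
rewrite -XE -EFinM lee_fin.
have -> : J `^ Q = J * J `^ (Q - 1).
  by rewrite -{2}(powRr1 (ltW J0)) -powRD ?(gt_eqF J0) ?implybT//; congr (_ `^ _); ring.
have E : G `^ (Q - 1) = t `^ (1 - Q) * J `^ (Q - 1).
  rewrite -(opprB Q) powRN; apply: (mulIf (lt0r_neq0 (powR_gt0 (Q - 1) t0))).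
  rewrite mulrAC mulVf ?gt_eqF ?powR_gt0// mul1r -powRM ?(ltW G0) ?(ltW t0)//; congr (_ `^ _).
  by rewrite /t mulrC divfK// gt_eqF.
by rewrite E mulrAC ler_wpM2r ?powR_ge0.
Qed.

(** The infimum defining the essential supremum is attained, because the exceptional set is a
    countable union over the levels c + 1/(k+1). *)
Lemma esssupn_null n (h : 'rV[R]_n -> R) (c : R) : measurable_fun setT h ->
  (esssupn (fun x => (h x)%:E) <= c%:E)%E -> leb R n [set x | c < h x] = 0%E.
Proof.
move=> mh hc.
have mS (t : R) : measurable [set x | t < h x].
  have := mh measurableT _ (@measurable_itv R `]t, +oo[); rewrite setTI.
  by rewrite (_ : _ @^-1` _ = [set x | t < h x])//; apply/seteqP; split => x /=; rewrite in_itv/= andbT.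
have -> : [set x | c < h x] = \bigcup_k [set x | c + k.+1%:R^-1 < h x].
  apply/seteqP; split => x /=; last first.
    by move=> [k _] /=; apply: lt_trans; rewrite ltrDl.
  rewrite -subr_gt0 => ch; exists (Num.bound (h x - c)^-1) => //=.
  rewrite -ltrBrDl; have hi : 0 < (h x - c)^-1 by rewrite invr_gt0.
  rewrite invf_plt ?posrE//; apply: lt_le_trans (archi_boundP (ltW hi)) _.
  by rewrite ler_nat.
apply: measure_negligible; first exact: bigcup_measurable.
apply: negligible_bigcup => k; exists [set x | c + k.+1%:R^-1 < h x]; split => //.
apply: nulln_leb => //; have := @esssupn_lt R n (fun x => (h x)%:E) (c + k.+1%:R^-1).
by apply; apply: le_lt_trans hc _; rewrite lte_fin ltrDl.
Qed.

Lemma esssupn_le n (g : 'rV[R]_n -> \bar R) (c : \bar R) : (forall x, (g x <= c)%E) -> (esssupn g <= c)%E.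
Proof.
move=> gc; apply: ereal_inf_lbound => /=; rewrite /nulln.
rewrite (_ : (fun x => _) = cst 0%E).
  by rewrite iintE//= integral0.
apply/funext => x; rewrite indicE memNset//= => H.
by have := lt_le_trans H (gc x); rewrite ltxx.
Qed.

(** A negative level would make the whole space null, against [ball_not_null]. *)
Lemma esssupn_ge0 n (h : 'rV[R]_n -> R) : (forall x, 0 <= h x) -> (0 <= esssupn (fun x => (h x)%:E))%E.
Proof.
move=> h0; apply: le_ereal_inf_tmp => t /= t0; rewrite leNgt; apply/negP => t0'.
apply: (@ball_not_null R n 0); apply: nulln_le t0 => x _ /=.
by apply: lt_le_trans t0' _; rewrite lee_fin.
Qed.
End mixed_norms.

(** * The product measure as a sigma-finite measure *)

Section product_measure.
Context d d' (T : measurableType d) (T' : measurableType d') (R : realType).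
Variables (m1 : {sigma_finite_measure set T -> \bar R}) (m2 : {sigma_finite_measure set T' -> \bar R}).

(** A name for the product to which a sigma-finite structure can be attached, so that it can itself
    be a factor in Tonelli's theorem. *)
Definition prodm : set (T * T') -> \bar R := (m1 \x m2)%E.
HB.instance Definition _ := Measure.on prodm.

Let prodm_sigma_finite : sigma_finite setT prodm.
Proof.
have /sigma_finiteP [F [F_T F_nd F_oo]] := sigma_finiteT m1.
have /sigma_finiteP [G [G_T G_nd G_oo]] := sigma_finiteT m2.
exists (fun k => F k `*` G k).
  rewrite predeqE => x; split => // _.
  have [k _ Fk] : (\bigcup_k F k) x.1 by rewrite -F_T.
  have [l _ Gl] : (\bigcup_k G k) x.2 by rewrite -G_T.
  exists (maxn k l) => //; split.
    by move: (Fk); apply/subsetPset/F_nd/leq_maxl.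
  by move: (Gl); apply/subsetPset/G_nd/leq_maxr.
move=> k; have [mF Foo] := F_oo k; have [mG Goo] := G_oo k.
split; first exact: measurableX.
by rewrite /prodm product_measure1E// lte_mul_pinfty// ge0_fin_numE.
Qed.

HB.instance Definition _ := Measure_isSigmaFinite.Build _ _ _ prodm prodm_sigma_finite.

Lemma integral_prodm (f : T * T' -> \bar R) : measurable_fun setT f -> (forall w, (0 <= f w)%E) ->
  (\int[prodm]_w f w = \int[m1]_x \int[m2]_y f (x, y))%E.
Proof. exact: fubini_tonelli1. Qed.
End product_measure.

(** * Minkowski and Young inequalities for one variable of a mixed norm *)

Section convolution_bound.
Variables (R : realType) (m n : nat).
(** The setting: T^r is dominated by H^r integrated against kx in the first variable and convolved
    with k in the second. N is to be the norm of H in its second variable, and X the integral of kx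
    N^r. The section is used with m = n for the inner norm at a fixed point and with m = 0 for the
    outer norm. *)
Variables (r A I B X : R) (kx : 'rV[R]_m -> R) (k : 'rV[R]_n -> R).
Variables (H : 'rV[R]_m * 'rV[R]_n -> R) (N : 'rV[R]_m -> R) (T : 'rV[R]_n -> R).
Hypotheses (r0 : 0 < r) (mkx : measurable_fun setT kx) (kx0 : forall y, 0 <= kx y).
Hypothesis kxA : (\int[leb R m]_y (kx y)%:E = A%:E)%E.
Hypotheses (mk : measurable_fun setT k) (k0 : forall z, 0 <= k z).
Hypothesis kI : (\int[leb R n]_z (k z)%:E = I%:E)%E.
Hypotheses (mH : measurable_fun setT H) (H0 : forall w, 0 <= H w) (HB : forall w, H w <= B).
Hypotheses (mN : measurable_fun setT N) (N0 : forall y, 0 <= N y).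
Hypothesis NX : (\int[leb R m]_y (kx y * N y `^ r)%:E = X%:E)%E.
Hypothesis T0 : forall z, 0 <= T z.
Let nu : {sigma_finite_measure set ('rV[R]_m * 'rV[R]_n)%type -> \bar R} := prodm (leb R m) (leb R n).
Hypothesis HT : forall z, ((T z `^ r)%:E <= \int[nu]_w (kx w.1 * k (z - w.2) * H w `^ r)%:E)%E.

Lemma A_ge0 : 0 <= A.
Proof. by rewrite -lee_fin -kxA; apply: integral_ge0 => y _; rewrite lee_fin. Qed.

Lemma I_ge0 : 0 <= I.
Proof. by rewrite -lee_fin -kI; apply: integral_ge0 => y _; rewrite lee_fin. Qed.

Lemma X_ge0 : 0 <= X.
Proof. by rewrite -lee_fin -NX; apply: integral_ge0 => y _; rewrite lee_fin mulr_ge0 ?powR_ge0. Qed.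

Lemma integral_kB z : (\int[leb R n]_u (k (z - u))%:E = I%:E)%E.
Proof.
rewrite (@integral_rVB R n z (fun u => (k u)%:E))//; exact/measurable_EFinP.
Qed.

Lemma integral_kD z : (\int[leb R n]_u (k (u - z))%:E = I%:E)%E.
Proof.
rewrite (@integral_rVD R n (- z) (fun u => (k u)%:E))//; exact/measurable_EFinP.
Qed.

Lemma measurable_kB d (S : measurableType d) (f g : S -> 'rV[R]_n) :
  measurable_fun setT f -> measurable_fun setT g -> measurable_fun setT (fun t => k (f t - g t)).
Proof. by move=> mf mg; apply: (measurableT_comp mk); exact: measurable_rVsub. Qed.

Lemma integral_nu_fst z (g : 'rV[R]_m -> R) : measurable_fun setT g -> (forall y, 0 <= g y) ->
  (\int[nu]_w (kx w.1 * k (z - w.2) * g w.1)%:E = I%:E * \int[leb R m]_y (kx y * g y)%:E)%E.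
Proof.
move=> mg g0.
have mF : measurable_fun setT (fun w : 'rV[R]_m * 'rV[R]_n => (kx w.1 * k (z - w.2) * g w.1)%:E).
  apply/measurable_EFinP; apply: measurable_funM; last exact: (measurableT_comp mg measurable_fst).
  apply: measurable_funM; first exact: (measurableT_comp mkx measurable_fst).
  exact: measurable_kB.
have F0 (w : 'rV[R]_m * 'rV[R]_n) : (0 <= (kx w.1 * k (z - w.2) * g w.1)%:E)%E.
  by rewrite lee_fin !mulr_ge0.
rewrite (integral_prodm (leb R m) (leb R n) mF F0) /=.
rewrite -ge0_integralZl_EFin//; last 3 first.
- by move=> y _; rewrite lee_fin mulr_ge0.
- by apply/measurable_EFinP; exact: measurable_funM.
- exact: I_ge0.
apply: eq_integral => y _; under eq_integral do rewrite mulrAC EFinM.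
rewrite ge0_integralZl_EFin//; last 3 first.
- by move=> u _; rewrite lee_fin.
- by apply/measurable_EFinP; exact: measurable_kB.
- by rewrite mulr_ge0.
by rewrite integral_kB muleC.
Qed.

(** For fixed y, H (y, u) is at most N y for almost every u, and integrating k in u gives I. *)
Lemma Lpn_conv_oo : (forall y, Lpn +oo%E (fun z => (H (y, z))%:E) = (N y)%:E) ->
  (Lpn +oo%E (fun z => (T z)%:E) <= ((I * X) `^ r^-1)%:E)%E.
Proof.
rewrite /Lpn eqxx => HN; apply: esssupn_le => z; rewrite lee_fin.
have -> : T z = (T z `^ r) `^ r^-1 by rewrite -powRrM divff ?gt_eqF// powRr1.
apply: ge0_ler_powR; rewrite ?nnegrE ?powR_ge0 ?mulr_ge0 ?I_ge0 ?X_ge0 ?invr_ge0 ?(ltW r0)//.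
rewrite -lee_fin; apply: le_trans (HT z) _.
have mF : measurable_fun setT (fun w : 'rV[R]_m * 'rV[R]_n => (kx w.1 * k (z - w.2) * H w `^ r)%:E).
  apply/measurable_EFinP; apply: measurable_funM; last exact: (measurableT_comp (measurable_powR _) mH).
  apply: measurable_funM; first exact: (measurableT_comp mkx measurable_fst).
  exact: measurable_kB.
have F0 (w : 'rV[R]_m * 'rV[R]_n) : (0 <= (kx w.1 * k (z - w.2) * H w `^ r)%:E)%E.
  by rewrite lee_fin !mulr_ge0 ?powR_ge0.
rewrite (integral_prodm (leb R m) (leb R n) mF F0) /= EFinM -NX -ge0_integralZl_EFin//; last 3 first.
- by move=> y _; rewrite lee_fin mulr_ge0 ?powR_ge0.
- apply/measurable_EFinP; apply: measurable_funM => //; exact: (measurableT_comp (measurable_powR _) mN).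
- exact: I_ge0.
apply: ge0_le_integral_nm => y; first by apply: integral_ge0 => u _; exact: F0 (y, u).
have mHy : measurable_fun setT (fun u => H (y, u)) by exact: (measurableT_comp mH (measurable_pair1 y)).
have null : leb R n [set u | N y < H (y, u)] = 0%E.
  by apply: esssupn_null => //; rewrite HN.
have mS : measurable [set u | N y < H (y, u)].
  have := mHy measurableT _ (@measurable_itv R `]N y, +oo[); rewrite setTI.
  by rewrite (_ : _ @^-1` _ = [set u | N y < H (y, u)])//; apply/seteqP; split => u /=; rewrite in_itv/= andbT.
apply: (@le_trans _ _ (\int[leb R n]_u ((kx y * N y `^ r)%:E * (k (z - u))%:E))%E).
  apply: ae_ge0_le_integral => //.
  - by move=> u _; exact: F0 (y, u).
  - exact: (measurableT_comp mF (measurable_pair1 y)).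
  - by move=> u _; rewrite -EFinM lee_fin !mulr_ge0 ?powR_ge0.
  - by apply: emeasurable_funM => //; apply/measurable_EFinP; exact: measurable_kB.
  exists [set u | N y < H (y, u)]; split => // u /= nu_; rewrite ltNge; apply/negP => HNu; apply: nu_ => _.
  rewrite -EFinM lee_fin mulrAC ler_wpM2r// ler_wpM2l//.
  by apply: ge0_ler_powR; rewrite ?nnegrE ?(ltW r0).
rewrite ge0_integralZl_EFin//; last 3 first.
- by move=> u _; rewrite lee_fin.
- by apply/measurable_EFinP; exact: measurable_kB.
- by rewrite mulr_ge0 ?powR_ge0.
by rewrite integral_kB muleC.
Qed.

Lemma poweR_inj (q x : R) (Y : \bar R) : 0 < q -> 0 <= x -> (0 <= Y)%E ->
  (Y `^ q^-1 = x%:E)%E -> Y = (x `^ q)%:E.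
Proof.
move=> q0 x0; have qi : q^-1 != 0 by rewrite gt_eqF ?invr_gt0.
case: Y => [y| |]//; last by rewrite poweRyr.
rewrite lee_fin poweR_EFin => y0 [<-].
by rewrite -powRrM mulVf ?gt_eqF// powRr1.
Qed.

(** Both inequalities for the exponent Q = q / r in one step: Jensen is applied with the density b =
    N^r + e, which is the inner L^Q norm of H^r up to e. Integrating b^(1 - Q) H^q in the second
    variable gives at most b again, so the integral is bounded by G and the total by G^(Q - 1) G. *)
Lemma conv_iint_le (q e : R) : r <= q -> 0 < e ->
  (forall y, Lpn q%:E (fun z => (H (y, z))%:E) = (N y)%:E) ->
  (iint (fun z => (T z `^ q)%:E) <= ((I * (X + e * A) + e) `^ (q / r))%:E)%E.
Proof.
move=> rq e0 HN.
have q0 : 0 < q by exact: lt_le_trans rq.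
pose Q := q / r.
have Q1 : 1 <= Q by rewrite ler_pdivlMr// mul1r.
have Q0 : 0 < Q by exact: lt_le_trans Q1.
have I0 := I_ge0; have X0 := X_ge0; have A0 := A_ge0.
pose G := I * (X + e * A) + e.
have G0 : 0 < G by rewrite ltr_wpDl// mulr_ge0// addr_ge0// mulr_ge0// ltW.
(* The summand e keeps the density positive where N vanishes. *)
pose b (w : 'rV[R]_m) := N w `^ r + e.
have b0 y : 0 < b y by rewrite ltr_wpDl// powR_ge0.
have mNr : measurable_fun setT (fun y => N y `^ r) by exact: (measurableT_comp (measurable_powR _) mN).
have mb : measurable_fun setT b by apply: measurable_funD => //; exact: measurable_cst.
have kxb : (\int[leb R m]_y (kx y * b y)%:E = (X + e * A)%:E)%E.
  under eq_integral do rewrite mulrDr (mulrC _ e) EFinD (EFinM e).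
  rewrite ge0_integralD//; last 4 first.
  - by move=> y _; rewrite lee_fin mulr_ge0 ?powR_ge0.
  - by apply/measurable_EFinP; exact: measurable_funM.
  - by move=> y _; rewrite -EFinM lee_fin mulr_ge0// ltW.
  - by apply: emeasurable_funM => //; exact/measurable_EFinP.
  rewrite NX (ge0_integralZl_EFin _ measurableT _ _ (ltW e0)) ?kxA//.
    by move=> y _; rewrite lee_fin.
  exact/measurable_EFinP.
pose h w := H w `^ r.
have mh : measurable_fun setT h by exact: (measurableT_comp (measurable_powR _) mH).
have h0 w : 0 <= h w by exact: powR_ge0.
pose u z (w : 'rV[R]_m * 'rV[R]_n) := kx w.1 * k (z - w.2).
have mu_ z : measurable_fun setT (u z).
  apply: measurable_funM; first exact: (measurableT_comp mkx measurable_fst).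
  exact: measurable_kB.
have u0 z w : 0 <= u z w by rewrite mulr_ge0.
have ub z : (\int[nu]_w (u z w * b w.1)%:E <= G%:E)%E.
  rewrite integral_nu_fst//; last by move=> y; exact: ltW.
  by rewrite kxb -EFinM lee_fin lerDl ltW.
have B0 : 0 <= B by apply: le_trans (HB (0, 0)).
(* The bound B on H makes J a real number, as [jensen_scaled] requires. *)
have uhoo z : (\int[nu]_w (u z w * h w)%:E < +oo)%E.
  apply: (@le_lt_trans _ _ (\int[nu]_w (u z w * cst (B `^ r) w.1)%:E)%E).
    apply: ge0_le_integral_nm => w; first by rewrite lee_fin mulr_ge0.
    by rewrite lee_fin ler_wpM2l//; apply: ge0_ler_powR; rewrite ?nnegrE ?(ltW r0).
  rewrite integral_nu_fst; [|exact: measurable_cst|by move=> y; exact: powR_ge0].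
  under eq_integral do rewrite mulrC EFinM.
  rewrite ge0_integralZl_EFin//; last 3 first.
  - by move=> y _; rewrite lee_fin.
  - exact/measurable_EFinP.
  - exact: powR_ge0.
  by rewrite kxA -!EFinM ltry.
pose J z := fine (\int[nu]_w (u z w * h w)%:E).
have uh0 z : (0 <= \int[nu]_w (u z w * h w)%:E)%E.
  by apply: integral_ge0 => w _; rewrite lee_fin mulr_ge0.
have JE z : (\int[nu]_w (u z w * h w)%:E = (J z)%:E)%E by rewrite fineK// ge0_fin_numE.
pose c (w : 'rV[R]_m * 'rV[R]_n) := b w.1 `^ (1 - Q) * h w `^ Q.
have c0 w : 0 <= c w by rewrite mulr_ge0 ?powR_ge0.
have mb1 : measurable_fun setT (fun w : 'rV[R]_m * 'rV[R]_n => b w.1) by exact: (measurableT_comp mb measurable_fst).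
have mc : measurable_fun setT c.
  apply: measurable_funM; first exact: (measurableT_comp (measurable_powR _) mb1).
  exact: (measurableT_comp (measurable_powR _) mh).
have TJ z : ((T z `^ q)%:E <= (G `^ (Q - 1))%:E * \int[nu]_w (u z w * c w)%:E)%E.
  apply: (@le_trans _ _ ((J z `^ Q)%:E)).
    have -> : q = r * Q by rewrite /Q mulrC divfK// gt_eqF.
    rewrite powRrM lee_fin; apply: ge0_ler_powR; rewrite ?nnegrE ?powR_ge0 ?(ltW Q0)//.
      by rewrite fine_ge0.
    by rewrite -lee_fin -JE; exact: HT.
  exact: (jensen_scaled Q1 G0 (mu_ z) mh mb1 (u0 z) h0 (fun w => b0 w.1) (JE z) (ub z)).
apply: (@le_trans _ _ (iint (fun z => (G `^ (Q - 1))%:E * \int[nu]_w (u z w * c w)%:E)%E)).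
  by apply: le_iint => z //; rewrite lee_fin powR_ge0.
have mF : measurable_fun setT (fun v : 'rV[R]_n * ('rV[R]_m * 'rV[R]_n) => (u v.1 v.2 * c v.2)%:E).
  apply/measurable_EFinP; apply: measurable_funM; last exact: (measurableT_comp mc measurable_snd).
  apply: measurable_funM.
    exact: (measurableT_comp mkx (measurableT_comp measurable_fst measurable_snd)).
  by apply: measurable_kB => //; exact: (measurableT_comp measurable_snd measurable_snd).
have F0 (v : 'rV[R]_n * ('rV[R]_m * 'rV[R]_n)) : (0 <= (u v.1 v.2 * c v.2)%:E)%E.
  by rewrite lee_fin mulr_ge0.
have mFF : measurable_fun setT (fun z => \int[nu]_w (u z w * c w)%:E)%E.
  exact: (measurable_fun_fubini_tonelli_F _ mF F0).
have FF0 z : (0 <= \int[nu]_w (u z w * c w)%:E)%E by apply: integral_ge0 => w _; exact: F0 (z, w).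
have G10 : 0 <= G `^ (Q - 1) by exact: powR_ge0.
rewrite iintE; last 2 first.
- by apply: emeasurable_funM.
- by move=> z; apply: mule_ge0.
rewrite ge0_integralZl_EFin//.
suff : (\int[leb R n]_z \int[nu]_w (u z w * c w)%:E <= G%:E)%E.
  move=> /(lee_wpmul2l (_ : (0 <= (G `^ (Q - 1))%:E)%E)) => /(_ (powR_ge0 _ _))/le_trans; apply.
  rewrite -EFinM lee_fin -{2}(powRr1 (ltW G0)) -powRD ?(gt_eqF G0) ?implybT//.
  by rewrite subrK.
rewrite (fubini_tonelli _ mF F0)/=.
under eq_integral => w _.
  under eq_integral do rewrite /u mulrAC EFinM.
  rewrite ge0_integralZl_EFin//; last 3 first.
  - by move=> z _; rewrite lee_fin.
  - by apply/measurable_EFinP; exact: measurable_kB.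
  - by rewrite mulr_ge0.
  rewrite integral_kD muleC.
  over.
have mkc : measurable_fun setT (fun w : 'rV[R]_m * 'rV[R]_n => (kx w.1 * c w)%:E).
  apply/measurable_EFinP; apply: measurable_funM => //.
  exact: (measurableT_comp mkx measurable_fst).
have kc0 (w : 'rV[R]_m * 'rV[R]_n) : (0 <= (kx w.1 * c w)%:E)%E by rewrite lee_fin mulr_ge0.
rewrite ge0_integralZl_EFin// (integral_prodm (leb R m) (leb R n) mkc kc0)/=.
apply: (@le_trans _ _ (I%:E * (X + e * A)%:E)%E); last by rewrite -EFinM lee_fin lerDl ltW.
apply: lee_wpmul2l => //; rewrite -kxb.
apply: ge0_le_integral_nm => y; first by apply: integral_ge0 => z _; exact: kc0 (y, z).
rewrite /c /=.
under eq_integral do rewrite mulrA EFinM.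
have mhy : measurable_fun setT (fun z => (H (y, z) `^ q)%:E).
  by apply/measurable_EFinP; apply: (measurableT_comp (measurable_powR _)); exact: (measurableT_comp mH (measurable_pair1 y)).
have hE z : h (y, z) `^ Q = H (y, z) `^ q.
  by rewrite /h -powRrM /Q mulrC divfK// gt_eqF.
under eq_integral do rewrite hE.
rewrite ge0_integralZl_EFin//; last 2 first.
- by move=> z _; rewrite lee_fin powR_ge0.
- by rewrite mulr_ge0 ?powR_ge0.
have -> : (\int[leb R n]_z (H (y, z) `^ q)%:E = (N y `^ q)%:E)%E.
  rewrite -iintE//; last by move=> z; rewrite lee_fin powR_ge0.
  apply: poweR_inj => //; first by apply: iint_ge0 => z; rewrite lee_fin powR_ge0.
  by rewrite -HN.
rewrite -EFinM lee_fin -mulrA ler_wpM2l//.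
have bE : b y = b y `^ (1 - Q) * b y `^ Q.
  by rewrite -powRD ?(gt_eqF (b0 y)) ?implybT// subrK powRr1// ltW.
rewrite {2}bE ler_wpM2l ?powR_ge0// (_ : q = r * Q); last by rewrite /Q mulrC divfK// gt_eqF.
rewrite powRrM; apply: ge0_ler_powR; rewrite ?nnegrE ?powR_ge0 ?(ltW Q0) ?(ltW (b0 y))//.
by rewrite /b lerDl ltW.
Qed.

(** For finite q, the auxiliary e of [conv_iint_le] is sent to 0. *)
Lemma Lpn_conv (q : \bar R) : (r%:E <= q)%E ->
  (forall y, Lpn q (fun z => (H (y, z))%:E) = (N y)%:E) ->
  (Lpn q (fun z => (T z)%:E) <= ((I * X) `^ r^-1)%:E)%E.
Proof.
case: q => [q rq HN| _ |//]; last exact: Lpn_conv_oo.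
rewrite lee_fin in rq; have q0 : 0 < q by exact: lt_le_trans rq.
rewrite /Lpn /=.
have Le e (e0 : 0 < e) := conv_iint_le rq e0 HN.
have L0 : (0 <= iint (fun z => (T z `^ q)%:E))%E by apply: iint_ge0 => z; rewrite lee_fin powR_ge0.
have Lfin : iint (fun z => (T z `^ q)%:E) \is a fin_num.
  by rewrite ge0_fin_numE//; apply: le_lt_trans (Le 1 ltr01) _; rewrite ltry.
rewrite -(fineK Lfin) poweR_EFin lee_fin.
move: L0 Le; rewrite -(fineK Lfin); move: (fine _) => L; rewrite lee_fin => L0 Le.
have I0 := I_ge0; have X0 := X_ge0; have A0 := A_ge0.
have -> : q^-1 = (q / r)^-1 * r^-1 by rewrite invf_div mulrAC divff ?gt_eqF// mul1r.
rewrite powRrM; apply: ge0_ler_powR; rewrite ?nnegrE ?powR_ge0 ?invr_ge0 ?mulr_ge0 ?(ltW r0)//.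
apply/ler_addgt0Pr => e e0.
have IA : 0 < I * A + 1 by rewrite ltr_wpDl// mulr_ge0.
(* Scaled so that the base of the power in [conv_iint_le] becomes exactly I X + e. *)
have e0' : 0 < e / (I * A + 1) by rewrite divr_gt0.
have := Le _ e0'; rewrite lee_fin => H1.
rewrite (_ : I * X + e = I * (X + e / (I * A + 1) * A) + e / (I * A + 1)); last by field; rewrite gt_eqF.
have qr0 : 0 < q / r by rewrite divr_gt0.
set G := _ + _ in H1 *.
have G0 : 0 <= G.
  apply: addr_ge0; last exact: ltW.
  by apply: mulr_ge0 => //; apply: addr_ge0 => //; apply: mulr_ge0 => //; exact: ltW.
rewrite -[leRHS](powRr1 G0) -(divff (lt0r_neq0 qr0)) powRrM.
by apply: ge0_ler_powR; rewrite ?nnegrE ?powR_ge0 ?invr_ge0 ?(ltW qr0).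
Qed.

End convolution_bound.

(** * Pointwise bound on r-th powers *)

Section reproducing_power.
Variables (R : realType) (n : nat).

Lemma jbr_powR_mul_le (a : R) (x y : 'rV[R]_n) : 0 <= a ->
  jbr x `^ (- a) * jbr y `^ (- a) <= 2 `^ a * jbr (x + y) `^ (- a).
Proof.
move=> a0; have x0 := jbr_gt0 x; have y0 := jbr_gt0 y; have xy0 := jbr_gt0 (x + y).
rewrite !powRN -invfM -powRM ?(ltW x0) ?(ltW y0)//.
rewrite ler_pdivlMr ?powR_gt0// mulrC ler_pdivrMr ?powR_gt0 ?mulr_gt0// -powRM ?mulr_ge0 ?(ltW x0) ?(ltW y0)//.
by apply: ge0_ler_powR; rewrite ?nnegrE ?mulr_ge0 ?(ltW x0) ?(ltW y0) ?(ltW xy0)// jbrD_prod.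
Qed.

Lemma powR_split (x r : R) : 0 <= x -> 0 < r -> x = x `^ (1 - r) * x `^ r.
Proof.
rewrite le_eqVlt => /orP[/eqP <- r0|x0 _]; first by rewrite (powR0 (lt0r_neq0 r0)) mulr0.
by rewrite -powRD ?(gt_eqF x0) ?implybT// subrK powRr1// ltW.
Qed.

(** Cancelling M^(1 - r), for positive M, yields M^r <= K' J. Substituted in the bound on T this
    leaves J to the power (1 - r)/r + 1 = 1/r, whose r-th power is J. *)
Lemma self_improve (r K K' M J T : R) : 0 < r -> r <= 1 -> 0 <= K -> 0 <= K' ->
  0 <= M -> 0 <= J -> 0 <= T -> M <= K' * (M `^ (1 - r) * J) -> T <= K * (M `^ (1 - r) * J) ->
  T `^ r <= K `^ r * K' `^ (1 - r) * J.
Proof.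
move=> r0 r1 K0 K'0 M0 J0 T0 MJ TJ.
have r1' : 0 <= 1 - r by rewrite subr_ge0.
have Mr : M `^ r <= K' * J.
  move: MJ; have [->|Mn0] := eqVneq M 0; first by move=> _; rewrite (powR0 (lt0r_neq0 r0)); exact: mulr_ge0.
  have {Mn0} {}M0 : 0 < M by rewrite lt_neqAle eq_sym Mn0.
  by rewrite {1}(powR_split (ltW M0) r0) mulrCA ler_pM2l// powR_gt0.
have M1r : M `^ (1 - r) <= (K' * J) `^ ((1 - r) / r).
  have -> : M `^ (1 - r) = (M `^ r) `^ ((1 - r) / r).
    by rewrite -powRrM mulrCA divff ?mulr1// gt_eqF.
  by apply: ge0_ler_powR; rewrite ?nnegrE ?powR_ge0 ?mulr_ge0 ?invr_ge0 ?(ltW r0).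
have {}TJ : T <= K * ((K' * J) `^ ((1 - r) / r) * J).
  by apply: le_trans TJ _; rewrite ler_wpM2l// ler_wpM2r.
apply: (@le_trans _ _ ((K * ((K' * J) `^ ((1 - r) / r) * J)) `^ r)).
  by apply: ge0_ler_powR; rewrite ?nnegrE ?mulr_ge0 ?powR_ge0 ?(ltW r0).
rewrite (powRM _ K0) ?mulr_ge0 ?powR_ge0// (powRM _ (powR_ge0 _ _) J0) -powRrM divfK ?gt_eqF//.
rewrite (powRM _ K'0 J0).
by rewrite [X in _ <= _ * X](powR_split J0 r0) !mulrA.
Qed.

Lemma triple_le (p q t c h : R) : 0 <= h -> p * q <= c * t ->
  (p%:E * (q * h)%:E <= c%:E * (t * h)%:E)%E.
Proof. by move=> h0 pq; rewrite -!EFinM lee_fin !mulrA ler_wpM2r. Qed.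

Variables (r a K B : R) (H T : 'rV[R]_n * 'rV[R]_n -> R).
Hypotheses (r0 : 0 < r) (r1 : r <= 1) (a0 : 0 <= a) (K0 : 0 < K).
Hypotheses (mH : measurable_fun setT H) (H0 : forall w, 0 <= H w) (HB : forall w, H w <= B).
Hypothesis T0 : forall w, 0 <= T w.

Definition jker (b : R) (z w : 'rV[R]_n * 'rV[R]_n) : R :=
  jbr (z.1 - w.1) `^ (- b) * jbr (z.2 - w.2) `^ (- b).
Let nu := prodm (leb R n) (leb R n).

Lemma jker_ge0 b z w : 0 <= jker b z w.
Proof. by rewrite mulr_ge0 ?powR_ge0. Qed.

Lemma jker_le1 b z w : 0 <= b -> jker b z w <= 1.
Proof.
move=> b0; have H1 (x : 'rV[R]_n) : jbr x `^ (- b) <= 1.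
  rewrite [leRHS](_ : 1 = jbr x `^ 0); last by rewrite powRr0.
  by apply: ler_powR; rewrite ?jbr_ge1 ?oppr_le0.
by rewrite mulr_ile1 ?powR_ge0.
Qed.

Lemma measurable_jker b z : measurable_fun setT (jker b z).
Proof.
by apply: measurable_funM; apply: measurable_jbr_powR; exact: measurable_rVsub.
Qed.

(** Submultiplicativity up to a constant: it lets a bound at v be transferred to one at z. *)
Lemma jker_mul_le z v w : jker a z v * jker a v w <= 2 `^ a * 2 `^ a * jker a z w.
Proof.
rewrite /jker mulrACA [leRHS]mulrACA; apply: ler_pM.
- exact: mulr_ge0 (powR_ge0 _ _) (powR_ge0 _ _).
- exact: mulr_ge0 (powR_ge0 _ _) (powR_ge0 _ _).
- by have := jbr_powR_mul_le (z.1 - v.1) (v.1 - w.1) a0; rewrite addrA subrK.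
- by have := jbr_powR_mul_le (z.2 - v.2) (v.2 - w.2) a0; rewrite addrA subrK.
Qed.

Lemma jker_powR b c z w : jker b z w `^ c = jker (b * c) z w.
Proof.
rewrite /jker; move: (jbr (z.1 - w.1)) (jbr (z.2 - w.2)) => p q.
by rewrite powRM ?powR_ge0// -!powRrM mulNr.
Qed.

(** For fixed z, multiplying the bound for H at v by [jker a z v] and applying [jker_mul_le] bounds
    the supremum M by the same integral S that bounds T; then [self_improve] applies to M and T
    together. *)
Lemma reproducing_power :
  (forall z, ((H z)%:E <= K%:E * \int[nu]_w (jker a z w * H w)%:E)%E) ->
  (forall z, ((T z)%:E <= K%:E * \int[nu]_w (jker a z w * H w)%:E)%E) -> forall z,
  ((T z `^ r)%:E <= (K `^ r * (K * (2 `^ a * 2 `^ a)) `^ (1 - r))%:E *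
     \int[nu]_w (jker (a * r) z w * H w `^ r)%:E)%E.
Proof.
move=> HK TK z.
set K' := K * _; set J := (\int[nu]_w _)%E.
have K'0 : 0 < K' by rewrite !mulr_gt0 ?powR_gt0.
have J0 : (0 <= J)%E by apply: integral_ge0 => w _; rewrite lee_fin mulr_ge0 ?jker_ge0 ?powR_ge0.
have c0 : 0 < K `^ r * K' `^ (1 - r) by rewrite mulr_gt0 ?powR_gt0.
have [->|] := eqVneq J +oo%E; first by rewrite gt0_muley ?lte_fin// leey.
rewrite -ltey => Joo; have JE : J = (fine J)%:E by rewrite fineK// ge0_fin_numE.
pose E := [set jker a z w * H w | w in [set: 'rV[R]_n * 'rV[R]_n]].
have E0 : E !=set0 by exists (jker a z (0, 0) * H (0, 0)); exists (0, 0).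
(* Finiteness of the supremum: [jker] is at most 1 and H is at most B. *)
have Eb : has_ubound E.
  exists B => _ [w _ <-]; apply: le_trans (HB w).
  by rewrite ler_piMl ?jker_le1.
pose M := sup E.
have ME w : jker a z w * H w <= M by apply: ub_le_sup => //; exists w.
have M0 : 0 <= M by apply: le_trans (ME (0, 0)); rewrite mulr_ge0 ?jker_ge0.
have mJ : measurable_fun setT (fun w => (jker (a * r) z w * H w `^ r)%:E).
  apply/measurable_EFinP; apply: measurable_funM; first exact: measurable_jker.
  exact: (measurableT_comp (measurable_powR _) mH).
pose S := (\int[nu]_w (jker a z w * H w)%:E)%E.
have SJ : (S <= (M `^ (1 - r) * fine J)%:E)%E.
  rewrite EFinM -JE -ge0_integralZl_EFin//; last 2 first.
  - by move=> w _; rewrite lee_fin mulr_ge0 ?jker_ge0 ?powR_ge0.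
  - exact: powR_ge0.
  apply: ge0_le_integral_nm => w; first by rewrite lee_fin mulr_ge0 ?jker_ge0.
  have jH : 0 <= jker a z w * H w by rewrite mulr_ge0 ?jker_ge0.
  rewrite -EFinM lee_fin [leLHS](powR_split jH r0).
  apply: ler_pM; rewrite ?powR_ge0//.
    by apply: ge0_ler_powR; rewrite ?nnegrE ?subr_ge0.
  by rewrite (powRM _ (jker_ge0 _ _ _) (H0 _)) jker_powR.
rewrite JE -EFinM lee_fin; apply: (self_improve r0 r1 (ltW K0) (ltW K'0) M0 _ (T0 z)).
- by rewrite fine_ge0.
- apply: ge_sup => // _ [v _ <-].
  rewrite -lee_fin EFinM; apply: (@le_trans _ _ (K'%:E * S)%E); last first.
    by rewrite (EFinM K'); apply: lee_wpmul2l; rewrite // lee_fin ltW.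
  apply: (@le_trans _ _ ((jker a z v)%:E * (K%:E * \int[nu]_w (jker a v w * H w)%:E))%E).
    by apply: lee_wpmul2l; rewrite ?lee_fin ?jker_ge0.
  rewrite muleCA /K' (EFinM K) -muleA; apply: lee_wpmul2l; first by rewrite lee_fin ltW.
  have mjH u : measurable_fun setT (fun w => (jker a u w * H w)%:E).
    by apply/measurable_EFinP; apply: measurable_funM => //; exact: measurable_jker.
  have jH0 u w : (0 <= (jker a u w * H w)%:E)%E by rewrite lee_fin mulr_ge0 ?jker_ge0.
  have c20 : 0 <= 2 `^ a * 2 `^ a :> R by rewrite mulr_ge0 ?powR_ge0.
  rewrite /S -(ge0_integralZl_EFin _ measurableT (fun w _ => jH0 v w) (mjH v) (jker_ge0 a z v)).
  rewrite -(ge0_integralZl_EFin _ measurableT (fun w _ => jH0 z w) (mjH z) c20).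
  apply: ge0_le_integral_nm => w; first by apply: mule_ge0; rewrite // lee_fin jker_ge0.
  exact: triple_le (H0 w) (jker_mul_le z v w).
- rewrite -lee_fin; apply: le_trans (TK z) _.
  by rewrite (EFinM K); apply: lee_wpmul2l; rewrite // lee_fin ltW.
Qed.
End reproducing_power.

(** * Mixed quasi-norm estimate *)

Section mixed_norm_bound.
Variable R : realType.

Lemma le_Lpn n (p : \bar R) (g h : 'rV[R]_n -> \bar R) : (0 < p)%E ->
  (forall x, 0 <= g x)%E -> (forall x, g x <= h x)%E -> (Lpn p g <= Lpn p h)%E.
Proof.
move=> p0 g0 gh; rewrite /Lpn; case: ifPn => [_|poo].
  by apply: ereal_inf_le_tmp => t /=; apply: nulln_le => x /= /lt_le_trans; apply.
have fp : 0 <= fine p by rewrite fine_ge0// ltW.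
apply: gt0_ler_poweR; rewrite ?invr_ge0// ?in_itv/= ?leey ?andbT.
- by apply: iint_ge0 => x; exact: poweR_ge0.
- by apply: iint_ge0 => x; exact: poweR_ge0.
apply: le_iint => x; first exact: poweR_ge0.
by apply: gt0_ler_poweR; rewrite ?in_itv/= ?leey ?andbT//; exact: le_trans (gh x).
Qed.

Lemma Lpn_ge0 n (p : \bar R) (h : 'rV[R]_n -> R) : (forall x, 0 <= h x) ->
  (0 <= Lpn p (fun x => (h x)%:E))%E.
Proof.
move=> h0; rewrite /Lpn; case: ifPn => _; first exact: esssupn_ge0.
exact: poweR_ge0.
Qed.

(** M r > n and q >= r give M q > n. This is what makes the inner norms finite for Schwartz data. *)
Lemma Lpn_jbr_lty n (q : \bar R) (r B M : R) : 0 < r -> (r%:E <= q)%E -> n%:R < M * r -> 0 <= B ->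
  (Lpn q (fun z : 'rV[R]_n => (B * jbr z `^ (- M))%:E) < +oo)%E.
Proof.
move=> r0 rq nM B0.
have M0 : 0 <= M by rewrite -(pmulr_lge0 _ r0) (le_trans _ (ltW nM)).
rewrite /Lpn; case: ifPn => [_|].
  apply: (@le_lt_trans _ _ B%:E); last by rewrite ltry.
  apply: esssupn_le => z; rewrite lee_fin ler_piMr//.
  rewrite [leRHS](_ : 1 = jbr z `^ 0); last by rewrite powRr0.
  by apply: ler_powR; rewrite ?jbr_ge1 ?oppr_le0.
case: q rq => [q|//|//]; rewrite lee_fin => rq _ /=.
have q0 : 0 < q by exact: lt_le_trans rq.
apply: poweR_lty.
have mj : measurable_fun setT (fun z : 'rV[R]_n => (B * jbr z `^ (- M)) `^ q).
  apply: (measurableT_comp (measurable_powR _)); apply: measurable_funM => //.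
  exact: measurable_jbr_powR.
rewrite iintE; [|exact/measurable_EFinP|by move=> z; rewrite lee_fin powR_ge0].
under eq_integral do rewrite powRM ?powR_ge0// -powRrM mulNr EFinM.
rewrite ge0_integralZl_EFin ?powR_ge0//; last first.
- by apply/measurable_EFinP; exact: measurable_jbr_powR.
- by move=> z _; rewrite lee_fin powR_ge0.
- by rewrite IjbrE -?EFinM ?ltry//; apply: lt_le_trans nM _; rewrite ler_wpM2l.
Qed.

(** For finite q this is Tonelli's theorem. For q = +oo, N y <= c says that the section at y of the
    set where H exceeds c is null, and the measure of a section depends measurably on y. *)
Lemma measurable_Lpn m n (q : \bar R) (H : 'rV[R]_m * 'rV[R]_n -> R) (N : 'rV[R]_m -> R) :
  measurable_fun setT H -> (forall w, 0 <= H w) -> (0 < q)%E ->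
  (forall y, Lpn q (fun z => (H (y, z))%:E) = (N y)%:E) -> measurable_fun setT N.
Proof.
move=> mH H0; case: q => [q q0 HN|_ HN|//]; last first.
  have NE y c : (N y <= c) <-> leb R n [set z | c < H (y, z)] = 0%E.
    split => [Nc|l0].
      apply: esssupn_null; first exact: (measurableT_comp mH (measurable_pair1 y)).
      by have := HN y; rewrite /Lpn eqxx => ->; rewrite lee_fin.
    rewrite -lee_fin -HN /Lpn eqxx; apply: ereal_inf_lbound; rewrite /= /nulln.
    have mS : measurable [set z | c < H (y, z)].
      have := (measurableT_comp mH (measurable_pair1 y)) measurableT _ (@measurable_itv R `]c, +oo[); rewrite setTI.
      by rewrite (_ : _ @^-1` _ = [set z | c < H (y, z)])//; apply/seteqP; split => z /=; rewrite in_itv/= andbT.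
    rewrite (_ : [set x | _] = [set z | c < H (y, z)]); last by apply/seteqP; split => z /=; rewrite lte_fin.
    rewrite iintE//; first by rewrite integral_indic// setIT.
    by apply/measurable_EFinP; exact: measurable_indic.
  apply: (measurability _ (RGenOInfty.measurableE R)) => _ [_ [c ->] <-]; rewrite setTI.
  have mS : measurable [set w | c < H w].
    have := mH measurableT _ (@measurable_itv R `]c, +oo[); rewrite setTI.
    by rewrite (_ : _ @^-1` _ = [set w | c < H w])//; apply/seteqP; split => z /=; rewrite in_itv/= andbT.
  have mX := measurable_fun_xsection (leb R n) mS.
  rewrite (_ : _ @^-1` _ = ~` ((leb R n \o xsection [set w | c < H w]) @^-1` [set 0%E])).
    apply: measurableC; rewrite -[X in measurable X]setTI; exact: mX.
  apply/seteqP; split => y /=; rewrite in_itv/= andbT ltNge (_ : xsection _ y = [set z | c < H (y, z)]).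
  - by move=> /negP Nc l0; apply: Nc; exact/NE.
  - by apply/seteqP; split => z; rewrite /xsection /= inE.
  - by move=> l0; apply/negP => Nc; apply: l0; exact/NE.
  - by apply/seteqP; split => z; rewrite /xsection /= inE.
apply/measurable_EFinP; rewrite (_ : EFin \o N = (fun y => Lpn q%:E (fun z => (H (y, z))%:E))).
  rewrite /Lpn /=.
  have mHq : measurable_fun setT (fun w => (H w `^ q)%:E).
    by apply/measurable_EFinP; exact: (measurableT_comp (measurable_powR _) mH).
  have Hq0 w : (0 <= (H w `^ q)%:E)%E by rewrite lee_fin powR_ge0.
  rewrite (_ : (fun y => _) = (fun y => (\int[leb R n]_z (H (y, z) `^ q)%:E) `^ q^-1)%E).
    apply: (measurableT_comp (measurable_poweR _)).
    exact: (measurable_fun_fubini_tonelli_F _ mHq Hq0).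
  apply/funext => y; rewrite iintE//.
  exact: (measurableT_comp mHq (measurable_pair1 y)).
by apply/funext => y /=; rewrite HN.
Qed.

Lemma integral_leb0 (f : 'rV[R]_0 -> \bar R) : measurable_fun setT f -> (forall x, 0 <= f x)%E ->
  (\int[leb R 0]_x f x = f (0%R : 'rV[R]_0))%E.
Proof. by move=> mf f0; rewrite -iintE. Qed.

Lemma leb0_cst (c : R) : 0 <= c -> (\int[leb R 0]_x c%:E = c%:E)%E.
Proof. by move=> c0; rewrite integral_leb0//; exact: measurable_cst. Qed.

(** At each fixed x [Lpn_conv] bounds the inner norm by a convolution of N^r in x, and a second
    application bounds the outer norm. The decay of H makes the inner norms finite and uniformly
    bounded, so that N can be real-valued. *)
Lemma mixed_norm_bound n (p q : \bar R) (r b C1 : R) : 0 < r -> (r%:E <= p)%E -> (r%:E <= q)%E ->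
  n%:R < b -> 0 < C1 -> exists2 C, 0 < C & forall (H T : 'rV[R]_n * 'rV[R]_n -> R) (B M : R),
    measurable_fun setT H -> (forall w, 0 <= H w) -> (forall w, 0 <= T w) ->
    0 <= B -> n%:R < M * r -> (forall w, H w <= B * jbr w.2 `^ (- M)) ->
    (forall z, ((T z `^ r)%:E <= C1%:E * \int[prodm (leb R n) (leb R n)]_w (jker b z w * H w `^ r)%:E)%E) ->
    (Lpn p (fun x => Lpn q (fun xi => (T (x, xi))%:E)) <=
     C%:E * Lpn p (fun x => Lpn q (fun xi => (H (x, xi))%:E)))%E.
Proof.
move=> r0 rp rq nb C10.
have p0 : (0 < p)%E by apply: lt_le_trans rp; rewrite lte_fin.
have q0 : (0 < q)%E by apply: lt_le_trans rq; rewrite lte_fin.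
have ri : r^-1 != 0 by rewrite gt_eqF ?invr_gt0.
pose I := @Ijbr R n b.
have I0 : 0 <= I by exact: Ijbr_ge0.
(* One factor I per application of [Lpn_conv], and the constant C1 once; the summand 1 ensures
   positivity. *)
pose C := (I * (I * C1)) `^ r^-1 + 1.
exists C => [|H T B M mH H0 T0 B0 nM HB HT]; first by rewrite ltr_wpDl// powR_ge0.
have C0 : 0 < C by rewrite ltr_wpDl// powR_ge0.
have M0 : 0 <= M by rewrite -(pmulr_lge0 _ r0) (le_trans _ (ltW nM)).
have HB' w : H w <= B.
  apply: le_trans (HB w) _; rewrite ler_piMr//.
  rewrite [leRHS](_ : 1 = jbr w.2 `^ 0); last by rewrite powRr0.
  by apply: ler_powR; rewrite ?jbr_ge1 ?oppr_le0.
pose B2 := fine (Lpn q (fun z : 'rV[R]_n => (B * jbr z `^ (- M))%:E)).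
have B2E : Lpn q (fun z : 'rV[R]_n => (B * jbr z `^ (- M))%:E) = B2%:E.
  rewrite fineK// ge0_fin_numE; first exact: (Lpn_jbr_lty r0).
  by apply: Lpn_ge0 => z; rewrite mulr_ge0 ?powR_ge0.
pose N y := fine (Lpn q (fun z => (H (y, z))%:E)).
have Nge y : (0 <= Lpn q (fun z => (H (y, z))%:E))%E by exact: Lpn_ge0.
have NB2 y : (Lpn q (fun z => (H (y, z))%:E) <= B2%:E)%E.
  by rewrite -B2E; apply: le_Lpn => // z; rewrite lee_fin ?HB.
have NE y : Lpn q (fun z => (H (y, z))%:E) = (N y)%:E.
  by rewrite fineK// ge0_fin_numE//; apply: le_lt_trans (NB2 y) _; rewrite ltry.
have mN : measurable_fun setT N by exact: (measurable_Lpn mH H0 q0 NE).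
have N0 y : 0 <= N y by rewrite fine_ge0.
have NB y : N y <= B2 by rewrite -lee_fin -NE.
rewrite [in leRHS](_ : (fun x => Lpn q _) = (fun x => (N x)%:E)); last by apply/funext => y; exact: NE.
have [->|] := eqVneq (Lpn p (fun x => (N x)%:E)) +oo%E; first by rewrite gt0_muley ?lte_fin// leey.
rewrite -ltey => NNoo.
pose NN := fine (Lpn p (fun x => (N x)%:E)).
have NNge : (0 <= Lpn p (fun x => (N x)%:E))%E by exact: Lpn_ge0.
have NNE : Lpn p (fun x => (N x)%:E) = NN%:E by rewrite fineK// ge0_fin_numE.
have NN0 : 0 <= NN by rewrite fine_ge0.
pose k (z : 'rV[R]_n) := jbr z `^ (- b).
have mk : measurable_fun setT k by exact: measurable_jbr_powR.
have k0 z : 0 <= k z by exact: powR_ge0.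
have kI : (\int[leb R n]_z (k z)%:E = I%:E)%E by exact: IjbrE.
have mkx (x : 'rV[R]_n) : measurable_fun setT (fun y : 'rV[R]_n => C1 * k (x - y)).
  by apply: measurable_funM => //; apply: (measurableT_comp mk); exact: measurable_rVB.
have kx0 (x y : 'rV[R]_n) : 0 <= C1 * k (x - y) by rewrite mulr_ge0// ltW.
have kxA (x : 'rV[R]_n) : (\int[leb R n]_y (C1 * k (x - y))%:E = (C1 * I)%:E)%E.
  under eq_integral do rewrite EFinM.
  have mkE : measurable_fun setT (fun y => (k y)%:E) by exact/measurable_EFinP.
  have kE0 y : (0 <= (k y)%:E)%E by rewrite lee_fin.
  rewrite ge0_integralZl_EFin ?(ltW C10)//; last first.
    exact: (measurableT_comp mkE (measurable_rVB x)).
  by rewrite (integral_rVB x mkE kE0) kI.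
have mNr : measurable_fun setT (fun y => N y `^ r) by exact: (measurableT_comp (measurable_powR _) mN).
have mkN x : measurable_fun setT (fun y : 'rV[R]_n => (C1 * k (x - y) * N y `^ r)%:E).
  by apply/measurable_EFinP; exact: measurable_funM.
have kN0 x y : (0 <= (C1 * k (x - y) * N y `^ r)%:E)%E by rewrite lee_fin mulr_ge0 ?powR_ge0.
have kNoo x : (\int[leb R n]_y (C1 * k (x - y) * N y `^ r)%:E < +oo)%E.
  apply: (@le_lt_trans _ _ (\int[leb R n]_y ((B2 `^ r)%:E * (C1 * k (x - y))%:E))%E).
    apply: ge0_le_integral_nm => y; first exact: kN0.
    rewrite -EFinM lee_fin mulrC; apply: (ler_wpM2r (kx0 x y)).
    apply: (ge0_ler_powR (ltW r0) _ _ (NB y)); rewrite nnegrE; first exact: N0.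
    exact: le_trans (N0 y) (NB y).
  rewrite ge0_integralZl_EFin ?powR_ge0//.
  - by rewrite kxA -EFinM ltry.
  - by move=> y _; rewrite lee_fin.
  - exact/measurable_EFinP.
pose X x := fine (\int[leb R n]_y (C1 * k (x - y) * N y `^ r)%:E).
have XE x : (\int[leb R n]_y (C1 * k (x - y) * N y `^ r)%:E = (X x)%:E)%E.
  by rewrite fineK// ge0_fin_numE//; apply: integral_ge0 => y _; exact: kN0.
have X0 x : 0 <= X x by rewrite fine_ge0//; apply: integral_ge0 => y _; exact: kN0.
have inner x : (Lpn q (fun xi => (T (x, xi))%:E) <= ((I * X x) `^ r^-1)%:E)%E.
  apply: (Lpn_conv r0 (mkx x) (kx0 x) (kxA x) mk k0 kI mH H0 HB' mN N0 (XE x) _ _ rq NE).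
    by move=> z; exact: T0.
  move=> z; apply: le_trans (HT (x, z)) _.
  rewrite -ge0_integralZl_EFin ?(ltW C10)//; last 2 first.
  - by move=> w _; rewrite lee_fin; apply: mulr_ge0; [exact: jker_ge0|exact: powR_ge0].
  - apply/measurable_EFinP; apply: measurable_funM; first exact: measurable_jker.
    exact: (measurableT_comp (measurable_powR _) mH).
  apply: ge0_le_integral_nm => w.
    by rewrite -EFinM lee_fin; apply: mulr_ge0; [exact: ltW|apply: mulr_ge0; [exact: jker_ge0|exact: powR_ge0]].
  by rewrite -EFinM lee_fin /jker /= /k !mulrA.
apply: le_trans (le_Lpn p0 _ inner) _; first by move=> x; apply: Lpn_ge0 => z; exact: T0.
pose kk := fun _ : 'rV[R]_0 => I * C1.
have IC : 0 <= I * C1 by rewrite mulr_ge0// ltW.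
have kkA : (\int[leb R 0]_y (kk y)%:E = (I * C1)%:E)%E.
  exact: leb0_cst.
have kkX : (\int[leb R 0]_y (kk y * (fun=> NN) y `^ r)%:E = (I * C1 * NN `^ r)%:E)%E.
  exact: (leb0_cst (mulr_ge0 IC (powR_ge0 _ _))).
have outer : (Lpn p (fun x => ((I * X x) `^ r^-1)%:E) <= ((I * (I * C1 * NN `^ r)) `^ r^-1)%:E)%E.
  (* The outer norm is the case of a one-point inner space. *)
  apply: (@Lpn_conv R 0 n r (I * C1) I B2 _ kk k (fun w => N w.2) (fun=> NN)) => //.
  - exact: measurable_cst.
  - exact: (measurableT_comp mN measurable_snd).
  - by move=> z; exact: powR_ge0.
  - move=> x; rewrite -powRrM mulVf ?gt_eqF// powRr1 ?mulr_ge0//.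
    have mF : measurable_fun setT (fun w : 'rV[R]_0 * 'rV[R]_n => (kk w.1 * k (x - w.2) * N w.2 `^ r)%:E).
      apply/measurable_EFinP; apply: measurable_funM; last exact: (measurableT_comp mNr measurable_snd).
      apply: measurable_funM => //; apply: (measurableT_comp mk).
      exact: (measurableT_comp (measurable_rVB x) measurable_snd).
    have F0 (w : 'rV[R]_0 * 'rV[R]_n) : (0 <= (kk w.1 * k (x - w.2) * N w.2 `^ r)%:E)%E.
      by rewrite lee_fin; apply: mulr_ge0; [exact: mulr_ge0 IC (k0 _)|exact: powR_ge0].
    rewrite (integral_prodm _ _ mF F0) integral_leb0; last 2 first.
    + exact: (measurable_fun_fubini_tonelli_F _ mF F0).
    + by move=> y; apply: integral_ge0 => z _; exact: F0 (y, z).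
    rewrite EFinM -XE -ge0_integralZl_EFin//.
    by rewrite le_eqVlt; apply/orP; left; apply/eqP; apply: eq_integral => y _; rewrite -EFinM !mulrA.
apply: le_trans outer _; rewrite NNE -EFinM lee_fin (mulrA I) powRM ?mulr_ge0 ?powR_ge0//.
by rewrite -powRrM divff ?gt_eqF// powRr1// ler_wpM2r// lerDl.
exact: ltW.
Qed.

End mixed_norm_bound.

(** * Assembling the estimates *)

Section assembly.
Variable R : realType.

Lemma dotexp_spec (p : \bar R) : (0 < p)%E ->
  [/\ 0 < dotexp p, dotexp p <= 1 & ((dotexp p)%:E <= p)%E].
Proof.
case: p => [p| |]//; rewrite /dotexp; last first.
  by move=> _; rewrite (min_idPl _) ?leey//= ltr01 lexx leey.
rewrite lte_fin => p0; have [p1|p1] := leP 1%E p%:E => /=.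
  by rewrite ltr01 lexx.
by rewrite p0 lexx ltW//; rewrite lte_fin in p1.
Qed.

Lemma wien_le n (N C C' : R) (B : 'rV[R]_n -> R[i]) : C <= C' -> wien N C B -> wien N C' B.
Proof.
move=> CC [b [bi BE bC]]; exists b; split => //.
by apply: filterS bC => z /le_trans; apply; rewrite ler_wpM2r ?powR_ge0.
Qed.

(** On the frequency side the transform integrates F f against a Gaussian around xi, so the decay of
    F f passes to xi uniformly in x. *)
Lemma stft_schwartz_decay n (L : R) (f : 'rV[R]_n -> R[i]) : schwartz f ->
  exists2 C, 0 <= C & forall x xi, normc (stft f x xi) <= C * jbr xi `^ (- L).
Proof.
move=> sf; have [C C0 HC] := fourier_schwartz L sf.
have [D D0 HD] := @jbr_gauss_le R n (- L) 1 (n%:R + 1) ltr01.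
have n1 : n%:R < n%:R + 1 :> R by rewrite ltrDl.
have Fi : cL1 (fourier f).
  have [C' C'0 HC'] := fourier_schwartz (n%:R + 1) sf.
  exact: (cL1_jbr n1 (cmfun_fourier (schwartz_cmfun sf)) HC').
exists (2 * (C * D * @Ijbr R n (n%:R + 1))) => [|x xi].
  by rewrite !mulr_ge0 ?Ijbr_ge0// ltW.
have {1}-> : f = (fun y => cint (fun eta => fourier f eta * cexpi (2 * pi * dotp y eta))).
  apply/funext => y; rewrite (schwartz_inversion y sf).
  by apply: eq_cint => eta; rewrite dotpC.
rewrite stft_synthesis// -lee_fin.
have mE : cmfun (fun eta => fourier f eta * RtoC (gauss 1 (eta - xi)) * cexpi (2 * pi * dotp x (eta - xi))).
  apply: cmfunM; first apply: (cmfunM Fi.1).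
    by apply: cmfun_RtoC; apply: measurable_gauss; exact: measurable_rVD.
  by apply: cmfun_ebr => //; exact: measurable_rVD.
apply: le_trans (normc_cint mE) _.
have mj : measurable_fun setT (fun y : 'rV[R]_n => (jbr y `^ (- (n%:R + 1)))%:E).
  by apply/measurable_EFinP; exact: measurable_jbr_powR.
have j0 (y : 'rV[R]_n) : (0 <= (jbr y `^ (- (n%:R + 1)))%:E)%E by rewrite lee_fin powR_ge0.
have k0 : 0 <= C * D * jbr xi `^ (- L) by rewrite !mulr_ge0 ?powR_ge0// ltW.
rewrite [leRHS](_ : _ = 2%:E * ((C * D * jbr xi `^ (- L))%:E * (Ijbr n (n%:R + 1))%:E))%E; last first.
  by rewrite -!EFinM; congr EFin; move: (jbr xi `^ _) (Ijbr _ _) => u v; ring.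
apply: lee_wpmul2l => //.
rewrite -(IjbrE n1) -(integral_rVD (- xi) mj j0) -(ge0_integralZl_EFin _ measurableT _ _ k0)//; last first.
  exact: (measurableT_comp mj (measurable_rVD (- xi))).
apply: ge0_le_integral_nm => eta; first by rewrite lee_fin normc_ge0.
rewrite -EFinM lee_fin !Normc.normcM normc_cexpi mulr1 normc_RtoC (ger0_norm (gauss_ge0 _ _)).
apply: (@le_trans _ _ (C * jbr eta `^ (- L) * gauss 1 (eta - xi))).
  by rewrite ler_wpM2r ?gauss_ge0.
by rewrite -!mulrA ler_wpM2l// !mulrA.
Qed.

Lemma integral_prodm_swap n (f : 'rV[R]_n * 'rV[R]_n -> R) : measurable_fun setT f -> (forall w, 0 <= f w) ->
  (\int[leb R n]_z \int[leb R n]_y (f (y, z))%:E = \int[prodm (leb R n) (leb R n)]_w (f w)%:E)%E.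
Proof.
move=> mf f0; rewrite integral_prodm.
- by rewrite (fubini_tonelli (fun w => (f w)%:E))//; exact/measurable_EFinP.
- exact/measurable_EFinP.
- by move=> w; rewrite lee_fin.
Qed.

(** Brings the output of [stft_convolution] into the form of H integrated against [jker]. The factor
    e stands for the weight at xi, which is <xi>^0 for T and <xi>^delta for H. *)
Lemma weighted_stft_bound n (a de t K D e V : R) (x xi : 'rV[R]_n) (f : 'rV[R]_n -> R[i]) :
  cmfun f -> 0 <= K -> 0 <= D -> 0 <= e ->
  (forall z : 'rV[R]_n, e * (jbr z `^ t * gauss 2^-1 (z - xi)) <= D * (jbr z `^ de * jbr (xi - z) `^ (- a))) ->
  (V%:E <= K%:E * \int[leb R n]_z \int[leb R n]_y
     (normc (stft f y z) * (jbr z `^ t * gauss 2^-1 (z - xi) * jbr (x - y) `^ (- a)))%:E)%E ->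
  ((V * e)%:E <= (K * D)%:E * \int[prodm (leb R n) (leb R n)]_w
     (jker a (x, xi) w * (normc (stft f w.1 w.2) * jbr w.2 `^ de))%:E)%E.
Proof.
move=> mf K0 D0 e0 De VK.
pose P (w : 'rV[R]_n * 'rV[R]_n) :=
  normc (stft f w.1 w.2) * (jbr w.2 `^ t * gauss 2^-1 (w.2 - xi) * jbr (x - w.1) `^ (- a)).
have mV : measurable_fun setT (fun w : 'rV[R]_n * 'rV[R]_n => normc (stft f w.1 w.2)).
  by apply: cmfun_normc; exact: cmfun_stft.
have mP : measurable_fun setT P.
  apply: measurable_funM => //; apply: measurable_funM; first apply: measurable_funM.
  - exact: measurable_jbr_powR.
  - by apply: measurable_gauss; exact: measurable_rVsub.
  - by apply: measurable_jbr_powR; exact: measurable_rVsub.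
have P0 w : 0 <= P w by rewrite !mulr_ge0 ?normc_ge0 ?powR_ge0 ?gauss_ge0.
set I2 := (\int[_]_w _)%E.
suff I12 : (e%:E * \int[prodm (leb R n) (leb R n)]_w (P w)%:E <= D%:E * I2)%E.
  move: VK I12; rewrite (integral_prodm_swap mP P0).
  move: (\int[_]_w (P w)%:E)%E I2 => I1 I2 VK I12.
  rewrite mulrC EFinM; apply: (@le_trans _ _ (e%:E * (K%:E * I1))%E); first exact: lee_wpmul2l.
  by rewrite muleCA (EFinM K) -(muleA K%:E); exact: lee_wpmul2l.
rewrite /I2.
have mPE : measurable_fun setT (fun w => (P w)%:E) by exact/measurable_EFinP.
have mQ : measurable_fun setT (fun w => (jker a (x, xi) w * (normc (stft f w.1 w.2) * jbr w.2 `^ de))%:E).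
  apply/measurable_EFinP; apply: measurable_funM; first exact: measurable_jker.
  by apply: measurable_funM => //; exact: measurable_jbr_powR.
have Q0 w : (0 <= (jker a (x, xi) w * (normc (stft f w.1 w.2) * jbr w.2 `^ de))%:E)%E.
  by rewrite lee_fin mulr_ge0 ?jker_ge0// mulr_ge0 ?normc_ge0 ?powR_ge0.
have PE0 w : (0 <= (P w)%:E)%E by rewrite lee_fin.
rewrite -(ge0_integralZl_EFin _ measurableT (fun w _ => PE0 w) mPE e0).
rewrite -(ge0_integralZl_EFin _ measurableT (fun w _ => Q0 w) mQ D0).
apply: ge0_le_integral_nm => w; first by rewrite -EFinM lee_fin mulr_ge0.
rewrite -!EFinM lee_fin /P /jker; cbn [fst snd].
have := De w.2; have := normc_ge0 (stft f w.1 w.2); have := powR_ge0 (jbr (x - w.1)) (- a).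
move: (normc _) (jbr (x - _) `^ _) (jbr w.2 `^ t * _) (jbr w.2 `^ de) (jbr (xi - _) `^ _) => v j1 u j2 j3 j10 v0 H.
rewrite (_ : e * (v * (u * j1)) = v * j1 * (e * u)); last by ring.
rewrite (_ : D * (j1 * j3 * (v * j2)) = v * j1 * (D * (j2 * j3))); last by ring.
by rewrite ler_wpM2l// mulr_ge0.
Qed.

End assembly.

Theorem theorem1p2 (R : realType) (n : nat) (p q : \bar R)
    (mu : 'rV[R]_n -> R) (s eps : R) :
  (0 < p)%E -> (0 < q)%E ->
  C1 mu -> 0 < s -> 0 < eps ->
  (forall j : 'I_n,
     inW +oo%E +oo%E (n%:R / Num.min (dotexp p) (dotexp q) + eps)
       (fun xi => RtoC (jbr xi `^ (- s) * 'D_(ebasis R j) mu xi))) ->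
  forall delta : R, s * n%:R / Num.min (dotexp p) (dotexp q) < delta ->
  exists C : R, 0 < C /\
    forall f : 'rV[R]_n -> R[i], schwartz f ->
      (Wnorm p q 0 (eimuD mu f) <= C%:E * Wnorm p q delta f)%E.
Proof.
move=> p0 q0 muC s0 eps0; have [rp0 rp1 rpp] := dotexp_spec p0; have [rq0 rq1 rqq] := dotexp_spec q0.
set r := Num.min _ _ => mW de sde.
have r0 : 0 < r by rewrite lt_min rp0.
have r1 : r <= 1 by rewrite ge_min rp1.
have rp : (r%:E <= p)%E by apply: le_trans rpp; rewrite lee_fin ge_min lexx.
have rq : (r%:E <= q)%E by apply: le_trans rqq; rewrite lee_fin ge_min lexx orbT.
clearbody r.
set N := n%:R / r + eps in mW.
have nr : n%:R <= n%:R / r :> R by rewrite ler_pdivlMr// ler_piMr.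
have nN : n%:R < N by rewrite (le_lt_trans nr)// ltrDl.
have /choice[Cj HCj] : forall j : 'I_n, exists C, 0 <= C /\ forall xi : 'rV[R]_n,
    exists2 x0 : 'rV[R]_n, dotp (x0 - xi) (x0 - xi) <= 1 &
    wien N C (fun y => RtoC (jbr y `^ (- s) * 'D_(ebasis R j) mu y) * RtoC (gauss 1 (y - x0))).
  move=> j; have cg : continuous (fun y => jbr y `^ (- s) * 'D_(ebasis R j) mu y).
    by move=> y; exact: (continuousM (@continuous_jbr_powR R n (- s) y) (muC.2 j y)).
  by have [C C0 HC] := inW_wien nN cg (mW j); exists C.
(* A sum in place of a maximum, to have one constant for all directions. *)
pose Cg := \sum_j Cj j.
have Cg0 : 0 <= Cg by apply: sumr_ge0 => j _; case: (HCj j).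
have Hg (j : 'I_n) (xi : 'rV[R]_n) : exists2 x0 : 'rV[R]_n, dotp (x0 - xi) (x0 - xi) <= 1 &
    wien N Cg (fun y => RtoC (jbr y `^ (- s) * 'D_(ebasis R j) mu y) * RtoC (gauss 1 (y - x0))).
  have [_ /(_ xi)[x0 x01 W]] := HCj j; exists x0 => //; apply: wien_le W.
  by rewrite /Cg (bigD1 j)//= lerDl sumr_ge0// => i _; case: (HCj i).
(* The largest exponent within both constraints; strictness of the bound on delta and eps > 0 keep
   it above n / r. *)
pose a := Num.min (de / s) N.
have an : n%:R / r < a by rewrite lt_min ltrDl eps0 andbT ltr_pdivlMr// mulrAC (mulrC n%:R).
have a0 : 0 <= a by apply: le_trans (ltW an); exact: le_trans nr.
have aN : a <= N by rewrite ge_min lexx orbT.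
have sa : s * a <= de by rewrite mulrC -ler_pdivlMr// ge_min lexx.
have nar : n%:R < a * r by rewrite -ltr_pdivrMr.
have de0 : 0 <= de by apply: le_trans sa; rewrite mulr_ge0// ltW.
clearbody a.
have [c c2 [C C0 HC]] := fourier_gauss_decay nN s0 Cg0 muC Hg a0 aN.
have c0 : 0 < c by exact: lt_le_trans c2.
have mu_m : measurable_fun setT mu.
  by apply: continuous_measurable_rV => x; apply: differentiable_continuous; exact: muC.1.
have mw : cmfun (fun y => cexpi (mu y)) by exact: cmfun_cexpi.
have w1 y : normc (cexpi (mu y)) <= 1 by rewrite normc_cexpi.
have [K1 K10 HK1] := stft_convolution nN a0 aN c0 (ltW C0) mw w1 HC.
(* The multiplier 1 with t = 0: the same convolution bound then estimates V f by itself. *)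
have [C' C'0 HC'] := @fourier_gauss_le R n a 1 ltr01.
have HC1 (xi x : 'rV[R]_n) : normc (fourier (fun y => RtoC (gauss 1 (y - xi)) * 1) x) <=
    C' * jbr xi `^ 0 * jbr x `^ (- a).
  by rewrite powRr0 mulr1; under eq_fun do rewrite mulr1; exact: HC'.
have nc1 (y : 'rV[R]_n) : normc (1 : R[i]) <= 1 by rewrite Normc.normc1.
have [K2 K20 HK2] := stft_convolution nN a0 aN ltr01 (ltW C'0) (@cmfun_cst _ _ _ 1) nc1 HC1.
have h0 : 0 < 2^-1 :> R by rewrite invr_gt0.
have [D1 D10 HD1] := @gauss_le_jbr R n 2^-1 a h0.
(* Of the order a + delta, delta is spent on moving the weight from xi to z, and a remains for the
   kernel. *)
have [D2 D20 HD2] := @gauss_le_jbr R n 2^-1 (a + de) h0.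
(* One constant for both bounds; the summand 1 makes it positive. *)
pose K := K1 * D1 + K2 * (2 `^ de * D2) + 1.
have K0 : 0 < K by rewrite ltr_wpDl// addr_ge0// mulr_ge0 ?mulr_ge0 ?powR_ge0// ltW.
pose CC := K `^ r * (K * (2 `^ a * 2 `^ a)) `^ (1 - r).
have CC0 : 0 < CC by rewrite mulr_gt0 ?powR_gt0// !mulr_gt0 ?powR_gt0.
have [Cf Cf0 HCf] := mixed_norm_bound r0 rp rq nar CC0.
exists Cf; split => // f sf.
have fi := schwartz_cL1 sf.
have Fi : cL1 (fourier f).
  have [B B0 HB] := fourier_schwartz (n%:R + 1) sf.
  by apply: (cL1_jbr _ (cmfun_fourier fi.1) HB); rewrite ltrDl.
pose H (w : 'rV[R]_n * 'rV[R]_n) := normc (stft f w.1 w.2) * jbr w.2 `^ de.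
pose T (w : 'rV[R]_n * 'rV[R]_n) := normc (stft (eimuD mu f) w.1 w.2) * jbr w.2 `^ 0.
have H0 w : 0 <= H w by rewrite mulr_ge0 ?normc_ge0 ?powR_ge0.
have T0 w : 0 <= T w by rewrite mulr_ge0 ?normc_ge0 ?powR_ge0.
have mH : measurable_fun setT H.
  apply: measurable_funM; first by apply: cmfun_normc; exact: cmfun_stft fi.1.
  exact: measurable_jbr_powR.
(* M r = n + 1 exceeds n, as the inner norms of H require. V f is taken to decay to order M + delta,
   so that H, which carries the weight, decays to order M. *)
pose M := (n%:R + 1) / r.
have nM : n%:R < M * r by rewrite divfK ?gt_eqF// ltrDl.
have [B B0 HB] := stft_schwartz_decay (M + de) sf.
have HBM w : H w <= B * jbr w.2 `^ (- M).
  rewrite (_ : - M = - (M + de) + de); last by ring.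
  rewrite powRD ?(gt_eqF (jbr_gt0 _)) ?implybT// mulrA.
  by rewrite ler_wpM2r ?powR_ge0.
pose S (z : 'rV[R]_n * 'rV[R]_n) := (\int[prodm (leb R n) (leb R n)]_w (jker a z w * H w)%:E)%E.
have S0 z : (0 <= S z)%E by apply: integral_ge0 => w _; rewrite lee_fin mulr_ge0 ?jker_ge0.
have gN (z xi : 'rV[R]_n) : gauss 2^-1 (z - xi) = gauss 2^-1 (xi - z) by rewrite -gaussN opprB.
have TK z : ((T z)%:E <= K%:E * S z)%E.
  apply: (@le_trans _ _ ((K1 * D1)%:E * S z)%E); last first.
    apply: lee_wpmul2r => //; rewrite lee_fin /K -addrA lerDl addr_ge0// !mulr_ge0 ?powR_ge0//.
    exact: ltW.
  case: z => x xi; apply: (weighted_stft_bound fi.1 K10 (ltW D10) _ _ (HK1 f fi Fi x xi)); first exact: powR_ge0.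
  move=> z; rewrite powRr0 mul1r gN mulrCA; apply: ler_pM; rewrite ?powR_ge0 ?gauss_ge0//.
  by apply: ler_powR; first exact: jbr_ge1.
(* Fourier inversion: the multiplier 1 is the identity on Schwartz functions. *)
have fE : (fun u => cint (fun eta => 1 * fourier f eta * cexpi (2 * pi * dotp u eta))) = f.
  apply/funext => u; rewrite (schwartz_inversion u sf).
  by apply: eq_cint => eta; rewrite mul1r dotpC.
have HK z : ((H z)%:E <= K%:E * S z)%E.
  apply: (@le_trans _ _ ((K2 * (2 `^ de * D2))%:E * S z)%E); last first.
    apply: lee_wpmul2r => //; rewrite lee_fin /K addrAC lerDr addr_ge0// mulr_ge0//.
    exact: ltW.
  case: z => x xi; have VK := HK2 f fi Fi x xi; rewrite fE in VK.
  apply: (weighted_stft_bound fi.1 K20 _ _ _ VK); rewrite ?powR_ge0 ?mulr_ge0 ?powR_ge0 ?(ltW D20)//.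
  move=> z; rewrite powRr0 mul1r gN.
  have jE : jbr xi `^ de <= 2 `^ de * (jbr z `^ de * jbr (xi - z) `^ de).
    by have := jbr_powRD de z (xi - z); rewrite addrC subrK ger0_norm.
  apply: (@le_trans _ _ (2 `^ de * (jbr z `^ de * jbr (xi - z) `^ de) * (D2 * jbr (xi - z) `^ (- (a + de))))).
    by apply: ler_pM; rewrite ?powR_ge0 ?gauss_ge0.
  rewrite (_ : - a = de + - (a + de)); last by ring.
  rewrite [X in _ <= _ * (_ * X)]powRD ?(gt_eqF (jbr_gt0 _)) ?implybT//.
  rewrite le_eqVlt; apply/orP; left; apply/eqP.
  by move: (2 `^ de) (jbr z `^ de) (jbr (xi - z) `^ de) (jbr (xi - z) `^ (- _)) => u1 u2 u3 u4; ring.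
have HB' w : H w <= B.
  apply: le_trans (HBM w) _; rewrite ler_piMr//.
  rewrite [leRHS](_ : 1 = jbr w.2 `^ 0); last by rewrite powRr0.
  by apply: ler_powR; rewrite ?jbr_ge1// oppr_le0 divr_ge0 ?addr_ge0// ltW.
have TH := reproducing_power r0 r1 a0 K0 mH H0 HB' T0 HK TK.
exact: (HCf H T B M mH H0 T0 B0 nM HBM TH).
Qed.
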